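(* Let $V\subset\mathbb{R}^d$ be a non-empty, bounded, open set such that every point of $\partial V$ satisfies Poincaré's condition, and let $f:\partial V\to\mathbb{R}$ be continuous. For $0<r<1$ define $h:\overline{V}\to\mathbb{R}$ by $h(v)=f(v)$ for $v\in\partial V$ and $h(v)=E[f(X_r^v(\infty))]$ for $v\in V$. Then $h$ is well defined (it does not depend on the choice of $r\in(0,1)$) and it is a solution to the Dirichlet problem for $(V,f)$: $h$ is continuous on $\overline{V}$, $h=f$ on $\partial V$, and $h$ has in $V$ continuous partial derivatives of second order with $\Delta h(x)=\sum_{k=1}^d\frac{\partial^2 h(x)}{\partial x_k^2}=0$ for all $x\in V$.
   Context: $\mathbb{R}^d$ carries the Euclidean norm $\|\cdot\|$; $B_s(u)=\{y\in\mathbb{R}^d:\|y-u\|<s\}$ for $s>0$; $d(x,A)=\inf\{\|x-y\|:y\in A\}$. A point $v\in\partial V$ satisfies Poincaré's condition if there is a ball $B_s(u)$ such that $\overline{V}\cap\overline{B_s(u)}=\{v\}$. Let $\vartheta_1,\vartheta_2,\dots$ be independent, identically distributed random variables on a probability space $(\Omega,\mathcal{F},P)$, uniformly distributed on the unit sphere $S_1(0)=\{y\in\mathbb{R}^d:\|y\|=1\}$; $E$ denotes expectation with respect to $P$. For $v\in V$ and $0<r<1$ define $X_r^v(1)=v$ and $X_r^v(n+1)=X_r^v(n)+r\,d(X_r^v(n),\partial V)\,\vartheta_n$ for $n\ge 1$. This sequence converges almost surely, and $X_r^v(\infty)$ denotes its almost sure limit, which lies in $\partial V$ almost surely. *)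

(* Defs.v *)
From mathcomp Require Import all_boot all_order all_algebra finmap.
From mathcomp Require Import all_classical all_reals all_analysis.

Set Implicit Arguments.
Unset Strict Implicit.
Unset Printing Implicit Defensive.

Import Order.TTheory GRing.Theory Num.Theory.
Import numFieldNormedType.Exports.

Local Open Scope classical_set_scope.
Local Open Scope ring_scope.

(* R^d is 'rV[R]_d.  The library norm `|x| on row vectors is the sup norm; it
   induces the usual topology and the usual bounded sets, so the library notions
   of open, closure, continuity, limit and bounded_set are used directly.  All
   metric quantities (spheres, balls, distances) use the Euclidean norm below. *)
Definition eucl_norm (R : realType) (d : nat) (x : 'rV[R]_d) : R :=
  Num.sqrt (\sum_(i < d) x ord0 i ^+ 2).

Definition eucl_ball (R : realType) (d : nat) (u : 'rV[R]_d) (s : R) :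
    set 'rV[R]_d :=
  [set y | eucl_norm (y - u) < s].

Definition unit_sphere (R : realType) (d : nat) : set 'rV[R]_d :=
  [set y | eucl_norm y = 1].

Definition eucl_dist (R : realType) (d : nat) (x : 'rV[R]_d)
    (A : set 'rV[R]_d) : R :=
  inf [set eucl_norm (x - y) | y in A].

Definition boundary (T : topologicalType) (A : set T) : set T :=
  closure A `\` A°.

Definition poincare_condition (R : realType) (d : nat) (V : set 'rV[R]_d)
    (v : 'rV[R]_d) : Prop :=
  exists (u : 'rV[R]_d) (s : R),
    0 < s /\ closure V `&` closure (eucl_ball u s) = [set v].

(* R^d with its Borel sigma-algebra. *)
Definition borelRd (R : realType) (d : nat) :=
  g_sigma_algebraType (@open 'rV[R]_d).

(* The uniform distribution on the unit sphere is the unique Borel probability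
   measure carried by the sphere and invariant under all orthogonal maps
   y |-> y *m Q. *)
Definition uniform_on_sphere (R : realType) (d : nat)
    (mu : set (borelRd R d) -> \bar R) : Prop :=
  mu (@unit_sphere R d) = 1%E /\
  forall (Q : 'M[R]_d) (A : set (borelRd R d)), Q *m Q^T = 1%:M ->
    measurable A -> mu ((fun y : 'rV[R]_d => y *m Q) @^-1` A) = mu A.

Section random_variables.
Context {disp disp' : measure_display} {Omega : measurableType disp}
  {E : measurableType disp'} {R : realType} (P : probability Omega R).

Definition mutually_independent (X : nat -> {RV P >-> E}) : Prop :=
  forall (J : {fset nat}) (A : nat -> set E), (forall i, measurable (A i)) ->
    P (\bigcap_(i in [set` J]) (X i @^-1` A i)) =
    (\prod_(i <- J) P (X i @^-1` A i))%E.

Definition identically_distributed (X : nat -> {RV P >-> E}) : Prop :=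
  forall i j (A : set E), measurable A ->
    distribution P (X i) A = distribution P (X j) A.

End random_variables.

(* The index is shifted by one: walk V r v t n is X_r^v(n+1) and t n is
   theta_(n+1), where t is a realization of the sequence of directions. *)
Fixpoint walk (R : realType) (d : nat) (V : set 'rV[R]_d) (r : R) (v : 'rV[R]_d)
    (t : nat -> 'rV[R]_d) (n : nat) : 'rV[R]_d :=
  match n with
  | 0 => v
  | m.+1 => let x := walk V r v t m in x + (r * eucl_dist x (boundary V)) *: t m
  end.

Section dirichlet.
Context {R : realType} {d : nat}.
Implicit Types (V : set 'rV[R]_d) (f h : 'rV[R]_d -> R) (r : R).

Definition partial (i : 'I_d) h : 'rV[R]_d -> R := 'D_(delta_mx ord0 i) h.

Definition laplacian h : 'rV[R]_d -> R :=
  fun x => \sum_(k < d) partial k (partial k h) x.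

Definition C2_on V h : Prop :=
  forall x, V x -> forall i j : 'I_d,
    [/\ derivable h x (delta_mx ord0 i),
        derivable (partial i h) x (delta_mx ord0 j) &
        {for x, continuous (partial j (partial i h))}].

Definition dirichlet_solution V f h : Prop :=
  [/\ {within closure V, continuous h},
      (forall v, boundary V v -> h v = f v),
      C2_on V h &
      (forall x, V x -> laplacian h x = 0)].

Context {disp : measure_display} {Omega : measurableType disp}
  {P : probability Omega R}.
Implicit Type theta : nat -> {RV P >-> borelRd R d}.

Definition walk_path V r v theta (w : Omega) : nat -> 'rV[R]_d :=
  walk V r v (fun n => theta n w).

Definition walk_limit V r v theta (w : Omega) : 'rV[R]_d :=
  lim (walk_path V r v theta w n @[n --> \oo]).

(* f is only meaningful on the boundary of V; it is extended by 0 elsewhere,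
   which is relevant only on the null event that the limit does not exist or is
   not in the boundary. *)
Definition exit_value V f r v theta (w : Omega) : R :=
  patch (cst 0) (boundary V) f (walk_limit V r v theta w).

(* The values of this function outside closure V are irrelevant. *)
Definition walk_solution V f r theta (v : 'rV[R]_d) : R :=
  if v \in boundary V then f v else fine 'E_P[exit_value V f r v theta].

(* X_r^v(oo) exists and lies in the boundary of V almost surely, and the
   expectation of f(X_r^v(oo)) makes sense. *)
Definition exit_value_well_defined V f r v theta : Prop :=
  {ae P, forall w, cvgn (walk_path V r v theta w) /\
                   boundary V (walk_limit V r v theta w)} /\
  P.-integrable [set: Omega] (EFin \o exit_value V f r v theta).

End dirichlet.

(* Main.v *)
Require Import Defs.
From HB Require Import structures.
From mathcomp Require Import all_boot all_order all_algebra finmap.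
From mathcomp Require Import ring lra.
From mathcomp Require Import all_classical all_reals all_analysis measurable_realfun.

Set Implicit Arguments.
Unset Strict Implicit.
Unset Printing Implicit Defensive.

Import Order.TTheory GRing.Theory Num.Theory.
Import numFieldNormedType.Exports.

Local Open Scope classical_set_scope.
Local Open Scope ring_scope.

(** Let sigma be the law of one direction. A solution u of the Dirichlet problem is
    built by Perron's method: the Poisson integral of a ball is harmonic because the
    kernel is, subharmonicity is taken in the viscosity sense, so that comparison is
    a second-derivative test, and an exterior ball at a boundary point carries the
    barrier exp(- alpha s^2) - exp(- alpha |x - c|^2).  By construction u has the mean
    value property on the balls inside V.

    Each step has mean zero given the past, so E |X_n - v|^2 is the sum of the
    E (r d(X_k, bd V))^2, k < n.  As V is bounded this series converges; Kolmogorov's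
    maximal inequality then makes X_n almost surely Cauchy, and d(X_n, bd V) tends to 0
    along a subsequence, so the limit lies on the boundary.  The mean value property
    makes u(X_n) a bounded martingale, whence u(v) = E u(X_n) -> E f(X_oo): the
    function h of the theorem is u, whatever r. *)

(** * Euclidean norm *)

Section Euclid.
Context {R : realType} {d : nat}.
Implicit Types x y z u v w : 'rV[R]_d.

(** The uniform law enters only through its mass on the sphere and its invariance under orthogonal
    maps. So the Poisson kernel is normalised by symmetry and comparison, and a step is centred
    because z -> - z is orthogonal.

    A supremum of subharmonic functions need not be continuous. Replacing competitors by their
    Poisson integrals in a fixed ball gives them a common modulus of continuity at the centre, which
    passes to the supremum; compactness then yields one competitor uniformly close to it on a
    sphere, and with it the mean value property, without monotone limits of harmonic functions.

    Independence is given for the directions only: that the position at time n is independent of the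
    direction then used is derived from rectangles, and Fubini's theorem acts as conditional
    expectation. The maximal inequality is about a stretch of the path; a second chain, stopped once
    it is too far away, reduces it to one time. Directions off the sphere and missing limits form
    null events, but the integrands must be measurable everywhere, hence the indicators and the
    extensions by zero. *)

Definition dot x y : R := \sum_(i < d) x ord0 i * y ord0 i.

Lemma dotC x y : dot x y = dot y x.
Proof. by apply: eq_bigr => i _; rewrite mulrC. Qed.

Lemma dotDl x y z : dot (x + y) z = dot x z + dot y z.
Proof. by rewrite /dot -big_split; apply: eq_bigr => i _; rewrite mxE mulrDl. Qed.

Lemma dotZl a x y : dot (a *: x) y = a * dot x y.
Proof. by rewrite /dot mulr_sumr; apply: eq_bigr => i _; rewrite mxE mulrA. Qed.

Lemma dotDr x y z : dot z (x + y) = dot z x + dot z y.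
Proof. by rewrite dotC dotDl !(dotC z). Qed.

Lemma dotZr a x y : dot y (a *: x) = a * dot y x.
Proof. by rewrite dotC dotZl (dotC y). Qed.

Lemma dotNl x y : dot (- x) y = - dot x y.
Proof. by rewrite -scaleN1r dotZl mulN1r. Qed.

Lemma dotNr x y : dot y (- x) = - dot y x.
Proof. by rewrite dotC dotNl (dotC y). Qed.

Lemma dotBl x y z : dot (x - y) z = dot x z - dot y z.
Proof. by rewrite dotDl dotNl. Qed.

Lemma dotBr x y z : dot z (x - y) = dot z x - dot z y.
Proof. by rewrite dotDr dotNr. Qed.

Lemma dot0l x : dot 0 x = 0.
Proof. by rewrite -(scale0r 0) dotZl mul0r. Qed.

Lemma dot_ge0 x : 0 <= dot x x.
Proof. by apply: sumr_ge0 => i _; rewrite -expr2 sqr_ge0. Qed.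

Lemma dot_delta x i : dot x (delta_mx ord0 i) = x ord0 i.
Proof.
rewrite /dot (bigD1 i)//= mxE !eqxx mulr1 big1 ?addr0// => j ji.
by rewrite mxE (negbTE ji) andbF mulr0.
Qed.

Lemma eucl_normE x : eucl_norm x = Num.sqrt (dot x x).
Proof. by rewrite /eucl_norm; congr Num.sqrt; apply: eq_bigr => i _; rewrite expr2. Qed.

Lemma eucl_norm_ge0 x : 0 <= eucl_norm x.
Proof. exact: sqrtr_ge0. Qed.

Lemma sqr_eucl_norm x : eucl_norm x ^+ 2 = dot x x.
Proof. by rewrite eucl_normE sqr_sqrtr// dot_ge0. Qed.

(** The squared norm of (y.y) x - (x.y) y is y.y times the difference of the two sides; the case y.y
    = 0 is treated apart. *)
Lemma CauchySchwarz_sqr x y : dot x y ^+ 2 <= dot x x * dot y y.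
Proof.
have := dot_ge0 (dot y y *: x - dot x y *: y).
rewrite !(dotBl, dotBr, dotZl, dotZr) (dotC y x).
have [y0|yn0] := eqVneq (dot y y) 0.
  have y00 i : y ord0 i = 0.
    move/eqP: y0; rewrite /dot psumr_eq0; last by move=> j _; rewrite -expr2 sqr_ge0.
    by move=> /allP/(_ i); rewrite mem_index_enum => /(_ isT)/=; rewrite mulf_eq0 orbb => /eqP.
  move=> _; suff -> : dot x y = 0 by rewrite y0 mulr0 expr0n.
  by rewrite /dot big1// => i _; rewrite y00 mulr0.
have y0 : 0 < dot y y by rewrite lt_neqAle eq_sym yn0 dot_ge0.
move=> h; rewrite -subr_ge0 -(pmulr_rge0 _ y0).
by apply: le_trans h _; rewrite le_eqVlt; apply/orP; left; apply/eqP; ring.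
Qed.

Lemma CauchySchwarz x y : dot x y <= eucl_norm x * eucl_norm y.
Proof.
rewrite !eucl_normE -sqrtrM ?dot_ge0//.
apply: le_trans (ler_norm _) _; rewrite -sqrtr_sqr ler_sqrt ?mulr_ge0 ?dot_ge0//.
exact: CauchySchwarz_sqr.
Qed.

Lemma eucl_normD x y : eucl_norm (x + y) <= eucl_norm x + eucl_norm y.
Proof.
rewrite -(ler_pXn2r (n := 2))// ?nnegrE ?addr_ge0 ?eucl_norm_ge0//.
rewrite sqr_eucl_norm sqrrD !sqr_eucl_norm dotDl !dotDr (dotC y x).
have := CauchySchwarz x y; lra.
Qed.

Lemma eucl_normZ a x : eucl_norm (a *: x) = `|a| * eucl_norm x.
Proof. by rewrite !eucl_normE dotZl dotZr mulrA -expr2 sqrtrM ?sqr_ge0// sqrtr_sqr. Qed.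

Lemma eucl_normN x : eucl_norm (- x) = eucl_norm x.
Proof. by rewrite -scaleN1r eucl_normZ normrN1 mul1r. Qed.

Lemma eucl_distC x y : eucl_norm (x - y) = eucl_norm (y - x).
Proof. by rewrite -eucl_normN opprB. Qed.

Lemma eucl_norm0 : eucl_norm (0 : 'rV[R]_d) = 0.
Proof. by rewrite eucl_normE dot0l sqrtr0. Qed.

Lemma eucl_dist_triangle x y z :
  eucl_norm (x - z) <= eucl_norm (x - y) + eucl_norm (y - z).
Proof. by apply: le_trans (eucl_normD _ _); rewrite addrA subrK. Qed.

Lemma ler_eucl_norm_dist x y : `|eucl_norm x - eucl_norm y| <= eucl_norm (x - y).
Proof.
rewrite ler_norml; have := eucl_normD (x - y) y; have := eucl_normD (y - x) x.
rewrite !subrK (eucl_distC y); lra.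
Qed.

Lemma ler_coord_eucl x i : `|x ord0 i| <= eucl_norm x.
Proof.
rewrite eucl_normE -sqrtr_sqr ler_sqrt ?dot_ge0// /dot (bigD1 i)//= -expr2 lerDl.
by apply: sumr_ge0 => j _; rewrite -expr2 sqr_ge0.
Qed.

Lemma ler_coord_norm x i : `|x ord0 i| <= `|x|.
Proof.
rewrite [leRHS]/Num.norm /= mx_normrE.
by apply: (le_bigmax_cond _ (fun ij => `|x ij.1 ij.2|) (j := (ord0, i))).
Qed.

Lemma ler_norm_eucl x : `|x| <= eucl_norm x.
Proof.
rewrite [leLHS]/Num.norm /= mx_normrE; apply/bigmax_leP; split; first exact: eucl_norm_ge0.
by case=> i j _ /=; rewrite (ord1 i) ler_coord_eucl.
Qed.

(** The crude factor d in place of sqrt d keeps roots out of the statement; it comes from d <= d^2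
    for natural numbers. *)
Lemma ler_eucl_norm x : eucl_norm x <= d%:R * `|x|.
Proof.
rewrite -(ler_pXn2r (n := 2))// ?nnegrE ?mulr_ge0 ?eucl_norm_ge0//.
rewrite sqr_eucl_norm exprMn /dot.
have h (i : 'I_d) (_ : true) : x ord0 i * x ord0 i <= `|x| ^+ 2.
  by rewrite -expr2 -real_normK ?num_real// ler_pXn2r// ?nnegrE// ler_coord_norm.
apply: le_trans (ler_sum _ h) _; rewrite sumr_const card_ord -[leLHS]mulr_natl.
rewrite ler_wpM2r ?sqr_ge0// expr2; case: (d) => [|n]; first by rewrite mulr0.
by rewrite -natrM ler_nat leq_pmull.
Qed.

Lemma continuous_eucl_norm : continuous (@eucl_norm R d).
Proof.
move=> x; apply/(@cvgrPdist_lt _ _ _ (nbhs x)) => e e0.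
have d0 : (0 : R) < d.+1%:R by rewrite ltr0n.
apply/nbhs_ballP; exists (e / d.+1%:R) => /=; first exact: divr_gt0.
move=> y; rewrite -ball_normE /= ltr_pdivlMr// mulrC => xy.
apply: le_lt_trans (ler_eucl_norm_dist _ _) _; apply: le_lt_trans (ler_eucl_norm _) _.
by apply: le_lt_trans xy; rewrite ler_wpM2r// ler_nat.
Qed.

Lemma continuous_eucl_dist_pt u : continuous (fun x => eucl_norm (x - u)).
Proof.
move=> x; apply: (@continuous_comp _ _ _ (fun x => x - u) (@eucl_norm R d)).
  exact: (@cvgB _ _ _ (nbhs x) _ id (cst u) x u cvg_id (cvg_cst _)).
exact: continuous_eucl_norm.
Qed.

(** Bridge between the topology, given by the sup norm, and the Euclidean balls in which the
    estimates are made. *)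
Lemma nbhs_eucl (x : 'rV[R]_d) (A : set 'rV[R]_d) :
  nbhs x A <-> exists2 e : R, 0 < e & eucl_ball x e `<=` A.
Proof.
split=> [/nbhs_ballP[e /= e0 eA]|[e e0 eA]].
  exists e => // y /= ye; apply: eA; rewrite -ball_normE /=.
  by apply: le_lt_trans (ler_norm_eucl _) _; rewrite eucl_distC.
have := @continuous_eucl_dist_pt x x.
move=> /(@cvgrPdist_lt _ _ _ (nbhs x))/(_ _ e0); apply: filterS => y.
rewrite subrr eucl_norm0 add0r normrN ger0_norm ?eucl_norm_ge0// => ye.
exact: eA.
Qed.

Lemma open_eucl_ball u (s : R) : open (eucl_ball u s).
Proof.
have -> : eucl_ball u s = (fun x => eucl_norm (x - u)) @^-1` [set t | t < s] by [].
by apply: open_comp; [move=> x _; exact: continuous_eucl_dist_pt|exact: open_lt].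
Qed.

Definition eucl_cball u (s : R) := [set y | eucl_norm (y - u) <= s].

Lemma closed_eucl_cball u (s : R) : closed (eucl_cball u s).
Proof.
have -> : eucl_cball u s = (fun x => eucl_norm (x - u)) @^-1` [set t | t <= s] by [].
by apply: closed_comp; [move=> x _; exact: continuous_eucl_dist_pt|exact: closed_le].
Qed.

Lemma bounded_eucl (A : set 'rV[R]_d) :
  bounded_set A <-> exists M : R, forall x, A x -> eucl_norm x <= M.
Proof.
split=> [[M [_ hM]]|[M hM]].
  exists (d%:R * (M + 1)) => x Ax; apply: le_trans (ler_eucl_norm _) _.
  by rewrite ler_wpM2l//; apply: hM => //; rewrite ltrDl.
exists M; split; first exact: num_real.
move=> N MN x Ax; apply: le_trans (ltW MN).
exact: le_trans (ler_norm_eucl _) (hM _ Ax).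
Qed.

Lemma compact_eucl_cball u (s : R) : compact (eucl_cball u s).
Proof.
apply: bounded_closed_compact; last exact: closed_eucl_cball.
apply/bounded_eucl; exists (s + eucl_norm u) => x; rewrite /eucl_cball /= => xs.
by have := eucl_normD (x - u) u; rewrite subrK; lra.
Qed.

Lemma compact_unit_sphere : compact (@unit_sphere R d).
Proof.
apply: (@subclosed_compact _ _ (eucl_cball 0 1)); [|exact: compact_eucl_cball|].
  have -> : @unit_sphere R d = (@eucl_norm R d) @^-1` [set 1] by [].
  by apply: closed_comp; [move=> x _; exact: continuous_eucl_norm|exact: closed_eq].
by move=> x /=; rewrite /unit_sphere /eucl_cball /= subr0 => ->.
Qed.

Lemma dot_coord_mulmx x y : (x *m y^T) ord0 ord0 = dot x y.
Proof. by rewrite mxE; apply: eq_bigr => i _; rewrite mxE. Qed.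

Lemma dot_mulmx (Q : 'M[R]_d) x y : Q *m Q^T = 1%:M -> dot (x *m Q) (y *m Q) = dot x y.
Proof.
move=> QQ; rewrite -!dot_coord_mulmx trmx_mul mulmxA -(mulmxA x) QQ.
by rewrite mulmx1.
Qed.

(** Together with the invariance of the uniform law, this makes the Poisson integral of a constant
    radial. *)
Lemma orthogonal_transitive x y : dot x x = dot y y ->
  exists2 Q : 'M[R]_d, Q *m Q^T = 1%:M & x *m Q = y.
Proof.
move=> xy; have [->|xny] := eqVneq x y.
  by exists 1%:M; rewrite ?trmx1 mulmx1.
pose w := x - y; pose q := dot w w.
have q0 : q != 0.
  rewrite /q -sqr_eucl_norm expf_neq0//; apply: contra xny => /eqP n0.
  by rewrite -subr_eq0 -normr_le0 -n0 ler_norm_eucl.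
(* Equality of the two norms enters here: it makes the coefficient of [w] in the reflected vector
   equal to 1, so that [x] goes to x - w = y. *)
have qE : q = 2 * dot x w.
  by rewrite /q /w !(dotBl, dotBr) (dotC y x) xy; ring.
have ww : w *m w^T = q%:M by rewrite [LHS]mx11_scalar dot_coord_mulmx.
(* the Householder reflection along w = x - y *)
exists (1%:M - (2 / q) *: (w^T *m w)).
  have -> : (1%:M - (2 / q) *: (w^T *m w))^T = 1%:M - (2 / q) *: (w^T *m w).
    by apply/matrixP => i j; rewrite !mxE eq_sym; congr (_ - _ * _); apply: eq_bigr => k _; rewrite !mxE mulrC.
  have : (w^T *m w) *m (w^T *m w) = q *: (w^T *m w).
    by rewrite mulmxA -(mulmxA w^T) ww mul_mx_scalar -scalemxAl.
  move: (w^T *m w) => M MM.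
  rewrite [LHS]mulmxBr mulmx1 mulmxBl mul1mx -scalemxAl -scalemxAr MM !scalerA.
  have -> : 2 / q * (2 / q) * q = 2 / q + 2 / q by field.
  by rewrite scalerDl opprB addrK subrK.
rewrite mulmxBr mulmx1 -scalemxAr mulmxA [x *m _]mx11_scalar dot_coord_mulmx.
rewrite mul_scalar_mx scalerA.
have -> : 2 / q * dot x w = 1 by rewrite qE; field; rewrite -?qE; apply: contraNneq q0 => dd; rewrite qE dd mulr0.
by rewrite scale1r /w opprB addrC subrK.
Qed.

End Euclid.

(** * Borel sets and spherical means *)

Section BorelMeasurability.
Context {R : realType} {d : nat}.

Lemma borel_open (U : set 'rV[R]_d) : open U -> measurable (U : set (borelRd R d)).
Proof. by move=> oU; exact: sub_sigma_algebra. Qed.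

Lemma borel_closed (U : set 'rV[R]_d) : closed U -> measurable (U : set (borelRd R d)).
Proof.
by move=> /closed_openC/borel_open/measurableC; rewrite setCK.
Qed.

Lemma within_continuous_measurable (D : set 'rV[R]_d) (f : 'rV[R]_d -> R) :
  measurable (D : set (borelRd R d)) -> {within D, continuous f} ->
  measurable_fun (D : set (borelRd R d)) (f : borelRd R d -> R).
Proof.
move=> mD /continuousP cf; apply: (measurability _ (RGenOpens.measurableE R)).
move=> _ [_ [a [b ->] <-]].
have /open_subspaceP[U oU UE] := cf _ (@interval_open R (BRight a) (BLeft b) isT isT).
by rewrite setIC -UE; apply: measurableI => //; exact: borel_open.
Qed.

Lemma continuous_borel (f : 'rV[R]_d -> R) : continuous f ->
  measurable_fun setT (f : borelRd R d -> R).
Proof.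
by move=> cf; apply: within_continuous_measurable => //; exact: continuous_subspaceT.
Qed.

Lemma coord_borel (i : 'I_d) :
  measurable_fun setT (fun x : borelRd R d => (x : 'rV[R]_d) ord0 i).
Proof. by apply: continuous_borel; exact: coord_continuous. Qed.

(** Second countability in concrete form. The balls are those of the sup norm, that is, boxes, so
    the rational centre can be chosen coordinate by coordinate. *)
Lemma rational_ball (U : set 'rV[R]_d) (x : 'rV[R]_d) : open U -> U x ->
  exists (q : 'rV[rat]_d) (n : nat), ball (map_mx ratr q : 'rV[R]_d) n.+1%:R^-1 x /\
    ball (map_mx ratr q : 'rV[R]_d) n.+1%:R^-1 `<=` U.
Proof.
rewrite openE => oU /oU /nbhs_ballP[e /= e0 eU].
have [n ne] : exists n, n.+1%:R^-1 < e / 2 :> R.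
  have [N _ /(_ N (leqnn N))] := near_infty_natSinv_lt (PosNum (divr_gt0 e0 (ltr0n R 2))).
  by move=> h; exists N.
have n0 : 0 < n.+1%:R^-1 :> R by rewrite invr_gt0.
have /choice[q qP] (i : 'I_d) : exists q : rat, `|ratr q - x ord0 i| < n.+1%:R^-1.
  have [] := @rat_in_itvoo R (x ord0 i - n.+1%:R^-1) (x ord0 i + n.+1%:R^-1).
    by move: n0; set t := _^-1; lra.
  by move=> q; rewrite in_itv/= => qx; exists q; rewrite ltr_distl.
exists (\row_i q i), n; split.
  by split=> // i j; rewrite ord1 !mxE /ball /=; exact: qP.
move=> y [_ xy]; apply: eU; split=> // i j.
have := xy i j; rewrite ord1 !mxE /ball /= => yq.
have := qP j; move: (q j) yq => r yq xq.
rewrite (le_lt_trans (ler_distD (ratr r) _ _))// distrC.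
by move: ne yq xq; set t := _^-1; set a := `|_|; set b := `|_|; lra.
Qed.

(** An open set is a countable union of rational boxes, and the preimage of a box is a finite
    intersection of conditions on single coordinates. *)
Lemma measurable_fun_coord (dT : measure_display) (T : measurableType dT) (D : set T)
    (g : T -> borelRd R d) :
  (forall i : 'I_d, measurable_fun D (fun t => (g t : 'rV[R]_d) ord0 i)) ->
  measurable_fun D g.
Proof.
move=> mg mD; suff : measurable_fun D g by apply.
apply: (@measurability _ _ T (borelRd R d) D g (@open 'rV[R]_d)) => //.
move=> _ [U oU <-].
pose B (q : 'rV[rat]_d * nat) : set 'rV[R]_d := ball (map_mx ratr q.1 : 'rV[R]_d) q.2.+1%:R^-1.
pose J : set ('rV[rat]_d * nat) := [set q | B q `<=` U].
have -> : D `&` g @^-1` U = \bigcup_(q in J) (D `&` g @^-1` B q).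
  apply/seteqP; split=> [t [Dt /= Ut]|t [q Jq [Dt /Jq]]//].
  by have [q [n [? ?]]] := rational_ball oU Ut; exists (q, n).
rewrite bigcup_mkcond; apply: countable_bigcupT_measurable.
  exact: countableP.
move=> q; case: ifPn => // _.
have -> : D `&` g @^-1` B q = D `&` \bigcap_(i in @setT 'I_d)
    (D `&` [set t | `|(g t : 'rV[R]_d) ord0 i - ratr (q.1 ord0 i)| < q.2.+1%:R^-1]).
  apply/seteqP; split=> t [Dt /= Bt]; split=> //.
    by move=> i _; split=> //=; have [_ /(_ ord0 i)] := Bt; rewrite mxE /ball /= distrC.
  split; first by rewrite invr_gt0.
  by move=> i j; rewrite ord1 mxE /ball /= distrC; have [] := Bt j I.
apply: measurableI => //; apply: fin_bigcap_measurable => [|i _].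
  exact: finite_finset.
have : measurable_fun D (fun t => `|(g t : 'rV[R]_d) ord0 i - ratr (q.1 ord0 i)|).
  by apply: measurableT_comp => //; apply: measurable_funB.
move=> /(_ mD `]-oo, q.2.+1%:R^-1[%classic (measurable_itv _)).
by congr measurable; apply: congr1; apply/funext => t /=; rewrite in_itv.
Qed.

End BorelMeasurability.

Section SphereMean.
Context {R : realType} {d : nat} (sigma : probability (borelRd R d) R).
Hypothesis sigma_unif : uniform_on_sphere sigma.
Local Notation S := (@unit_sphere R d).
Implicit Types h k g : 'rV[R]_d -> R.

(** Continuity in the ambient space at the points of the sphere, not relative to the sphere: sums,
    products and compositions then follow pointwise from the ambient rules. *)
Definition sphere_continuous h := forall z, S z -> {for z, continuous h}.

Definition sphere_mean h : R := \int[sigma]_(z in (S : set (borelRd R d))) h z.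
Local Notation M := sphere_mean.

Lemma borel_unit_sphere : measurable (S : set (borelRd R d)).
Proof.
apply: borel_closed; apply: compact_closed (@compact_unit_sphere R d).
exact: norm_hausdorff.
Qed.
Local Hint Resolve borel_unit_sphere : core.

Lemma sphere_continuous_within h : sphere_continuous h -> {within S, continuous h}.
Proof. by move=> ch; apply: continuous_in_subspaceT => x /set_mem; exact: ch. Qed.

Lemma sphere_continuous_bounded h : sphere_continuous h ->
  exists C : R, 0 <= C /\ forall z, S z -> `|h z| <= C.
Proof.
move=> /sphere_continuous_within ch.
have /compact_bounded[C [_ hC]] := continuous_compact ch (@compact_unit_sphere R d).
exists (`|C| + 1); split; first by rewrite addr_ge0.
by move=> z Sz; apply: hC; [rewrite (le_lt_trans (ler_norm _))// ltrDl|exists z].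
Qed.

Lemma sphere_integrable h : sphere_continuous h ->
  sigma.-integrable (S : set (borelRd R d)) (EFin \o h).
Proof.
move=> ch; apply: measurable_bounded_integrable => //.
- by rewrite (le_lt_trans (probability_le1 sigma borel_unit_sphere)) ?ltry.
- by apply: within_continuous_measurable => //; exact: sphere_continuous_within.
have [C [C0 hC]] := sphere_continuous_bounded ch.
by exists C; split; [exact: num_real|move=> e Ce z Sz; apply: le_trans (hC _ Sz) (ltW Ce)].
Qed.

Lemma eq_sphere_mean h k : (forall z, S z -> h z = k z) -> M h = M k.
Proof. by move=> hk; apply: eq_Rintegral => z /set_mem; exact: hk. Qed.

Lemma sphere_meanD h k : sphere_continuous h -> sphere_continuous k ->
  M (fun z => h z + k z) = M h + M k.
Proof. by move=> ch ck; apply: RintegralD => //; exact: sphere_integrable. Qed.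

Lemma sphere_meanB h k : sphere_continuous h -> sphere_continuous k ->
  M (fun z => h z - k z) = M h - M k.
Proof. by move=> ch ck; apply: RintegralB => //; exact: sphere_integrable. Qed.

Lemma sphere_meanZ a h : sphere_continuous h -> M (fun z => a * h z) = a * M h.
Proof. by move=> ch; apply: RintegralZl => //; exact: sphere_integrable. Qed.

Lemma sphere_mean_le h k : sphere_continuous h -> sphere_continuous k ->
  (forall z, S z -> h z <= k z) -> M h <= M k.
Proof. by move=> ch ck hk; apply: le_Rintegral => //; exact: sphere_integrable. Qed.

Lemma sphere_mean_cst a : M (fun=> a) = a.
Proof.
rewrite /sphere_mean Rintegral_cst//.
by rewrite [X in fine X](_ : _ = 1%E) ?mulr1//; case: sigma_unif.
Qed.

Lemma sphere_continuous_cst a : sphere_continuous (fun=> a).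
Proof. by move=> z _; exact: cst_continuous. Qed.
Local Hint Resolve sphere_continuous_cst : core.

Lemma sphere_mean_norm_le h C : sphere_continuous h ->
  (forall z, S z -> `|h z| <= C) -> `|M h| <= C.
Proof.
move=> ch hC; rewrite ler_norml -[in X in X && _](sphere_mean_cst (- C)).
rewrite -[in X in _ && X](sphere_mean_cst C).
by apply/andP; split; apply: sphere_mean_le => // z /hC; rewrite ler_norml => /andP[].
Qed.

Lemma unit_sphere_mulmx (Q : 'M[R]_d) z : Q *m Q^T = 1%:M -> S (z *m Q) <-> S z.
Proof. by move=> QQ; rewrite /unit_sphere /= !eucl_normE dot_mulmx. Qed.

Lemma measurable_mulmx (Q : 'M[R]_d) :
  measurable_fun setT (fun z : borelRd R d => (z : 'rV[R]_d) *m Q : borelRd R d).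
Proof.
apply: measurable_fun_coord => i; under eq_fun do rewrite mxE.
apply: measurable_sum => j; apply: measurable_funM => //; exact: coord_borel.
Qed.

(** Change of variables: the image of [sigma] under the orthogonal map agrees with [sigma] on Borel
    sets, and the sphere is its own preimage. *)
Lemma sphere_mean_rot (Q : 'M[R]_d) h : Q *m Q^T = 1%:M -> sphere_continuous h ->
  M (fun z => h (z *m Q)) = M h.
Proof.
move=> QQ ch; pose phi (z : borelRd R d) : borelRd R d := (z : 'rV[R]_d) *m Q.
have mphi : measurable_fun setT phi by exact: measurable_mulmx.
have preS : phi @^-1` S = S by apply/seteqP; split=> z; case: (unit_sphere_mulmx z QQ).
(* [h] is controlled only on the sphere; its cut-off by zero is Borel on the whole space, so that it
   can be composed with [phi]. *)
pose g : borelRd R d -> R := patch (fun=> 0) S h.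
have gE z : S z -> g z = h z by move=> Sz; rewrite /g patchE mem_set.
have mg0 : measurable_fun setT g.
  apply/(measurable_restrictT _ borel_unit_sphere).
  by apply: within_continuous_measurable => //; exact: sphere_continuous_within.
have mg : measurable_fun setT (EFin \o g) by apply/measurable_EFinP.
rewrite /sphere_mean /Rintegral; congr fine.
transitivity (\int[pushforward sigma phi]_(z in (S : set (borelRd R d))) (EFin \o g) z)%E; last first.
  transitivity (\int[sigma]_(z in (S : set (borelRd R d))) (EFin \o g) z)%E.
    by apply: eq_measure_integral => A mA _; case: sigma_unif => _ inv; exact: (inv Q A QQ mA).
  by apply: eq_integral => z /set_mem Sz /=; rewrite gE.
have ig : sigma.-integrable (phi @^-1` S) ((EFin \o g) \o phi).
  rewrite preS; apply: measurable_bounded_integrable => //.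
  - by rewrite (le_lt_trans (probability_le1 sigma borel_unit_sphere)) ?ltry.
  - by apply: measurable_funTS; exact: (measurableT_comp mg0 mphi).
  have [C [C0 hC]] := sphere_continuous_bounded ch.
  exists C; split; first exact: num_real.
  move=> e Ce z Sz; apply: le_trans (ltW Ce).
  by rewrite /= gE; [apply: hC|]; apply/unit_sphere_mulmx.
rewrite integral_pushforward// preS; apply: eq_integral => z /set_mem Sz /=.
by rewrite gE//; apply/unit_sphere_mulmx.
Qed.

End SphereMean.

(** * Differentiation under the spherical mean *)

Section LineDerivative.
Context {R : realType} {V : normedModType R}.

Lemma is_derive_line (f : V -> R) (x v : V) (t df : R) :
  is_derive (t *: v + x) v f df -> is_derive t 1 (fun s : R => f (s *: v + x)) df.
Proof.
have eqf : (fun h : R => h^-1 *: (f (h *: v + (t *: v + x)) - f (t *: v + x))) =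
    (fun h : R => h^-1 *: (f ((h *: (1 : R) + t) *: v + x) - f (t *: v + x))).
  by apply/funext => h; rewrite [h *: 1]mulr1 scalerDl addrA.
case=> fv <-; apply: DeriveDef; first by move: fv; rewrite /derivable /= eqf.
by rewrite /derive /= -eqf.
Qed.

(** The range of [t] is symmetric, so a difference quotient can be handled without knowing the sign
    of [h]. *)
Lemma mvt_abs (g dg : R -> R) (h : R) :
  (forall t : R, `|t| <= `|h| -> is_derive t (1 : R) g (dg t)) ->
  exists2 t, `|t| <= `|h| & g h - g 0 = dg t * h.
Proof.
have MVTc (a b : R) : a < b ->
    (forall t : R, a <= t <= b -> is_derive t (1 : R) g (dg t)) ->
    exists2 t, a <= t <= b & g b - g a = dg t * (b - a).
  move=> ab dgt; have [t||t tab ->] := @MVT R g dg a b ab.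
  - by rewrite in_itv/= => /andP[at_ tb]; apply: dgt; rewrite !ltW.
  - apply: derivable_within_continuous => t; rewrite in_itv/= => tab.
    exact: (@ex_derive _ _ _ _ _ _ _ (dgt t tab)).
  - by exists t => //; move: tab; rewrite in_itv/= => /andP[at_ tb]; rewrite !ltW.
move=> dg_; have [h0|h0|->] := ltrgt0P h; last first.
- by exists 0; rewrite ?normr0 ?subrr ?mulr0.
- have [t|t /andP[ht t0] gE] := MVTc h 0 h0.
    by move=> /andP[ht t0]; apply: dg_; rewrite (ler0_norm t0) (ler0_norm (ltW h0)) lerN2.
  exists t; first by rewrite ler0_norm// lerN2.
  by rewrite -[LHS]opprB gE sub0r mulrN opprK.
- have [t|t /andP[ht t0] gE] := MVTc 0 h h0.
    by move=> /andP[ht t0]; apply: dg_; rewrite (ger0_norm ht) (ger0_norm (ltW h0)).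
  exists t; first by rewrite ger0_norm.
  by rewrite gE subr0.
Qed.

End LineDerivative.

Section Parametric.
Context {R : realType} {d : nat} (sigma : probability (borelRd R d) R).
Hypothesis sigma_unif : uniform_on_sphere sigma.
Local Notation S := (@unit_sphere R d).
Local Notation M := (sphere_mean sigma).
Implicit Types (k : 'rV[R]_d -> 'rV[R]_d -> R) (g : 'rV[R]_d -> R) (x : 'rV[R]_d).

Definition jointly_continuous k x := forall z, S z ->
  {for (x, z), continuous (fun p : 'rV[R]_d * 'rV[R]_d => k p.1 p.2)}.

Lemma jointly_continuous_sphere k x : jointly_continuous k x -> sphere_continuous (k x).
Proof.
move=> ck z /ck kz; apply: (@continuous_comp _ _ _ (fun z => (x, z)) (fun p => k p.1 p.2)) => //.
move=> A [[B C] /= [xB zC] BC]; apply: filterS zC => w Cw; apply: BC; split=> //.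
exact: nbhs_singleton xB.
Qed.

(** Compactness of the sphere makes joint continuity uniform in [z]. Near a given [z], both values
    are compared with [k x z], hence the halves of [e]. *)
Lemma jointly_continuous_uniform k x (e : R) : jointly_continuous k x -> 0 < e ->
  \forall y \near x, forall z, S z -> `|k y z - k x z| < e.
Proof.
move=> ck e0; have e20 : 0 < e / 2 by rewrite divr_gt0.
have cS := @compact_unit_sphere R d.
move/compact_near_coveringP : cS => /(_ _ (nbhs x) (fun y z => `|k y z - k x z| < e)).
apply=> z Sz; have [[A B] /= [xA zB] AB] : nbhs (x, z) [set p | `|k x z - k p.1 p.2| < e / 2].
  by have := ck _ Sz => /cvgrPdist_lt/(_ _ e20).
exists (B, A) => //= -[z' y] [/= Bz' Ay].
have := AB (y, z') (conj Ay Bz'); have := AB (x, z') (conj (nbhs_singleton xA) Bz').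
rewrite /= => h1 h2; apply: le_lt_trans (ler_distD (k x z) _ _) _.
by rewrite distrC; move: h1 h2; lra.
Qed.

Lemma sphere_continuousM h g : sphere_continuous h -> sphere_continuous g ->
  sphere_continuous (fun z => h z * g z).
Proof. by move=> ch cg z Sz; exact: (continuousM (ch _ Sz) (cg _ Sz)). Qed.

Lemma sphere_continuousB h g : sphere_continuous h -> sphere_continuous g ->
  sphere_continuous (fun z => h z - g z).
Proof. by move=> ch cg z Sz; exact: (continuousB (ch _ Sz) (cg _ Sz)). Qed.

Lemma sphere_continuousZ (a : R) g : sphere_continuous g ->
  sphere_continuous (fun z => a * g z).
Proof. by apply: sphere_continuousM => z _; exact: cst_continuous. Qed.

Lemma mean_kernel_continuous (U : set 'rV[R]_d) k g x : open U -> U x ->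
  (forall y, U y -> jointly_continuous k y) -> sphere_continuous g ->
  {for x, continuous (fun y => M (fun z => k y z * g z))}.
Proof.
move=> oU Ux ck cg; have [C [C0 gC]] := sphere_continuous_bounded cg.
apply/(@cvgrPdist_le _ _ _ (nbhs x)) => e e0.
(* [C + 1] is used as divisor because the bound [C] of [g] may be zero. *)
have e'0 : 0 < e / (C + 1) by rewrite divr_gt0// ltr_wpDl.
have := jointly_continuous_uniform (ck _ Ux) e'0.
apply: filterS2 (open_nbhs_nbhs (conj oU Ux)) => y Uy kyz.
have cx := jointly_continuous_sphere (ck _ Ux).
have cy := jointly_continuous_sphere (ck _ Uy).
rewrite -sphere_meanB; [|exact: sphere_continuousM..].
apply: (sphere_mean_norm_le sigma_unif).
  by apply: sphere_continuousB; exact: sphere_continuousM.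
move=> z Sz; rewrite -mulrBl normrM distrC.
apply: le_trans (_ : e / (C + 1) * C <= _).
  by apply: ler_pM => //; [rewrite ltW// kyz|exact: gC].
by rewrite mulrAC ler_pdivrMr ?ler_wpM2l//; lra.
Qed.

(** For each [z] the mean value theorem turns the difference quotient into [k1] at a point between
    [x] and its translate; by compactness this is close to [k1 x z] uniformly in [z], although the
    intermediate point depends on [z]. *)
Lemma mean_kernel_derive (U : set 'rV[R]_d) k k1 v g : open U ->
  (forall y, U y -> jointly_continuous k y) ->
  (forall y, U y -> jointly_continuous k1 y) ->
  (forall y z, U y -> S z -> is_derive y v (k^~ z) (k1 y z)) ->
  sphere_continuous g ->
  forall x, U x -> is_derive x v (fun y => M (fun z => k y z * g z))
    (M (fun z => k1 x z * g z)).
Proof.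
move=> oU ck ck1 dk cg x Ux; have [C [C0 gC]] := sphere_continuous_bounded cg.
suff : h^-1 *: (M (fun z => k (h *: v + x) z * g z) - M (fun z => k x z * g z))
    @[h --> 0^'] --> M (fun z => k1 x z * g z).
  move=> lim; apply: DeriveDef; first by apply/cvg_ex; eexists; exact: lim.
  by apply: cvg_lim => //; exact: lim.
apply/cvgrPdist_le => e e0.
have e'0 : 0 < e / (C + 1) by rewrite divr_gt0// ltr_wpDl.
have := jointly_continuous_uniform (ck1 _ Ux) e'0.
move=> /(filterI (open_nbhs_nbhs (conj oU Ux)))/nbhs_ballP[r /= r0 xr].
have line_ball (t : R) : `|t| < r / (`|v| + 1) -> ball x r (t *: v + x).
  rewrite -ball_normE /= opprD addrCA subrr addr0 normrN normrZ.
  rewrite ltr_pdivlMr ?ltr_wpDl//; apply: le_lt_trans.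
  by rewrite ler_wpM2l// lerDl.
near=> h.
have h0 : h != 0 by near: h; exact: nbhs_dnbhs_neq.
have hr : `|h| < r / (`|v| + 1).
  near: h; apply: dnbhs0_lt; rewrite divr_gt0// ltr_wpDl//.
have [Uh _] := xr _ (line_ball _ hr).
have cx := jointly_continuous_sphere (ck _ Ux).
have ch := jointly_continuous_sphere (ck _ Uh).
have c1 := jointly_continuous_sphere (ck1 _ Ux).
rewrite -[_ *: _]/(_ * _) -sphere_meanB; [|exact: sphere_continuousM..].
rewrite -sphere_meanZ; last by apply: sphere_continuousB; exact: sphere_continuousM.
rewrite -sphere_meanB; [|exact: sphere_continuousM|]; last first.
  by apply: sphere_continuousZ; apply: sphere_continuousB; exact: sphere_continuousM.
apply: (sphere_mean_norm_le sigma_unif).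
  apply: sphere_continuousB; first exact: sphere_continuousM.
  by apply: sphere_continuousZ; apply: sphere_continuousB; exact: sphere_continuousM.
move=> z Sz.
have [t th kE] := @mvt_abs R (fun s => k (s *: v + x) z) (fun s => k1 (s *: v + x) z) h
  (fun t th => is_derive_line (dk _ _ (xr _ (line_ball _ (le_lt_trans th hr))).1 Sz)).
rewrite -mulrBl; move: kE; rewrite scale0r add0r => ->.
have -> : h^-1 * (k1 (t *: v + x) z * h * g z) = k1 (t *: v + x) z * g z by field.
rewrite -mulrBl normrM distrC.
apply: le_trans (_ : e / (C + 1) * C <= _).
  apply: ler_pM => //; last exact: gC.
  by rewrite ltW//; have [_] := xr _ (line_ball _ (le_lt_trans th hr)); exact.
by rewrite mulrAC ler_pdivrMr ?ler_wpM2l//; lra.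
Unshelve. all: by end_near. Qed.

End Parametric.

(** * Viscosity subharmonic functions and comparison *)

Section Subharmonic.
Context {R : realType} {d : nat}.
Local Notation vec := 'rV[R]_d.
Implicit Types (x y v : vec) (F G H psi s : vec -> R).

Lemma nbhs_line (x v : vec) (P : vec -> Prop) : (\forall y \near x, P y) ->
  exists2 e : R, 0 < e & forall t : R, `|t| < e -> P (t *: v + x).
Proof.
move=> /nbhs_ballP[r /= r0 xr]; exists (r / (`|v| + 1)); first by rewrite divr_gt0// ltr_wpDl.
move=> t tr; apply: xr.
rewrite -ball_normE /= opprD addrCA subrr addr0 normrN normrZ.
move: tr; rewrite ltr_pdivlMr ?ltr_wpDl//; apply: le_lt_trans.
by rewrite ler_wpM2l// lerDl.
Qed.

(** At the maximum the first derivative along the line vanishes. Were the second one positive, the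
    first would be positive just to the right, and the mean value theorem would give a value above
    the maximum. *)
Lemma second_derivative_test F x v :
  (\forall y \near x, derivable F y v) -> derivable ('D_v F) x v ->
  (\forall y \near x, F y <= F x) -> 'D_v ('D_v F) x <= 0.
Proof.
move=> dF d2F Fx; rewrite leNgt; apply/negP => L0.
have [e e0 he] := nbhs_line v (filterI dF Fx).
pose g (t : R) := F (t *: v + x); pose g1 (t : R) := 'D_v F (t *: v + x).
have dg (t : R) : `|t| < e -> is_derive t 1 g (g1 t).
  by move=> te; apply: is_derive_line; apply: derivableP; exact: (he t te).1.
have dg0 : derivable g 0 1 by apply: (@ex_derive _ _ _ _ _ _ _ (dg 0 _)); rewrite normr0.
have g10 : g1 0 = 0.
  have := @derive1_at_max R g (- (e / 2)) (e / 2) 0.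
  have e2 : 0 < e / 2 by rewrite divr_gt0.
  have lte (t : R) : t \in `](- (e / 2)), (e / 2)[ -> `|t| < e.
    rewrite in_itv/= => /andP[t1 t2]; rewrite ltr_norml.
    by apply/andP; split; lra.
  move=> h; have /@derive_val : is_derive (0 : R) (1 : R) g 0.
    apply: h; first lra.
    - by move=> t /lte te; exact: (@ex_derive _ _ _ _ _ _ _ (dg t te)).
    - by rewrite in_itv/= oppr_lt0 e2.
    - move=> t /lte te; have [_] := he t te.
      by rewrite /g scale0r add0r.
  by move=> Dg0; rewrite -[RHS]Dg0; symmetry; apply: derive_val; apply: dg; rewrite normr0.
have lim : h^-1 *: ('D_v F (h *: v + x) - 'D_v F x) @[h --> 0^'] --> 'D_v ('D_v F) x.
  exact: d2F.
have D0 : 'D_v F x = 0 by rewrite -g10 /g1 scale0r add0r.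
move/cvgrPdist_lt : lim => /(_ _ L0)/nbhs_ballP[r /= r0 hr].
pose h := Num.min e r / 2.
have m0 : 0 < Num.min e r by rewrite lt_min e0.
have h0 : 0 < h by rewrite divr_gt0.
have hm : h < Num.min e r by rewrite /h ltr_pdivrMr// ltr_pMr// ltr1n.
have [he' hr'] : h < e /\ h < r by move: hm; rewrite lt_min => /andP.
have [t||c] := @MVT R g g1 0 h h0.
- by rewrite in_itv/= => /andP[t0 th]; apply: dg; rewrite gtr0_norm// (lt_trans th).
- apply: derivable_within_continuous => t; rewrite in_itv/= => /andP[t0 th].
  by apply: (@ex_derive _ _ _ _ _ _ _ (dg t _)); rewrite ger0_norm// (le_lt_trans th).
rewrite in_itv/= => /andP[c0 ch]; rewrite subr0 => gE.
have := hr c; rewrite /ball /= sub0r normrN gtr0_norm// => /(_ (lt_trans ch hr')).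
rewrite (gt_eqF c0) => /(_ isT); rewrite D0 subr0 -/(g1 c) -[_ *: _]/(_ * _) => cL.
have g1c : 0 < g1 c.
  have : 0 < c^-1 * g1 c by move: cL; rewrite ltr_norml => /andP[]; lra.
  by rewrite pmulr_rgt0// invr_gt0.
have := (he h _).2; rewrite gtr0_norm// => /(_ he') /=.
have -> : F x = g 0 by rewrite /g scale0r add0r.
by rewrite -subr_le0 -/(g h) gE leNgt mulr_gt0.
Qed.

(** The regularity that the maximum test consumes: partial derivatives near the point and unmixed
    second ones at the point. Test functions for subharmonicity are taken from this class. *)
Definition pure_second F x := forall i : 'I_d,
  (\forall y \near x, derivable F y (delta_mx ord0 i)) /\
  derivable (partial i F) x (delta_mx ord0 i).

Lemma partial_near_eq F G x i : (\forall y \near x, F y = G y) ->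
  \forall y \near x, partial i F y = partial i G y.
Proof.
move=> /nbhs_interior; apply: filterS => y FG.
by apply: near_eq_derive.
Qed.

Lemma pure_second_near_eq F G x : (\forall y \near x, F y = G y) ->
  pure_second F x -> pure_second G x.
Proof.
move=> FG dF i; have [d1 d2] := dF i; split.
  move: (nbhs_interior FG); apply: filterS2 d1 => y dy FGy.
  exact: near_eq_derivable dy.
by apply: near_eq_derivable d2; exact: partial_near_eq.
Qed.

Lemma laplacian_near_eq F G x : (\forall y \near x, F y = G y) ->
  laplacian F x = laplacian G x.
Proof.
move=> FG; apply: eq_bigr => i _; apply: near_eq_derive.
exact: partial_near_eq.
Qed.

Lemma pure_second_derive F (dF : 'I_d -> vec -> R) (ddF : 'I_d -> R) x :
  (forall i, \forall y \near x, is_derive y (delta_mx ord0 i) F (dF i y)) ->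
  (forall i, is_derive x (delta_mx ord0 i) (dF i) (ddF i)) ->
  pure_second F x /\ laplacian F x = \sum_i ddF i.
Proof.
move=> h1 h2; have pE i : \forall y \near x, dF i y = partial i F y.
  by apply: filterS (h1 i) => y dy; rewrite /partial (@derive_val _ _ _ _ _ _ _ dy).
split=> [i|].
  split; first by apply: filterS (h1 i) => y dy; exact: (@ex_derive _ _ _ _ _ _ _ dy).
  by apply: near_eq_derivable (pE i) _; exact: (@ex_derive _ _ _ _ _ _ _ (h2 i)).
apply: eq_bigr => i _; exact: (@derive_val _ _ _ _ _ _ _ (near_eq_is_derive (pE i) (h2 i))).
Qed.

Lemma pure_secondDZ F G (a : R) x : pure_second F x -> pure_second G x ->
  pure_second (fun y => F y + a * G y) x /\
  laplacian (fun y => F y + a * G y) x = laplacian F x + a * laplacian G x.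
Proof.
move=> dF dG; have [||h ->] := @pure_second_derive (fun y => F y + a * G y)
  (fun i y => partial i F y + a * partial i G y)
  (fun i => partial i (partial i F) x + a * partial i (partial i G) x) x.
- move=> i; have [[d1 _] [d2 _]] := (dF i, dG i); apply: filterS2 d1 d2 => y d1 d2.
  exact: (is_deriveD (derivableP d1) (is_deriveZ a (derivableP d2))).
- move=> i; have [[_ d1] [_ d2]] := (dF i, dG i).
  exact: (is_deriveD (derivableP d1) (is_deriveZ a (derivableP d2))).
by split=> //; rewrite big_split mulr_sumr.
Qed.

Lemma laplacian_local_max F x : pure_second F x ->
  (\forall y \near x, F y <= F x) -> laplacian F x <= 0.
Proof.
move=> dF Fx; rewrite -oppr_ge0 /laplacian -sumrN; apply: sumr_ge0 => i _.
by rewrite oppr_ge0; have [d1 d2] := dF i; apply: second_derivative_test.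
Qed.

(* Subharmonicity in the viscosity sense: it is stable under maxima and under
   gluing, and the comparison principle needs no integration. *)
Definition subharmonic (W : set vec) s := forall x, W x -> forall psi,
  pure_second psi x -> (\forall y \near x, s y - psi y <= s x - psi x) ->
  0 <= laplacian psi x.

(** If [psi] touches [F] from above at [x], then F - psi has a local maximum there, so its laplacian
    is nonpositive. *)
Lemma smooth_subharmonic (W : set vec) F :
  (forall x, W x -> pure_second F x /\ 0 <= laplacian F x) -> subharmonic W F.
Proof.
move=> hF x /hF[dF F0] psi dpsi Fpsi.
have [dFpsi lE] := pure_secondDZ (- 1) dF dpsi.
have : laplacian F x + -1 * laplacian psi x <= 0.
  rewrite -lE; apply: laplacian_local_max => //.
  by apply: filterS Fpsi => y; rewrite !mulN1r.
by rewrite mulN1r subr_le0; exact: le_trans.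
Qed.

(** A test function touching the maximum at [x] also touches whichever of the two functions attains
    it at [x]. *)
Lemma subharmonic_max (W : set vec) s1 s2 : subharmonic W s1 -> subharmonic W s2 ->
  subharmonic W (fun x => Num.max (s1 x) (s2 x)).
Proof.
move=> h1 h2 x Wx psi dpsi; have [s12|s21] := leP (s1 x) (s2 x) => near_le.
  apply: (h2 x Wx psi dpsi); apply: filterS near_le => y; apply: le_trans.
  by rewrite lerB// le_max lexx orbT.
apply: (h1 x Wx psi dpsi); apply: filterS near_le => y; apply: le_trans.
by rewrite lerB// le_max lexx.
Qed.

(** One family serves three purposes: the strictly subharmonic perturbation in [comparison], the
    numerator and denominator of the Poisson kernel, and the exponent of the barrier. *)
Definition quad (a : R) (p : vec) x := dot (a *: x - p) (a *: x - p).

Lemma cvg_dot (T : Type) (F : set_system T) (FF : Filter F) (f g : T -> vec) (l m : vec) :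
  f @ F --> l -> g @ F --> m -> dot (f x) (g x) @[x --> F] --> dot l m.
Proof.
move=> fl gm; apply: cvg_big => [|i _]; first exact: add_continuous.
apply: cvgM.
  exact: (@cvg_comp _ _ _ f (fun x : vec => x ord0 i) _ _ _ fl (@coord_continuous _ _ _ _ _ _)).
exact: (@cvg_comp _ _ _ g (fun x : vec => x ord0 i) _ _ _ gm (@coord_continuous _ _ _ _ _ _)).
Qed.

Lemma continuous_quad (b : R) (u : vec) : continuous (quad b u).
Proof.
move=> x; have ca : {for x, continuous (fun y : vec => b *: y - u)}.
  apply: (@continuousB _ _ _ (fun y : vec => b *: y) (cst u)); last exact: cst_continuous.
  exact: scaler_continuous.
exact: (cvg_dot _ ca ca).
Qed.

Lemma is_derive_dotl (a : R) (p w : vec) x v :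
  is_derive x v (fun y => dot (a *: y - p) w) (a * dot v w).
Proof.
suff lim : h^-1 *: (dot (a *: (h *: v + x) - p) w - dot (a *: x - p) w) @[h --> (0 : R)^']
    --> a * dot v w.
  by apply: DeriveDef; [apply/cvg_ex; eexists; exact: lim|apply: cvg_lim => //; exact: lim].
apply: cvg_near_cst; near=> h.
have h0 : h != 0 by near: h; exact: nbhs_dnbhs_neq.
rewrite -[_ *: _]/(_ * _) !(dotBl, dotZl, dotDl, dotNl).
by field.
Unshelve. all: by end_near. Qed.

Lemma is_derive_quad (a : R) (p : vec) x v :
  is_derive x v (quad a p) (2 * a * dot (a *: x - p) v).
Proof.
suff lim : h^-1 *: (quad a p (h *: v + x) - quad a p x) @[h --> (0 : R)^']
    --> 2 * a * dot (a *: x - p) v.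
  by apply: DeriveDef; [apply/cvg_ex; eexists; exact: lim|apply: cvg_lim => //; exact: lim].
have : 2 * a * dot (a *: x - p) v + h * (a ^+ 2 * dot v v) @[h --> (0 : R)^'] -->
    2 * a * dot (a *: x - p) v + 0 * (a ^+ 2 * dot v v).
  apply: cvgD; first exact: cvg_cst.
  by apply: cvgMl; apply: cvg_within; exact: cvg_id.
rewrite mul0r addr0; apply: cvg_trans; apply: near_eq_cvg; near=> h.
have h0 : h != 0 by near: h; exact: nbhs_dnbhs_neq.
have scE (r s : R) : r *: s = r * s by [].
rewrite /quad scE !(dotBl, dotBr, dotZl, dotZr, dotDl, dotDr, dotNl, dotNr).
rewrite (dotC v x) (dotC p v) (dotC p x).
by field.
Unshelve. all: by end_near. Qed.

Lemma dot_deltas (i : 'I_d) : dot (delta_mx ord0 i : vec) (delta_mx ord0 i) = 1.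
Proof. by rewrite dot_delta mxE !eqxx. Qed.

Lemma quad_second (a : R) p x : pure_second (quad a p) x /\
  laplacian (quad a p) x = 2 * a ^+ 2 * d%:R.
Proof.
have [] := @pure_second_derive (quad a p)
  (fun i y => 2 * a * dot (a *: y - p) (delta_mx ord0 i)) (fun=> 2 * a ^+ 2) x.
- by move=> i; apply: (@filterE _ (nbhs x)) => y; exact: is_derive_quad.
- move=> i; have := is_deriveZ (2 * a) (is_derive_dotl a p (delta_mx ord0 i) x (delta_mx ord0 i)).
  by rewrite dot_deltas mulr1 -[_ *: _]/(_ * _) -mulrA -expr2.
move=> h ->; split=> //.
by rewrite sumr_const card_ord [RHS]mulr_natr.
Qed.

(** If s - H is positive somewhere, then s - H + e |x|^2 with small [e] still has its maximum over
    [K] at a point of [W]. There H - e |x|^2 is a test function for [s] with laplacian at most - 2 e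
    d, which is negative. *)
Lemma comparison (K W : set vec) s H : (0 < d)%N -> compact K -> open W -> W `<=` K ->
  {within K, continuous (fun x => s x - H x)} ->
  (forall x, K x -> ~ W x -> s x <= H x) ->
  subharmonic W s ->
  (forall x, W x -> pure_second H x /\ laplacian H x <= 0) ->
  forall x, K x -> s x <= H x.
Proof.
move=> d0 cK oW WK ctn bd subs hH x0 Kx0; rewrite leNgt; apply/negP => sH.
have quadE x : quad 1 0 x = dot x x by rewrite /quad scale1r subr0.
have cq : continuous (quad 1 0) := @continuous_quad 1 0.
have [B B0 KB] : exists2 B, 0 < B & forall x, K x -> quad 1 0 x <= B.
  have /bounded_eucl[C hC] := compact_bounded cK.
  exists (C ^+ 2 + 1); first by rewrite ltr_wpDl// sqr_ge0.
  move=> x Kx; rewrite quadE -sqr_eucl_norm; apply: le_trans (_ : C ^+ 2 <= _); last by rewrite lerDl.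
  by rewrite ler_sqr ?nnegrE ?hC ?eucl_norm_ge0// (le_trans (eucl_norm_ge0 x))// hC.
(* With this [e] the perturbation is at most half of s x0 - H x0 on [K], so it cannot lift a point
   outside [W] to the value at [x0]. *)
pose e := (s x0 - H x0) / (2 * B).
have e0 : 0 < e by rewrite divr_gt0 ?subr_gt0 ?mulr_gt0.
pose g x := (s x - H x) + e * quad 1 0 x.
have cg : {within K, continuous g}.
  move=> x; apply: (@continuousD _ _ _ (fun x : subspace K => s x - H x)
    (fun x : subspace K => e * quad 1 0 x)); first exact: ctn.
  have ce : continuous (fun x => e * quad 1 0 x).
    by move=> y; apply: (@continuousM _ _ (fun=> e) (quad 1 0) y); [exact: cst_continuous|exact: cq].
  exact: (continuous_subspaceT ce).
have [|c Kc gc] := EVT_max_rV _ cK cg; first by exists x0.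
have {}gc y : K y -> g y <= g c by move=> Ky; apply: gc; rewrite inE.
move: Kc; rewrite inE => Kc.
have gc0 : s x0 - H x0 <= g c.
  apply: le_trans (gc _ Kx0); rewrite /g lerDl mulr_ge0 ?(ltW e0)// quadE.
  exact: dot_ge0.
have Wc : W c.
  apply: contrapT => /(bd _ Kc) sHc; move: gc0; rewrite leNgt => /negP; apply.
  apply: le_lt_trans (_ : e * B < _).
    by rewrite /g -[leRHS]add0r lerD// ?subr_le0// ler_wpM2l// ?(ltW e0)// KB.
  rewrite /e invfM mulrA divfK ?gt_eqF// ltr_pdivrMr// mulr_natr mulr2n ltrDl subr_gt0//.
have [dH lH] := hH c Wc; have [dq lq] := quad_second 1 0 c.
have [dpsi lpsi] := pure_secondDZ (- e) dH dq.
have := subs c Wc _ dpsi; rewrite lpsi lq => /(_ _) h.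
have : 0 <= laplacian H c + - e * (2 * 1 ^+ 2 * d%:R).
  apply: h; have := open_nbhs_nbhs (conj oW Wc); apply: filterS => y /WK/gc.
  by rewrite /g !mulNr !opprD !opprK !addrA.
rewrite leNgt => /negP; apply; rewrite expr1n mulr1 mulNr subr_lt0.
apply: le_lt_trans lH _; apply: mulr_gt0 => //; apply: mulr_gt0 => //.
by rewrite ltr0n.
Qed.

End Subharmonic.

(** * The Poisson integral of a ball *)

Section PoissonKernel.
Context {R : realType} {d : nat} (sigma : probability (borelRd R d) R).
Hypothesis sigma_unif : uniform_on_sphere sigma.
Local Notation S := (@unit_sphere R d).
Local Notation M := (sphere_mean sigma).
Local Notation vec := 'rV[R]_d.

Lemma is_derive_lineP (f : vec -> R) (x v : vec) (df : R) :
  is_derive (0 : R) (1 : R) (fun s : R => f (s *: v + x)) df -> is_derive x v f df.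
Proof.
case=> d0 dE; have dx : derivable f x v by apply/derivable1P.
apply: DeriveDef dx _.
rewrite -dE /derive; apply: (congr1 (fun F : R -> R => lim (F @ 0^'))); apply/funext => h /=.
by rewrite scale0r add0r addr0 [h *: 1]mulr1.
Qed.

Lemma scale_realE (r s : R) : r *: s = r * s. Proof. by []. Qed.

Lemma is_derive_compl (h : R -> R) (f : vec -> R) (x v : vec) (dh df : R) :
  is_derive (f x) (1 : R) h dh -> is_derive x v f df ->
  is_derive x v (fun y => h (f y)) (dh * df).
Proof.
move=> hfx dfx; apply: is_derive_lineP.
have h1 : is_derive (0 : R) (1 : R) (fun s : R => f (s *: v + x)) df.
  by apply: is_derive_line; rewrite scale0r add0r.
have h2 : is_derive (f (0 *: v + x)) (1 : R) h dh by rewrite scale0r add0r.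
exact: (is_derive1_comp h2 h1).
Qed.

Lemma is_derive_powR_comp (f : vec -> R) (q : R) (x v : vec) (df : R) : 0 < f x ->
  is_derive x v f df -> is_derive x v (fun y => f y `^ q) (q * f x `^ (q - 1) * df).
Proof. by move=> f0 dfx; exact: (is_derive_compl (is_derive1_powR q f0) dfx). Qed.

Lemma continuous_powR_comp (T : topologicalType) (f : T -> R) (q : R) (x : T) : 0 < f x ->
  {for x, continuous f} -> {for x, continuous (fun y => f y `^ q)}.
Proof.
move=> f0 cf; apply: (@continuous_comp _ _ _ f (@powR R ^~ q)) => //.
apply: differentiable_continuous; apply/derivable1_diffP.
exact: (@ex_derive _ _ _ _ _ _ _ (is_derive1_powR q f0)).
Qed.

Variables (a : R) (p : vec).
Hypothesis a_gt0 : 0 < a.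

(* With a = 1 / rho and p = c / rho the chart maps the ball of centre c and radius
   rho onto the unit ball, and quad a p x = |chart x|^2; poisson_kernel is then the
   classical (1 - |w|^2) / |w - z|^d at w = chart x. *)
Definition chart (x : vec) : vec := a *: x - p.
Definition chart_ball : set vec := [set x | quad a p x < 1].
Local Notation U := chart_ball.

Lemma quad_shift x z : quad a (p + z) x = dot (chart x - z) (chart x - z).
Proof. by rewrite /quad opprD addrA. Qed.

Lemma unit_sphere_dot z : S z <-> dot z z = 1.
Proof.
rewrite /unit_sphere /= eucl_normE; split=> [h|->]; last exact: sqrtr1.
by rewrite -[LHS]sqr_sqrtr ?dot_ge0// h expr1n.
Qed.

Lemma dot_eq0 (x : vec) : dot x x = 0 -> x = 0.
Proof.
move=> x0; apply/eqP; rewrite -normr_le0; apply: le_trans (ler_norm_eucl _) _.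
by rewrite eucl_normE x0 sqrtr0.
Qed.

Lemma quad_shift_gt0 x z : U x -> S z -> 0 < quad a (p + z) x.
Proof.
rewrite /chart_ball /= => Ux /unit_sphere_dot zz.
rewrite quad_shift lt_neqAle dot_ge0 andbT eq_sym; apply/eqP => /dot_eq0/eqP.
rewrite subr_eq0 => /eqP wz; move: Ux.
by rewrite -[quad a p x]/(dot (chart x) (chart x)) wz zz ltxx.
Qed.

Lemma open_chart_ball : open U.
Proof.
have -> : U = quad a p @^-1` [set t | t < 1] by [].
by apply: open_comp; [move=> x _; exact: continuous_quad|exact: open_lt].
Qed.

(** Half the dimension, because the base of the power is a squared distance. *)
Let q : R := - (d%:R / 2).

Definition poisson_kernel (x z : vec) : R := (1 - quad a p x) * quad a (p + z) x `^ q.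
Local Notation K := poisson_kernel.

(** Kept close to the shape that the product rule yields, as is [ddkernel] below: joint continuity
    is read off factor by factor, and cancellation is left to [ddkernel_sum]. *)
Definition dkernel (v x z : vec) : R :=
  - (2 * a * dot (a *: x - p) v) * quad a (p + z) x `^ q +
  (1 - quad a p x) *
    (q * quad a (p + z) x `^ (q - 1) * (2 * a * dot (a *: x - (p + z)) v)).

Definition ddkernel (v u x z : vec) : R :=
  - (2 * a * (a * dot u v)) * quad a (p + z) x `^ q +
  - (2 * a * dot (a *: x - p) v) *
    (q * quad a (p + z) x `^ (q - 1) * (2 * a * dot (a *: x - (p + z)) u)) +
  (- (2 * a * dot (a *: x - p) u) *
    (q * quad a (p + z) x `^ (q - 1) * (2 * a * dot (a *: x - (p + z)) v)) +
  (1 - quad a p x) *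
    (q * ((q - 1) * quad a (p + z) x `^ (q - 1 - 1) * (2 * a * dot (a *: x - (p + z)) u)
       * (2 * a * dot (a *: x - (p + z)) v) +
     quad a (p + z) x `^ (q - 1) * (2 * a * (a * dot u v))))).

Lemma is_derive_kernel x z v : U x -> S z -> is_derive x v (K^~ z) (dkernel v x z).
Proof.
move=> Ux Sz; have D0 := quad_shift_gt0 Ux Sz.
have h1 := is_deriveB (is_derive_cst (1 : R) x v) (is_derive_quad a p x v).
have h2 := is_derive_powR_comp q D0 (is_derive_quad a (p + z) x v).
apply: (is_derive_eq (is_deriveM h1 h2)).
rewrite !scale_realE -[(cst 1 - quad a p) x]/(1 - quad a p x) /dkernel.
move: (quad a p x) (quad _ _ _ `^ q) (quad _ _ _ `^ (q - 1)) (dot _ v) (dot _ v) => A B C E F.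
by ring.
Qed.

Lemma is_derive_dkernel x z v u : U x -> S z ->
  is_derive x u (fun y => dkernel v y z) (ddkernel v u x z).
Proof.
move=> Ux Sz; have D0 := quad_shift_gt0 Ux Sz.
have h1 := is_deriveB (is_derive_cst (1 : R) x u) (is_derive_quad a p x u).
have h2 := is_derive_powR_comp q D0 (is_derive_quad a (p + z) x u).
have h3 := is_derive_powR_comp (q - 1) D0 (is_derive_quad a (p + z) x u).
have h4 : is_derive x u (fun y => - (2 * a * dot (a *: y - p) v)) (- (2 * a * (a * dot u v)))
  := is_deriveN (is_deriveZ (2 * a) (is_derive_dotl a p v x u)).
have h5 : is_derive x u (fun y => 2 * a * dot (a *: y - (p + z)) v) (2 * a * (a * dot u v))
  := is_deriveZ (2 * a) (is_derive_dotl a (p + z) v x u).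
have h3' : is_derive x u (fun y => q * quad a (p + z) y `^ (q - 1)) (q * ((q - 1) *
    quad a (p + z) x `^ (q - 1 - 1) * (2 * a * dot (a *: x - (p + z)) u)))
  := is_deriveZ q h3.
have h6 : is_derive x u (fun y => q * quad a (p + z) y `^ (q - 1) *
    (2 * a * dot (a *: y - (p + z)) v))
    (q * quad a (p + z) x `^ (q - 1) * (2 * a * (a * dot u v)) +
     2 * a * dot (a *: x - (p + z)) v * (q * ((q - 1) *
       quad a (p + z) x `^ (q - 1 - 1) * (2 * a * dot (a *: x - (p + z)) u))))
  := is_deriveM h3' h5.
apply: (is_derive_eq (is_deriveD (is_deriveM h4 h2) (is_deriveM h1 h6))).
rewrite !scale_realE -[(cst 1 - quad a p) x]/(1 - quad a p x) /ddkernel.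
move: (quad a p x) (quad _ _ _ `^ q) (quad _ _ _ `^ (q - 1)) (quad _ _ _ `^ (q - 1 - 1)).
move: (dot (_ - p) v) (dot (_ - p) u) (dot (_ - (p + z)) v) (dot (_ - (p + z)) u) (dot u v).
move=> A1 A2 A3 A4 A5 B1 B2 B3 B4.
by ring.
Qed.

(** Write w for the chart image of [x]. Once D^(q-2) is factored out, the trace is a polynomial in
    d, q, D, w.w and w.z. It vanishes because [z] is a unit vector and d = - 2 q. *)
Lemma ddkernel_sum x z : U x -> S z ->
  \sum_(i < d) ddkernel (delta_mx ord0 i) (delta_mx ord0 i) x z = 0.
Proof.
move=> Ux Sz; have D0 := quad_shift_gt0 Ux Sz.
have zz := (unit_sphere_dot z).1 Sz.
set N := 1 - quad a p x; set D := quad a (p + z) x.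
(* All powers are expressed through D^(q-2), so that only polynomial identities remain. *)
have P2 : D `^ q = D `^ (q - 1 - 1) * D ^+ 2.
  rewrite -(powR_mulrn 2 (ltW D0)) -powRD; last by rewrite (gt_eqF D0) implybT.
  by congr (_ `^ _); ring.
have P1 : D `^ (q - 1) = D `^ (q - 1 - 1) * D.
  have D1 : D = D `^ 1 by rewrite powRr1 ?ltW.
  rewrite [X in _ * X]D1 -powRD; last by rewrite (gt_eqF D0) implybT.
  by congr (_ `^ _); ring.
pose w := a *: x - p.
have wzE : a *: x - (p + z) = w - z by rewrite opprD addrA.
pose B := 2 * a ^+ 2 * D `^ (q - 1 - 1).
have tE i : ddkernel (delta_mx ord0 i) (delta_mx ord0 i) x z =
    B * (- D ^+ 2 + N * q * D) +
    B * (- (4 * q * D)) * (w ord0 i * (w - z) ord0 i) +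
    B * (2 * N * q * (q - 1)) * ((w - z) ord0 i * (w - z) ord0 i).
  rewrite /ddkernel -/D -/N P2 P1 wzE -/w dot_deltas !dot_delta /B.
  by move: (w ord0 i) ((w - z) ord0 i) => wi wzi; ring.
under eq_bigr do rewrite tE.
rewrite !big_split /= -!mulr_sumr sumr_const card_ord -!/(dot _ _).
have -> : dot (w - z) (w - z) = D by rewrite /D quad_shift.
have NE : N = 1 - dot w w by [].
have DE : D = dot w w - 2 * dot w z + 1.
  rewrite /D quad_shift -[chart x]/w; move: (w) => w'.
  by rewrite !dotBl !dotBr zz (dotC z w'); ring.
rewrite -[_ *+ d]mulr_natr dotBr.
(* This ties the exponent to the dimension; with the polarisation formula for w.z below it gives the
   cancellation. *)
have dE : d%:R = - 2 * q :> R by rewrite /q; field.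
have -> : dot w z = (dot w w + 1 - D) / 2 by rewrite DE; field.
by rewrite dE NE; field.
Qed.

Lemma jointly_continuousM k1 k2 (x : vec) : jointly_continuous k1 x ->
  jointly_continuous k2 x -> jointly_continuous (fun y z => k1 y z * k2 y z) x.
Proof. by move=> c1 c2 z Sz; exact: (continuousM (c1 _ Sz) (c2 _ Sz)). Qed.

Lemma jointly_continuousD k1 k2 (x : vec) : jointly_continuous k1 x ->
  jointly_continuous k2 x -> jointly_continuous (fun y z => k1 y z + k2 y z) x.
Proof. by move=> c1 c2 z Sz; exact: (continuousD (c1 _ Sz) (c2 _ Sz)). Qed.

Lemma jointly_continuousN k1 (x : vec) : jointly_continuous k1 x ->
  jointly_continuous (fun y z => - k1 y z) x.
Proof. by move=> c1 z Sz; exact: (continuousN (c1 _ Sz)). Qed.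

Lemma jointly_continuous_cst (b : R) (x : vec) : jointly_continuous (fun _ _ => b) x.
Proof. by move=> z _; exact: cst_continuous. Qed.

Lemma jointly_continuous_fst (f : vec -> R) (x : vec) : {for x, continuous f} ->
  jointly_continuous (fun y _ => f y) x.
Proof.
move=> cf z _; apply: (@continuous_comp _ _ _ (@fst vec vec) f); last exact: cf.
exact: cvg_fst.
Qed.

Lemma continuous_chart (x : vec) : {for x, continuous (fun y : vec => a *: y - p)}.
Proof.
apply: (@continuousB _ _ _ (fun y : vec => a *: y) (cst p)); last exact: cst_continuous.
exact: scaler_continuous.
Qed.

Lemma cvg_chart_shift (xz : vec * vec) :
  (a *: y.1 - (p + y.2)) @[y --> xz] --> a *: xz.1 - (p + xz.2).
Proof.
apply: cvgB; first by apply: cvgZr; exact: cvg_fst.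
by apply: cvgD; [exact: cvg_cst|exact: cvg_snd].
Qed.

Lemma jointly_continuous_shift (v x : vec) :
  jointly_continuous (fun y z => dot (a *: y - (p + z)) v) x.
Proof.
move=> z _; exact: (cvg_dot _ (@cvg_chart_shift (x, z)) (cvg_cst v)).
Qed.

Lemma jointly_continuous_pow (r : R) (x : vec) : U x ->
  jointly_continuous (fun y z => quad a (p + z) y `^ r) x.
Proof.
move=> Ux z Sz; apply: (@continuous_powR_comp _ (fun y => quad a (p + y.2) y.1)).
  exact: quad_shift_gt0.
exact: (cvg_dot _ (@cvg_chart_shift (x, z)) (@cvg_chart_shift (x, z))).
Qed.

Lemma jointly_continuous_quad (x : vec) : jointly_continuous (fun y _ => 1 - quad a p y) x.
Proof.
apply: jointly_continuousD; first exact: jointly_continuous_cst.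
by apply: jointly_continuousN; apply: jointly_continuous_fst; exact: continuous_quad.
Qed.

Lemma jointly_continuous_dot (v x : vec) :
  jointly_continuous (fun y _ => dot (a *: y - p) v) x.
Proof.
apply: jointly_continuous_fst.
exact: (cvg_dot _ (@continuous_chart x) (cvg_cst v)).
Qed.

Lemma jointly_continuous_kernel x : U x -> jointly_continuous K x.
Proof.
move=> Ux; apply: jointly_continuousM; first exact: jointly_continuous_quad.
exact: jointly_continuous_pow.
Qed.

Let jcM := jointly_continuousM.
Let jcD := jointly_continuousD.
Let jcN := jointly_continuousN.
Let jcC := jointly_continuous_cst.
Let jcS := jointly_continuous_shift.
Let jcP := jointly_continuous_pow.
Let jcQ := jointly_continuous_quad.
Let jcE := jointly_continuous_dot.

Lemma jointly_continuous_dkernel v x : U x -> jointly_continuous (dkernel v) x.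
Proof.
by move=> Ux; apply: jcD; [apply: jcM|]; [apply: jcN; apply: jcM; [exact: jcC|exact: jcE]
  |exact: jcP|apply: jcM; [exact: jcQ|apply: jcM]; [apply: jcM; [exact: jcC|exact: jcP]|
  apply: jcM; [exact: jcC|exact: jcS]]].
Qed.

Lemma jointly_continuous_ddkernel v u x : U x -> jointly_continuous (ddkernel v u) x.
Proof.
move=> Ux.
have cpow r : jointly_continuous (fun y z => quad a (p + z) y `^ r) x by exact: jcP.
have cq1 b e : jointly_continuous (fun y z => b * quad a (p + z) y `^ e) x.
  by apply: jcM; [exact: jcC|exact: cpow].
have cs w : jointly_continuous (fun y z => 2 * a * dot (a *: y - (p + z)) w) x.
  by apply: jcM; [exact: jcC|exact: jcS].
have cn w : jointly_continuous (fun y z => - (2 * a * dot (a *: y - p) w)) x.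
  by apply: jcN; apply: jcM; [exact: jcC|exact: jcE].
apply: jcD.
  apply: jcD; first by apply: jcM; [exact: jcC|exact: cpow].
  by apply: jcM; [exact: cn|apply: jcM; [exact: cq1|exact: cs]].
apply: jcD; first by apply: jcM; [exact: cn|apply: jcM; [exact: cq1|exact: cs]].
apply: jcM; first exact: jcQ.
apply: jcM; first exact: jcC.
apply: jcD; last by apply: jcM; [exact: cpow|exact: jcC].
by apply: jcM; [apply: jcM; [exact: cq1|exact: cs]|exact: cs].
Qed.

Definition poisson_integral (g : vec -> R) (x : vec) : R := M (fun z => K x z * g z).
Local Notation PI := poisson_integral.

Section Data.
Variable g : vec -> R.
Hypothesis cg : sphere_continuous g.

Lemma is_derive_poisson v x : U x ->
  is_derive x v (PI g) (M (fun z => dkernel v x z * g z)).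
Proof.
apply: (mean_kernel_derive sigma_unif open_chart_ball) => //.
- exact: jointly_continuous_kernel.
- exact: jointly_continuous_dkernel.
- by move=> y z Uy Sz; exact: is_derive_kernel.
Qed.

Lemma is_derive_dpoisson v u x : U x ->
  is_derive x u (fun y => M (fun z => dkernel v y z * g z))
    (M (fun z => ddkernel v u x z * g z)).
Proof.
apply: (mean_kernel_derive sigma_unif open_chart_ball) => //.
- exact: jointly_continuous_dkernel.
- exact: jointly_continuous_ddkernel.
- by move=> y z Uy Sz; exact: is_derive_dkernel.
Qed.

Lemma poisson_continuous x : U x -> {for x, continuous (PI g)}.
Proof.
move=> Ux; apply: (mean_kernel_continuous sigma_unif open_chart_ball) => //.
exact: jointly_continuous_kernel.
Qed.

Lemma near_chart_ball x (P : vec -> Prop) : U x -> (forall y, U y -> P y) -> \forall y \near x, P y.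
Proof.
by move=> Ux UP; have := open_nbhs_nbhs (conj open_chart_ball Ux); exact: filterS.
Qed.

Lemma partial_poisson i x : U x ->
  partial i (PI g) x = M (fun z => dkernel (delta_mx ord0 i) x z * g z).
Proof. by move=> Ux; exact: (@derive_val _ _ _ _ _ _ _ (is_derive_poisson _ Ux)). Qed.

Lemma poisson_C2 : C2_on U (PI g).
Proof.
move=> x Ux i j.
have pE := near_chart_ball Ux (partial_poisson i).
have pE' : \forall y \near x, M (fun z => dkernel (delta_mx ord0 i) y z * g z) = partial i (PI g) y.
  by move: pE; apply: filterS => y ->.
have dp y : U y -> is_derive y (delta_mx ord0 j) (partial i (PI g))
    (M (fun z => ddkernel (delta_mx ord0 i) (delta_mx ord0 j) y z * g z)).
  move=> Uy; apply: (near_eq_is_derive _ (is_derive_dpoisson _ _ Uy)).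
  by apply: near_chart_ball Uy _ => t Ut; rewrite partial_poisson.
split.
- exact: (@ex_derive _ _ _ _ _ _ _ (is_derive_poisson _ Ux)).
- exact: (@ex_derive _ _ _ _ _ _ _ (dp _ Ux)).
have ddE y : U y -> partial j (partial i (PI g)) y =
    M (fun z => ddkernel (delta_mx ord0 i) (delta_mx ord0 j) y z * g z).
  by move=> Uy; exact: (@derive_val _ _ _ _ _ _ _ (dp _ Uy)).
have ddE' : \forall y \near x, M (fun z => ddkernel (delta_mx ord0 i) (delta_mx ord0 j) y z * g z)
    = partial j (partial i (PI g)) y.
  by apply: near_chart_ball Ux _ => y Uy; rewrite ddE.
have := mean_kernel_continuous sigma_unif open_chart_ball Ux
  (fun y Uy => @jointly_continuous_ddkernel (delta_mx ord0 i) (delta_mx ord0 j) y Uy) cg.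
rewrite /prop_for /continuous_at ddE//; apply: cvg_trans.
exact: (near_eq_cvg ddE').
Qed.

Lemma poisson_laplacian x : U x -> laplacian (PI g) x = 0.
Proof.
move=> Ux; have E i : partial i (partial i (PI g)) x =
    M (fun z => ddkernel (delta_mx ord0 i) (delta_mx ord0 i) x z * g z).
  have := is_derive_dpoisson (delta_mx ord0 i) (delta_mx ord0 i) Ux.
  move=> /(@near_eq_is_derive _ _ _ _ (partial i (PI g))) h.
  apply: derive_val; apply: h; apply: near_chart_ball Ux _ => t Ut.
  by rewrite partial_poisson.
rewrite /laplacian (eq_bigr _ (fun i _ => E i)).
have cK i : sphere_continuous (fun z => ddkernel (delta_mx ord0 i) (delta_mx ord0 i) x z * g z).
  apply: sphere_continuousM => //; apply: jointly_continuous_sphere.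
  exact: jointly_continuous_ddkernel.
(* Additivity of the mean needs continuity of each partial sum, so both are carried through the
   induction. *)
have sumE (r : seq 'I_d) : sphere_continuous
      (fun z => \sum_(i <- r) ddkernel (delta_mx ord0 i) (delta_mx ord0 i) x z * g z) /\
    \sum_(i <- r) M (fun z => ddkernel (delta_mx ord0 i) (delta_mx ord0 i) x z * g z) =
    M (fun z => \sum_(i <- r) ddkernel (delta_mx ord0 i) (delta_mx ord0 i) x z * g z).
  elim: r => [|i r [IH1 IH2]].
    have -> : (fun z => \sum_(i <- [::]) ddkernel (delta_mx ord0 i) (delta_mx ord0 i) x z * g z)
        = fun=> 0 by apply/funext => z; rewrite big_nil.
    by split; [exact: sphere_continuous_cst|rewrite big_nil sphere_mean_cst].
  have -> : (fun z => \sum_(j <- i :: r) ddkernel (delta_mx ord0 j) (delta_mx ord0 j) x z * g z)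
      = fun z => ddkernel (delta_mx ord0 i) (delta_mx ord0 i) x z * g z +
        \sum_(j <- r) ddkernel (delta_mx ord0 j) (delta_mx ord0 j) x z * g z.
    by apply/funext => z; rewrite big_cons.
  split; first by move=> z Sz; exact: (continuousD (cK i z Sz) (IH1 z Sz)).
  by rewrite big_cons IH2 -sphere_meanD.
rewrite (sumE _).2 -[RHS](sphere_mean_cst sigma_unif 0).
apply: eq_sphere_mean => z Sz.
by rewrite -mulr_suml ddkernel_sum// mul0r.
Qed.

End Data.

End PoissonKernel.

(** * Normalisation and boundary values of the Poisson integral *)

Section PoissonBoundary.
Context {R : realType} {d : nat} (sigma : probability (borelRd R d) R).
Hypothesis sigma_unif : uniform_on_sphere sigma.
Local Notation S := (@unit_sphere R d).
Local Notation M := (sphere_mean sigma).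
Local Notation vec := 'rV[R]_d.

(** In dimension zero the sphere is empty and cannot have mass one. *)
Lemma dim_gt0 : (0 < d)%N.
Proof.
case: (posnP d) => // d0; have [] := sigma_unif.
have -> : S = set0.
  apply/seteqP; split=> // z; rewrite /unit_sphere /= /eucl_norm big1 ?sqrtr0.
    by move/eqP; rewrite eq_sym oner_eq0.
  by case=> i /[swap] _ /[dup]; rewrite {1}d0.
by rewrite measure0 => /eqP; rewrite eq_sym onee_eq0.
Qed.

Variables (a : R) (p : vec).
Hypothesis a_gt0 : 0 < a.
Local Notation U := (chart_ball a p).
Local Notation K := (poisson_kernel a p).
Local Notation PI := (poisson_integral sigma a p).
Local Notation W := (chart a p).

Lemma sphere_continuous_kernel x : U x -> sphere_continuous (K x).
Proof. by move=> Ux; apply: jointly_continuous_sphere; exact: jointly_continuous_kernel. Qed.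

Lemma poisson_kernel_ge0 x z : U x -> 0 <= K x z.
Proof.
by move=> Ux; rewrite mulr_ge0 ?powR_ge0// subr_ge0; exact: ltW.
Qed.

(** At the centre the kernel is identically 1. The mean value property of harmonic functions comes
    from here. *)
Lemma poisson_center (g : vec -> R) x : W x = 0 -> PI g x = M g.
Proof.
move=> Wx; apply: eq_sphere_mean => z Sz.
rewrite /poisson_kernel quad_shift Wx sub0r dotNl dotNr opprK.
rewrite ((unit_sphere_dot z).1 Sz) powR1 mulr1.
by rewrite -[quad a p x]/(dot (W x) (W x)) Wx dot0l subr0 mul1r.
Qed.

Lemma poisson_one_radial x y : U y -> quad a p x = quad a p y ->
  PI (fun=> 1) x = PI (fun=> 1) y.
Proof.
move=> Uy xy; have [Q QQ xQ] := @orthogonal_transitive _ _ (W x) (W y) xy.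
have cK : sphere_continuous (fun z => K y z * 1).
  by apply: sphere_continuousM; [exact: sphere_continuous_kernel|exact: sphere_continuous_cst].
rewrite -[RHS]/(M (fun z => K y z * 1)) -(sphere_mean_rot sigma_unif QQ cK).
apply: eq_sphere_mean => z Sz.
by rewrite /poisson_kernel !quad_shift -xQ -mulmxBl dot_mulmx// xy.
Qed.

Lemma chart_inv (w : vec) : W (a^-1 *: (w + p)) = w.
Proof. by rewrite /chart scalerA mulfV ?gt_eqF// scale1r addrK. Qed.

Lemma compact_quad_le (t : R) : compact [set x | quad a p x <= t].
Proof.
apply: bounded_closed_compact.
  apply/bounded_eucl; exists (a^-1 * (Num.sqrt t + eucl_norm p)) => x /= xt.
  have -> : x = a^-1 *: (W x + p) by rewrite /chart subrK scalerA mulVf ?gt_eqF// scale1r.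
  rewrite eucl_normZ ger0_norm ?invr_ge0 ?(ltW a_gt0)// ler_wpM2l ?invr_ge0 ?(ltW a_gt0)//.
  apply: le_trans (eucl_normD _ _) _; rewrite lerD2r eucl_normE.
  exact: ler_wsqrtr.
have -> : [set x | quad a p x <= t] = quad a p @^-1` [set r | r <= t] by [].
by apply: closed_comp; [move=> x _; exact: continuous_quad|exact: closed_le].
Qed.

(* By rotation invariance the Poisson integral of 1 is constant on spheres about the
   centre; being harmonic, it is then constant by comparison. *)
Lemma poisson_one x : U x -> PI (fun=> 1) x = 1.
Proof.
move=> Ux.
have c1 : @sphere_continuous R d (fun=> 1) by exact: sphere_continuous_cst.
have x0E : PI (fun=> 1) (a^-1 *: (0 + p)) = 1.
  by rewrite poisson_center ?chart_inv// sphere_mean_cst.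
have [Wx0|Wx0] := eqVneq (W x) 0; first by rewrite poisson_center// sphere_mean_cst.
set t := quad a p x.
have t0 : 0 < t.
  rewrite lt_neqAle dot_ge0 andbT eq_sym; apply: contra Wx0 => /eqP h.
  by apply/eqP; exact: dot_eq0.
have t1 : t < 1 by [].
(* Comparison is run on the ball about the centre whose boundary passes through [x]: its closure
   lies inside [U], where the integral is continuous, and on its boundary the integral equals its
   value at [x]. *)
pose V := quad a p @^-1` [set r | r < t].
have oV : open V by apply: open_comp; [move=> y _; exact: continuous_quad|exact: open_lt].
have VU y : V y -> U y by move=> /lt_trans; apply.
have KU y : quad a p y <= t -> U y by move=> /le_lt_trans; apply.
have center : quad a p (a^-1 *: (0 + p)) <= t.
  by rewrite -[quad _ _ _]/(dot (W _) (W _)) chart_inv dot0l ltW.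
have boundary y : quad a p y <= t -> ~ V y -> PI (fun=> 1) y = PI (fun=> 1) x.
  move=> yt /negP; rewrite -leNgt => ty; apply: poisson_one_radial => //.
  by apply/eqP; rewrite eq_le yt.
have cPI y : quad a p y <= t -> {for y, continuous (PI (fun=> 1))}.
  by move=> /KU Uy; exact: poisson_continuous.
have dcst (b : R) (y : vec) : pure_second (fun=> b) y /\ laplacian (fun=> b) y = 0.
  have [|h ->] := @pure_second_derive R d (fun=> b) (fun _ _ => 0) (fun=> 0) y.
    by move=> i; apply: (@filterE _ (nbhs y)) => z; exact: is_derive_cst.
  by split=> //; rewrite big1.
have dPI y : V y -> pure_second (PI (fun=> 1)) y /\ laplacian (PI (fun=> 1)) y = 0.
  move=> /VU Uy; split; last exact: poisson_laplacian.
  move=> i; split; last by have [] := poisson_C2 sigma_unif c1 Uy i i.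
  apply: near_chart_ball Uy _ => z Uz; by have [] := poisson_C2 sigma_unif c1 Uz i i.
transitivity (PI (fun=> 1) (a^-1 *: (0 + p))); last exact: x0E.
set F := PI (fun=> 1) in boundary cPI dPI *; set b := F x.
have cK := @compact_quad_le t.
have VK : V `<=` [set y | quad a p y <= t] by move=> y; exact: ltW.
have cb (G H : vec -> R) : (forall y, quad a p y <= t -> {for y, continuous G}) ->
    (forall y, quad a p y <= t -> {for y, continuous H}) ->
    {within [set y | quad a p y <= t], continuous (fun y => G y - H y)}.
  move=> cG cH; apply: continuous_in_subspaceT => y /set_mem yt.
  exact: (@continuousB _ _ _ G H y (cG y yt) (cH y yt)).
have ccst y : quad a p y <= t -> {for y, continuous (fun=> b : R)}.
  by move=> _; exact: cst_continuous.
have bd1 y : quad a p y <= t -> ~ V y -> b <= F y.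
  by move=> yt nV; rewrite (boundary _ yt nV).
have bd2 y : quad a p y <= t -> ~ V y -> F y <= b.
  by move=> yt nV; rewrite (boundary _ yt nV).
have sub1 : subharmonic V (fun=> b).
  by apply: smooth_subharmonic => y _; have [h ->] := dcst b y; split.
have sub2 : subharmonic V F.
  by apply: smooth_subharmonic => y /dPI[h ->]; split.
have sup1 y : V y -> pure_second F y /\ laplacian F y <= 0.
  by move=> /dPI[h ->]; split.
have sup2 y : V y -> pure_second (fun=> b) y /\ laplacian (fun=> b) y <= 0.
  by move=> _; have [h ->] := dcst b y; split.
apply/eqP; rewrite eq_le; apply/andP; split.
- exact: (comparison dim_gt0 cK oV VK (cb _ _ ccst cPI) bd1 sub1 sup1 center).
- exact: (comparison dim_gt0 cK oV VK (cb _ _ cPI ccst) bd2 sub2 sup2 center).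
Qed.

Lemma poisson_le (g1 g2 : vec -> R) x : U x -> sphere_continuous g1 -> sphere_continuous g2 ->
  (forall z, S z -> g1 z <= g2 z) -> PI g1 x <= PI g2 x.
Proof.
move=> Ux c1 c2 g12; apply: sphere_mean_le => [||z Sz].
- by apply: sphere_continuousM => //; exact: sphere_continuous_kernel.
- by apply: sphere_continuousM => //; exact: sphere_continuous_kernel.
by rewrite ler_wpM2l ?g12// poisson_kernel_ge0.
Qed.

Lemma poisson_cst (b : R) x : U x -> PI (fun=> b) x = b.
Proof.
move=> Ux; rewrite -[RHS]mulr1 -(poisson_one Ux) -sphere_meanZ.
  by apply: eq_sphere_mean => z _; rewrite mulr1 mulrC.
by apply: sphere_continuousM; [exact: sphere_continuous_kernel|exact: sphere_continuous_cst].
Qed.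

Lemma poissonB (g1 g2 : vec -> R) x : U x -> sphere_continuous g1 -> sphere_continuous g2 ->
  PI (fun z => g1 z - g2 z) x = PI g1 x - PI g2 x.
Proof.
move=> Ux c1 c2; rewrite -sphere_meanB.
- by apply: eq_sphere_mean => z _; rewrite mulrBr.
- by apply: sphere_continuousM => //; exact: sphere_continuous_kernel.
- by apply: sphere_continuousM => //; exact: sphere_continuous_kernel.
Qed.

(** The chart image of [x] is within [delta] of the unit vector [z0], so the numerator is at most 2
    delta, while its distance to [z] stays at least eta / 2. *)
Lemma poisson_kernel_away x z z0 (eta delta : R) : U x -> S z -> S z0 -> 0 < eta ->
  eucl_norm (W x - z0) < delta -> delta <= eta / 2 -> eta <= eucl_norm (z - z0) ->
  K x z <= 2 * delta * ((eta / 2) ^+ 2) `^ (- (d%:R / 2)).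
Proof.
move=> Ux Sz Sz0 eta0 xd de zz0.
have e2 : 0 < eta / 2 by rewrite divr_gt0.
have nWx : eucl_norm (W x) <= 1.
  rewrite -(ler_pXn2r (n := 2))// ?nnegrE ?eucl_norm_ge0// sqr_eucl_norm expr1n.
  exact: ltW.
have far : eta / 2 <= eucl_norm (W x - z).
  have := eucl_dist_triangle z (W x) z0; rewrite (eucl_distC z (W x)).
  by move: (eucl_norm (W x - z)) (eucl_norm (W x - z0)) (eucl_norm (z - z0)) xd zz0 => A B C; lra.
apply: ler_pM; [by rewrite subr_ge0; exact: ltW|exact: powR_ge0| |].
  rewrite -[quad a p x]/(dot (W x) (W x)) -sqr_eucl_norm.
  have : 1 - eucl_norm (W x) <= delta.
    have := ler_eucl_norm_dist z0 (W x); rewrite Sz0 eucl_distC.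
    move=> /(le_trans (ler_norm _)) h; apply: le_trans h (ltW xd).
  have := eucl_norm_ge0 (W x); move: (eucl_norm (W x)) nWx => A A1 A0 Ad.
  have : (1 - A) * (1 + A) <= delta * 2 by apply: ler_pM => //; lra.
  by rewrite (_ : (1 - A) * (1 + A) = 1 - A ^+ 2); [rewrite mulrC|ring].
rewrite quad_shift -sqr_eucl_norm !powRN lef_pV2 ?posrE ?powR_gt0 ?exprn_gt0//; last first.
  exact: lt_le_trans far.
apply: ge0_ler_powR; rewrite ?nnegrE ?divr_ge0 ?exprn_ge0 ?eucl_norm_ge0 ?(ltW e2)//.
by rewrite ler_pXn2r ?nnegrE ?eucl_norm_ge0 ?(ltW e2).
Qed.

(** The kernel is an approximate identity. Close to [z0] the oscillation of [g] is small, elsewhere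
    the kernel is; the bound [hK] covers both regions at once and has mean [e], so the integral need
    not be split. *)
Lemma poisson_boundary (g : vec -> R) z0 (e : R) : sphere_continuous g -> S z0 -> 0 < e ->
  exists2 delta, 0 < delta & forall x, U x -> eucl_norm (W x - z0) < delta ->
    `|PI g x - g z0| <= e.
Proof.
move=> cg Sz0 e0; have [C [C0 gC]] := sphere_continuous_bounded cg.
have e20 : 0 < e / 2 by rewrite divr_gt0.
have := cg _ Sz0 => /(@cvgrPdist_lt _ _ _ (nbhs z0))/(_ _ e20)/nbhs_eucl[eta eta0 heta].
set m := ((eta / 2) ^+ 2) `^ (- (d%:R / 2)).
have m0 : 0 <= m by exact: powR_ge0.
(* Away from [z0] the kernel is at most 2 delta m and the oscillation at most 2 C, so their product
   is below delta D; the summand 1 makes [D] positive. *)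
pose D := (2 * C) * (2 * m) + 1.
have D0 : 0 < D by rewrite ltr_wpDl// !mulr_ge0.
pose delta := Num.min (eta / 2) (e / 2 / D).
have de : delta <= eta / 2 by rewrite ge_min lexx.
have dD : delta * D <= e / 2 by rewrite -ler_pdivlMr// ge_min lexx orbT.
exists delta; first by rewrite lt_min !divr_gt0.
have delta0 : 0 <= delta by rewrite le_min !divr_ge0 ?ltW.
move=> x Ux xd; have cKx := sphere_continuous_kernel Ux.
pose h z := g z - g z0.
have ch : sphere_continuous h by apply: sphere_continuousB => //; exact: sphere_continuous_cst.
have -> : PI g x - g z0 = PI h x.
  by rewrite poissonB ?poisson_cst//; exact: sphere_continuous_cst.
have hK z : S z -> `|K x z * h z| <= K x z * (e / 2) + e / 2.
  move=> Sz; have K0 := poisson_kernel_ge0 z Ux.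
  rewrite normrM (ger0_norm K0); have [zz0|zz0] := ltP (eucl_norm (z - z0)) eta.
    have /= gz := heta _ zz0; rewrite ler_wpDr ?(ltW e20)// ler_wpM2l//.
    by rewrite /h distrC ltW.
  rewrite (ler_wpDl (mulr_ge0 K0 (ltW e20)))//; apply: (le_trans _ dD).
  have Kd := poisson_kernel_away Ux Sz Sz0 eta0 xd de zz0.
  have hC : `|h z| <= 2 * C.
    by apply: le_trans (ler_normB _ _) _; rewrite mulr_natl mulr2n lerD// gC.
  apply: le_trans (ler_pM K0 (normr_ge0 _) Kd hC) _.
  rewrite -/m /D mulrDr mulr1 ler_wpDr//.
  by rewrite le_eqVlt; apply/orP; left; apply/eqP; ring.
have cKh : sphere_continuous (fun z => K x z * h z) by exact: sphere_continuousM.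
have cKe : sphere_continuous (fun z => K x z * (e / 2) + e / 2).
  move=> z Sz; apply: (@continuousD _ _ _ (fun z => K x z * (e / 2)) (cst (e / 2))).
    by apply: (@sphere_continuousM _ _ (K x) (cst (e / 2))) => // y _; exact: cst_continuous.
  exact: cst_continuous.
have Me : M (fun z => K x z * (e / 2) + e / 2) = e.
  rewrite sphere_meanD ?sphere_mean_cst//.
  - by rewrite -[M _]/(PI (fun=> e / 2) x) poisson_cst// -splitr.
  - by apply: sphere_continuousM => //; exact: sphere_continuous_cst.
  - exact: sphere_continuous_cst.
rewrite -Me ler_norml; apply/andP; split.
  rewrite -mulN1r -sphere_meanZ//; apply: sphere_mean_le => //; first exact: sphere_continuousZ.
  by move=> z /hK; rewrite ler_norml mulN1r => /andP[].
by apply: sphere_mean_le => // z /hK; rewrite ler_norml => /andP[].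
Qed.

End PoissonBoundary.

(** * The Dirichlet problem in a ball and balayage *)

Section BallSolution.
Context {R : realType} {d : nat} (sigma : probability (borelRd R d) R).
Hypothesis sigma_unif : uniform_on_sphere sigma.
Local Notation S := (@unit_sphere R d).
Local Notation M := (sphere_mean sigma).
Local Notation vec := 'rV[R]_d.

Lemma C2_near_eq (F G : vec -> R) x : (\forall y \near x, F y = G y) ->
  (forall i j : 'I_d, [/\ derivable F x (delta_mx ord0 i),
     derivable (partial i F) x (delta_mx ord0 j) &
     {for x, continuous (partial j (partial i F))}]) ->
  (forall i j : 'I_d, [/\ derivable G x (delta_mx ord0 i),
     derivable (partial i G) x (delta_mx ord0 j) &
     {for x, continuous (partial j (partial i G))}]).
Proof.
move=> FG h i j; have [h1 h2 h3] := h i j.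
have FGi := partial_near_eq i FG; have FGij := partial_near_eq j FGi.
split; [exact: near_eq_derivable h1|exact: near_eq_derivable h2|].
move: h3; rewrite /prop_for /continuous_at (nbhs_singleton FGij); apply: cvg_trans.
exact: (near_eq_cvg FGij).
Qed.

Lemma C2_pure_second (W : set vec) F x : open W -> C2_on W F -> W x -> pure_second F x.
Proof.
move=> oW CF Wx i; split; last by have [] := CF x Wx i i.
have := open_nbhs_nbhs (conj oW Wx); apply: filterS => y Wy.
by have [] := CF y Wy i i.
Qed.

Section Ball.
Variables (c : vec) (rho : R).
Hypothesis rho0 : 0 < rho.
Local Notation a := (rho^-1).
Local Notation p := (rho^-1 *: c).
Local Notation B := (eucl_ball c rho).

Let a_gt0 : 0 < a. Proof. by rewrite invr_gt0. Qed.

Lemma chart_center x : chart a p x = a *: (x - c).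
Proof. by rewrite /chart scalerBr. Qed.

Lemma chart_ballE : chart_ball a p = B.
Proof.
apply/seteqP; split=> x; rewrite /chart_ball /eucl_ball /= -[quad _ _ _]/(dot (chart a p x) (chart a p x));
  rewrite -sqr_eucl_norm chart_center eucl_normZ gtr0_norm// => h.
  have {}h : a * eucl_norm (x - c) < 1.
    by rewrite -(@ltr_pXn2r _ 2)// ?nnegrE ?mulr_ge0 ?eucl_norm_ge0 ?(ltW a_gt0)// expr1n.
  by move: h; rewrite mulrC ltr_pdivrMr// mul1r.
rewrite -[ltRHS](expr1n _ 2) ltr_pXn2r// ?nnegrE ?mulr_ge0 ?eucl_norm_ge0 ?(ltW a_gt0)//.
by rewrite mulrC ltr_pdivrMr// mul1r.
Qed.

Definition sphere_data (g : vec -> R) (z : vec) : R := g (c + rho *: z).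

Definition ball_solution (g : vec -> R) : vec -> R :=
  poisson_integral sigma a p (sphere_data g).
Local Notation H := ball_solution.

Lemma sphere_dataE z : S z -> eucl_norm (c + rho *: z - c) = rho.
Proof. by move=> Sz; rewrite addrC addKr eucl_normZ Sz mulr1 gtr0_norm. Qed.

Lemma sphere_data_continuous (g : vec -> R) :
  (forall y, eucl_norm (y - c) = rho -> {for y, continuous g}) ->
  sphere_continuous (sphere_data g).
Proof.
move=> cg z Sz; rewrite -[sphere_data g]/(g \o (fun z => c + rho *: z)).
apply: continuous_comp.
  apply: (@continuousD _ _ _ (cst c) (fun z : vec => rho *: z)); first exact: cst_continuous.
  exact: scaler_continuous.
by apply: cg; exact: sphere_dataE.
Qed.

Section Data.
Variable g : vec -> R.
Hypothesis cg : forall y, eucl_norm (y - c) = rho -> {for y, continuous g}.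
Let cdata := sphere_data_continuous cg.

Lemma ball_solution_C2 : C2_on B (H g).
Proof. by rewrite -chart_ballE; exact: poisson_C2. Qed.

Lemma ball_solution_laplacian x : B x -> laplacian (H g) x = 0.
Proof. by rewrite -chart_ballE; exact: poisson_laplacian. Qed.

Lemma ball_solution_continuous x : B x -> {for x, continuous (H g)}.
Proof. by rewrite -chart_ballE; exact: poisson_continuous. Qed.

Lemma ball_solution_center : H g c = M (fun z => g (c + rho *: z)).
Proof. by rewrite /H poisson_center// chart_center subrr scaler0. Qed.

Lemma ball_solution_boundary y (e : R) : eucl_norm (y - c) = rho -> 0 < e ->
  \forall x \near y, B x -> `|H g x - g y| <= e.
Proof.
move=> yc e0; pose z0 := a *: (y - c).
have Sz0 : S z0 by rewrite /unit_sphere /= eucl_normZ gtr0_norm// yc mulVf ?gt_eqF.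
have [delta delta0 hd] := poisson_boundary sigma_unif p a_gt0 cdata Sz0 e0.
apply/nbhs_eucl; exists (rho * delta); first exact: mulr_gt0.
move=> x /= xy; rewrite -chart_ballE => Bx.
have gE : sphere_data g z0 = g y.
  by rewrite /sphere_data /z0 scalerA mulfV ?gt_eqF// scale1r addrC subrK.
rewrite -gE; apply: hd => //; rewrite chart_center /z0 -scalerBr opprB addrA subrK.
by rewrite eucl_normZ gtr0_norm// mulrC ltr_pdivrMr// mulrC.
Qed.

End Data.

(** Known as the Poisson modification of [g]. The strict test keeps [g] itself on the sphere, where
    the Poisson integral has the right limits. *)
Definition balayage (g : vec -> R) (x : vec) : R :=
  if eucl_norm (x - c) < rho then H g x else g x.

Lemma balayage_in g x : B x -> balayage g x = H g x.
Proof. by rewrite /balayage /eucl_ball /= => ->. Qed.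

Lemma balayage_out g x : ~ B x -> balayage g x = g x.
Proof. by rewrite /balayage /eucl_ball /=; case: ifP. Qed.

Lemma balayage_near g x : B x -> \forall y \near x, H g y = balayage g y.
Proof.
move=> Bx; have := open_nbhs_nbhs (conj (@open_eucl_ball R d c rho) Bx).
by apply: filterS => y By; rewrite balayage_in.
Qed.

Lemma balayage_continuous g : continuous g -> continuous (balayage g).
Proof.
move=> cg x; have cg' y : eucl_norm (y - c) = rho -> {for y, continuous g} by move=> _; exact: cg.
have [Bx|xr|yc] := ltgtP (eucl_norm (x - c)) rho.
- have := ball_solution_continuous cg' Bx; rewrite /prop_for /continuous_at -(balayage_in g Bx).
  by apply: cvg_trans; apply: (near_eq_cvg (balayage_near g Bx)).
- have : \forall y \near x, g y = balayage g y.
    have := @continuous_eucl_dist_pt R d c x.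
    move=> /(@cvgr_gt _ _ (nbhs x))/(_ _ xr); apply: filterS => y ry.
    by rewrite balayage_out// /eucl_ball /=; apply/negP; rewrite -leNgt ltW.
  move=> gE; have := cg x; rewrite /continuous_at (nbhs_singleton gE).
  by apply: cvg_trans; apply: (near_eq_cvg gE).
- have gx : balayage g x = g x by rewrite balayage_out// /eucl_ball /= yc ltxx.
  rewrite /continuous_at gx; apply/(@cvgrPdist_le _ _ _ (nbhs x)) => e e0.
  have h1 := ball_solution_boundary cg' yc e0.
  have h2 : \forall y \near x, `|g x - g y| <= e.
    by have := cg x => /(@cvgrPdist_le _ _ _ (nbhs x))/(_ _ e0).
  apply: filterS2 h1 h2 => y h1 h2; rewrite /balayage; case: ifPn => // By.
  by rewrite distrC; exact: h1.
Qed.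

Lemma balayage_pure_second g x : continuous g -> B x ->
  pure_second (balayage g) x /\ laplacian (balayage g) x = 0.
Proof.
move=> cg Bx; have cg' y : eucl_norm (y - c) = rho -> {for y, continuous g} by move=> _; exact: cg.
split.
  apply: (pure_second_near_eq (balayage_near g Bx)).
  exact: (C2_pure_second (@open_eucl_ball R d c rho) (ball_solution_C2 cg') Bx).
by rewrite -(laplacian_near_eq (balayage_near g Bx)) ball_solution_laplacian.
Qed.

Section Modification.
Variables (V : set vec) (s : vec -> R).
Hypotheses (BV : eucl_cball c rho `<=` V) (cs : continuous s) (ss : subharmonic V s).

Lemma balayage_ge x : s x <= balayage s x.
Proof.
have [Bx|/negP nB] := boolP (eucl_norm (x - c) < rho); last by rewrite balayage_out.
have cK : compact (eucl_cball c rho) by exact: compact_eucl_cball.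
have WK : B `<=` eucl_cball c rho by move=> y; exact: ltW.
have cH : {within eucl_cball c rho, continuous (fun y => s y - balayage s y)}.
  apply: continuous_subspaceT => y.
  by apply: (@continuousB _ _ _ s (balayage s) y); [exact: cs|exact: balayage_continuous].
have bd y : eucl_cball c rho y -> ~ B y -> s y <= balayage s y.
  by move=> _ nB; rewrite balayage_out.
have ssB : subharmonic B s.
  by move=> y /WK/BV Vy; exact: ss.
have hH y : B y -> pure_second (balayage s) y /\ laplacian (balayage s) y <= 0.
  by move=> /(balayage_pure_second cs)[h ->].
exact: (comparison (dim_gt0 sigma_unif) cK (@open_eucl_ball R d c rho) WK cH bd ssB hH (WK _ Bx)).
Qed.

(** Inside the ball the modification is harmonic. At any other point, those of the sphere included,
    it equals [s] and nowhere lies below it, so a function touching it from above touches [s]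
    too. *)
Lemma balayage_subharmonic : subharmonic V (balayage s).
Proof.
move=> x Vx; have [Bx|/negP nB] := boolP (eucl_norm (x - c) < rho).
  have : subharmonic B (balayage s).
    by apply: smooth_subharmonic => y /(balayage_pure_second cs)[h ->].
  by apply.
move=> psi dpsi le_psi; apply: (ss Vx dpsi).
apply: filterS le_psi => y; rewrite (balayage_out s nB); apply: le_trans.
by rewrite lerD2r balayage_ge.
Qed.

End Modification.

End Ball.

End BallSolution.

(** * Perron's method *)

Section Perron.
Context {R : realType} {d : nat} (sigma : probability (borelRd R d) R).
Hypothesis sigma_unif : uniform_on_sphere sigma.
Local Notation S := (@unit_sphere R d).
Local Notation M := (sphere_mean sigma).
Local Notation vec := 'rV[R]_d.
Variables (V : set vec) (f : vec -> R) (m : R).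
Hypotheses (V_open : open V) (V_bounded : bounded_set V).
Hypothesis f_bound : forall v, boundary V v -> `|f v| <= m.
Hypothesis m_ge0 : 0 <= m.
Implicit Types s : vec -> R.

Lemma boundaryE : boundary V = closure V `\` V.
Proof. by rewrite /boundary (interior_id V).1. Qed.

Lemma closure_cases x : closure V x -> V x \/ boundary V x.
Proof. by move=> cx; have [Vx|nVx] := pselect (V x); [left|right; rewrite boundaryE]. Qed.

Lemma boundary_closure x : boundary V x -> closure V x.
Proof. by case. Qed.

Lemma boundary_notin x : boundary V x -> ~ V x.
Proof. by rewrite boundaryE => -[]. Qed.

Lemma compact_closure : compact (closure V).
Proof.
have /bounded_eucl[C VC] := V_bounded.
apply: (@subclosed_compact _ _ (eucl_cball 0 C)); first exact: closed_closure.
  exact: compact_eucl_cball.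
have /closure_id -> := @closed_eucl_cball R d 0 C.
by apply: closure_subset => x Vx; rewrite /eucl_cball /= subr0; exact: VC.
Qed.

Lemma comparison_closure s (H : vec -> R) : continuous s -> continuous H ->
  (forall v, boundary V v -> s v <= H v) -> subharmonic V s ->
  (forall x, V x -> pure_second H x /\ laplacian H x <= 0) ->
  forall x, closure V x -> s x <= H x.
Proof.
move=> cs cH bd subs hH x.
have ctn : {within closure V, continuous (fun x => s x - H x)}.
  by apply: continuous_subspaceT => y; apply: (@continuousB _ _ _ s H y); [exact: cs|exact: cH].
have bd' y : closure V y -> ~ V y -> s y <= H y.
  by move=> cy nVy; apply: bd; rewrite boundaryE.
exact: (comparison (dim_gt0 sigma_unif) compact_closure V_open (@subset_closure _ V) ctn bd' subs hH).
Qed.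

(** Members are continuous on the whole space; maxima and balayage preserve this, so no
    semicontinuous functions arise. *)
Definition perron_class s := [/\ continuous s, subharmonic V s &
  forall v, boundary V v -> s v <= f v].

Definition perron (x : vec) : R := sup [set s x | s in perron_class].
Local Notation u := perron.

Lemma cst_second (b : R) (y : vec) : pure_second (fun=> b) y /\ laplacian (fun=> b) y = 0.
Proof.
have [|h ->] := @pure_second_derive R d (fun=> b) (fun _ _ => 0) (fun=> 0) y.
  by move=> i; apply: (@filterE _ (nbhs y)) => z; exact: is_derive_cst.
by split=> //; rewrite big1.
Qed.

Lemma subharmonic_cst (W : set vec) (b : R) : subharmonic W (fun=> b).
Proof. by apply: smooth_subharmonic => y _; have [h ->] := cst_second b y; split. Qed.

Lemma perron_class_cst : perron_class (fun=> - m).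
Proof.
split; [by move=> x; exact: cst_continuous|exact: subharmonic_cst|].
by move=> v /f_bound; rewrite ler_norml => /andP[].
Qed.

Lemma perron_class_max s1 s2 : perron_class s1 -> perron_class s2 ->
  perron_class (fun x => Num.max (s1 x) (s2 x)).
Proof.
move=> [c1 sub1 b1] [c2 sub2 b2]; split.
- by move=> x; apply: (@continuous_max _ _ s1 s2 x); [exact: c1|exact: c2].
- exact: subharmonic_max.
- by move=> v bv; rewrite ge_max b1// b2.
Qed.

Lemma perron_class_le s x : perron_class s -> closure V x -> s x <= m.
Proof.
move=> [cs subs bs] cx; apply: (comparison_closure cs _ _ subs _ cx).
- by move=> y; exact: cst_continuous.
- by move=> v bv; apply: le_trans (bs _ bv) _; have := f_bound bv; rewrite ler_norml => /andP[].
- by move=> y _; have [h ->] := cst_second m y; split.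
Qed.

Lemma perron_has_sup x : closure V x -> has_sup [set s x | s in perron_class].
Proof.
move=> cx; split; first by exists (- m), (fun=> - m) => //; exact: perron_class_cst.
by exists m => _ [s cs <-]; exact: perron_class_le.
Qed.

Lemma perron_ge s x : perron_class s -> closure V x -> s x <= u x.
Proof. by move=> cs cx; apply: (sup_upper_bound (perron_has_sup cx)); exists s. Qed.

Lemma perron_le x (b : R) : closure V x -> (forall s, perron_class s -> s x <= b) -> u x <= b.
Proof.
move=> cx sb; apply: ge_sup; first by have [] := perron_has_sup cx.
by move=> _ [s cs <-]; exact: sb.
Qed.

Lemma perron_norm_le x : closure V x -> `|u x| <= m.
Proof.
move=> cx; rewrite ler_norml; apply/andP; split; first exact: (perron_ge perron_class_cst cx).
by apply: perron_le => // s cs; exact: perron_class_le.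
Qed.

Lemma perron_class_balayage c (rho : R) s : 0 < rho -> eucl_cball c rho `<=` V ->
  perron_class s -> perron_class (balayage sigma c rho s).
Proof.
move=> rho0 BV [cs subs bs]; split.
- exact: balayage_continuous.
- exact: balayage_subharmonic.
move=> v bv; rewrite balayage_out; first exact: bs.
by move=> /ltW/BV; exact: boundary_notin.
Qed.

Lemma ball_in_open x (W : set vec) : open W -> W x -> exists2 rho : R, 0 < rho & eucl_cball x rho `<=` W.
Proof.
move=> oW Wx; have /nbhs_eucl[e e0 eW] := open_nbhs_nbhs (conj oW Wx).
exists (e / 2); first by rewrite divr_gt0.
by move=> y yx; apply: eW; apply: le_lt_trans yx _; rewrite ltr_pdivrMr// ltr_pMr// ltr1n.
Qed.

(** Each member lies below another one that is a Poisson integral, in a fixed ball about [x], of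
    data bounded by [m]. Uniform continuity of the kernel in its first variable gives these a common
    modulus at [x], which the supremum inherits. *)
Lemma perron_continuous x : V x -> {for x, continuous u}.
Proof.
move=> Vx; have [rho rho0 BV] := ball_in_open V_open Vx.
have Bx : eucl_ball x rho x by rewrite /eucl_ball /= subrr eucl_norm0.
have BE := chart_ballE x rho0.
have Ux : chart_ball (rho^-1) (rho^-1 *: x) x by rewrite BE.
apply/(@cvgrPdist_le _ _ _ (nbhs x)) => e e0.
have e'0 : 0 < e / (m + 1) by rewrite divr_gt0// ltr_wpDl.
have := jointly_continuous_uniform (jointly_continuous_kernel Ux) e'0.
apply: filterS2 (open_nbhs_nbhs (conj (@open_eucl_ball R d x rho) Bx)) => y By Kyz.
have a0 : 0 < rho^-1 by rewrite invr_gt0.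
have Uy : chart_ball (rho^-1) (rho^-1 *: x) y by rewrite BE.
have [cVx cVy] : closure V x /\ closure V y.
  by split; apply: subset_closure => //; apply: BV; exact: ltW.
have key s : perron_class s -> exists2 t, perron_class t &
    [/\ s x <= t x, s y <= t y & `|t x - t y| <= e].
  (* Members are bounded above by [m] only; the maximum with - m supplies the lower bound that makes
     the modulus independent of [s]. *)
  move=> hs; pose s1 z := Num.max (s z) (- m).
  have hs1 : perron_class s1 := perron_class_max hs perron_class_cst.
  have [cs1 subs1 _] := hs1.
  have s1_bound z : V z -> `|s1 z| <= m.
    move=> Vz; rewrite ler_norml; apply/andP; split; first by rewrite le_max lexx orbT.
    by apply: perron_class_le => //; exact: subset_closure.
  exists (balayage sigma x rho s1); first exact: perron_class_balayage.
  have ss1 z : s z <= balayage sigma x rho s1 z.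
    apply: le_trans (balayage_ge sigma_unif rho0 BV cs1 subs1 z).
    by rewrite le_max lexx.
  split=> //; rewrite !balayage_in//.
  have cdata : sphere_continuous (sphere_data x rho s1).
    by apply: sphere_data_continuous => // z _; exact: cs1.
  have cKx := sphere_continuous_kernel Ux; have cKy := sphere_continuous_kernel Uy.
  rewrite -sphere_meanB; [|exact: sphere_continuousM..].
  apply: (sphere_mean_norm_le sigma_unif).
    by apply: sphere_continuousB; exact: sphere_continuousM.
  move=> z Sz; rewrite -mulrBl normrM distrC.
  apply: le_trans (_ : e / (m + 1) * m <= _).
    apply: ler_pM => //; first by rewrite ltW// Kyz.
    by apply: s1_bound; apply: BV; rewrite /eucl_cball /= sphere_dataE.
  by rewrite mulrAC ler_pdivrMr ?ler_wpM2l ?(ltW e0)// ?lerDl// ltr_wpDl.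
have ineq (z w : vec) : closure V z -> closure V w ->
    (forall s, perron_class s -> exists2 t, perron_class t & s z <= t z /\ `|t z - t w| <= e) ->
    u z - u w <= e.
  move=> cz cw h; rewrite lerBlDr; apply: perron_le => // s /h[t ht [st tzw]].
  apply: le_trans st _; rewrite -lerBlDr.
  apply: (le_trans _ tzw); apply: le_trans (ler_norm _); rewrite lerB//.
  exact: perron_ge.
rewrite ler_norml; apply/andP; split.
  rewrite lerNl opprB; apply: ineq => // s /key[t ht [? ? ?]]; exists t => //.
  by rewrite distrC.
by apply: ineq => // s /key[t ht [? ? ?]]; exists t.
Qed.

(** A member close to [u] at one point is close to it in a neighbourhood, both being continuous;
    finitely many neighbourhoods cover [A], and the maximum of the corresponding members works on
    all of it. *)
Lemma perron_approx (A : set vec) (e : R) : compact A -> A `<=` V -> 0 < e ->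
  exists2 s, perron_class s & forall x, A x -> u x - e <= s x.
Proof.
move=> cA AV e0; have e20 : 0 < e / 2 by rewrite divr_gt0.
have cV x : A x -> closure V x by move=> /AV; exact: subset_closure.
have [s_ hs_] : exists s_ : vec -> vec -> R, forall x, A x ->
    perron_class (s_ x) /\ u x - e / 2 < s_ x x.
  have h x : exists s, A x -> perron_class s /\ u x - e / 2 < s x.
    have [Ax|] := pselect (A x); last by exists (fun=> 0).
    have [_ [s hs <-] us] := sup_adherent e20 (perron_has_sup (cV _ Ax)).
    by exists s.
  by have /choice[s_] := h; exists s_.
pose D x := [set y | u y - e < s_ x y]°.
have [J JA cover] : exists2 J : {fset vec}, {subset J <= A} & A `<=` \bigcup_(x in [set` J]) D x.
  have := cA; rewrite compact_cover => /(_ vec A D); apply.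
    by move=> x _; exact: open_interior.
  move=> x Ax; exists x => //; have [[cs _ _] us] := hs_ x Ax.
  have cu := perron_continuous (AV _ Ax).
  have cd : {for x, continuous (fun y => s_ x y - u y)}.
    by apply: (@continuousB _ _ _ (s_ x) u x); [exact: cs|exact: cu].
  have lt : - e < s_ x x - u x by move: us; set a := s_ x x; set b := u x; lra.
  have := cd => /(@cvgr_gt _ _ (nbhs x))/(_ _ lt); apply: filterS => y.
  by rewrite ltrBrDr addrC.
have [s hs sJ] : exists2 s, perron_class s & forall x, x \in J -> forall y, s_ x y <= s y.
  have : forall x, x \in enum_fset J -> A x by move=> x /JA /set_mem.
  move=> h; suff [s hs sJ] : exists2 s, perron_class s &
      forall x, x \in enum_fset J -> forall y, s_ x y <= s y by exists s.
  elim: (enum_fset J) h => [|x r IH] h.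
    by exists (fun=> - m); [exact: perron_class_cst|].
  have [|s hs sr] := IH.
    by move=> y yr; apply: h; rewrite inE yr orbT.
  have [hx _] := hs_ x (h x (mem_head _ _)).
  exists (fun y => Num.max (s_ x y) (s y)); first exact: perron_class_max.
  move=> y; rewrite inE => /predU1P[->|/sr sy] z; first by rewrite le_max lexx.
  by rewrite le_max sy orbT.
exists s => // x /cover[y Jy /interior_subset /= us].
by apply: le_trans (ltW us) _; exact: sJ.
Qed.

(** Upper bound: a member lies below its balayage, hence below the Poisson integral of [u]. Lower
    bound: for a member within [e] of [u] on the sphere, the balayage is again a member and exceeds
    the Poisson integral of u - e. *)
Lemma perron_ball c (rho : R) x : 0 < rho -> eucl_cball c rho `<=` V -> eucl_ball c rho x ->
  u x = ball_solution sigma c rho u x.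
Proof.
move=> rho0 BV Bx; have a0 : 0 < rho^-1 by rewrite invr_gt0.
have Ux : chart_ball (rho^-1) (rho^-1 *: c) x by rewrite chart_ballE.
have sphV z : S z -> V (c + rho *: z).
  by move=> Sz; apply: BV; rewrite /eucl_cball /= sphere_dataE.
have clV y : V y -> closure V y by exact: subset_closure.
have Vx : V x by apply: BV; exact: ltW.
have cu : sphere_continuous (sphere_data c rho u).
  apply: sphere_data_continuous => // y yc; apply: perron_continuous.
  by apply: BV; rewrite /eucl_cball /= yc.
have cs s : perron_class s -> sphere_continuous (sphere_data c rho s).
  by move=> [cs _ _]; apply: sphere_data_continuous => // y _; exact: cs.
apply/eqP; rewrite eq_le; apply/andP; split.
  apply: perron_le; first exact: clV.
  move=> s hs; have [ctns subs _] := hs.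
  apply: le_trans (balayage_ge sigma_unif rho0 BV ctns subs x) _.
  rewrite balayage_in//; apply: poisson_le => //; first exact: cs.
  by move=> z Sz; exact: (perron_ge hs (clV _ (sphV _ Sz))).
apply/ler_addgt0Pr => e e0.
have cA : compact ((fun z => c + rho *: z) @` S).
  apply: continuous_compact (@compact_unit_sphere R d).
  apply: continuous_subspaceT => z.
  apply: (@continuousD _ _ _ (cst c) (fun z : vec => rho *: z)); first exact: cst_continuous.
  exact: scaler_continuous.
have AV : (fun z => c + rho *: z) @` S `<=` V by move=> _ [z Sz <-]; exact: sphV.
have [s hs us] := perron_approx cA AV e0.
(* The constant [e] is its own Poisson integral, so it can be moved into the data. *)
rewrite -lerBlDr -[X in _ - X](poisson_cst sigma_unif a0 e Ux).
rewrite -poissonB//; last exact: sphere_continuous_cst.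
apply: (@le_trans _ _ (ball_solution sigma c rho s x)).
  apply: poisson_le => //; [|exact: cs|].
    by apply: sphere_continuousB => //; exact: sphere_continuous_cst.
  by move=> z Sz; apply: us; exists z.
have hg := perron_class_balayage rho0 BV hs.
by have := perron_ge hg (clV _ Vx); rewrite balayage_in.
Qed.

Lemma perron_mean c (rho : R) : 0 < rho -> eucl_cball c rho `<=` V ->
  u c = M (fun z => u (c + rho *: z)).
Proof.
move=> rho0 BV; have Bc : eucl_ball c rho c by rewrite /eucl_ball /= subrr eucl_norm0.
by rewrite [LHS](perron_ball rho0 BV Bc) ball_solution_center.
Qed.

Lemma perron_harmonic : C2_on V u /\ (forall x, V x -> laplacian u x = 0).
Proof.
have loc x : V x -> exists2 rho : R, 0 < rho & eucl_ball x rho x /\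
    [/\ eucl_cball x rho `<=` V, \forall y \near x, ball_solution sigma x rho u y = u y
      & forall y, eucl_norm (y - x) = rho -> {for y, continuous u}].
  move=> Vx; have [rho rho0 BV] := ball_in_open V_open Vx; exists rho => //.
  have Bx : eucl_ball x rho x by rewrite /eucl_ball /= subrr eucl_norm0.
  split=> //; split=> //.
    have := open_nbhs_nbhs (conj (@open_eucl_ball R d x rho) Bx).
    by apply: filterS => y By; rewrite [RHS](perron_ball rho0 BV).
  by move=> y yx; apply: perron_continuous; apply: BV; rewrite /eucl_cball /= yx.
split=> x Vx; have [rho rho0 [Bx [BV uE cu]]] := loc x Vx.
  apply: (C2_near_eq uE); exact: (ball_solution_C2 sigma_unif rho0 cu Bx).
by rewrite -(laplacian_near_eq uE) ball_solution_laplacian.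
Qed.

End Perron.

(** * The exterior ball barrier *)

Section Gauss.
Context {R : realType} {d : nat}.
Local Notation vec := 'rV[R]_d.
Variables (alpha : R) (c : vec).

Definition gauss (x : vec) : R := expR (- (alpha * quad 1 c x)).

Lemma is_derive_gauss x v : is_derive x v gauss
  (gauss x * (- (alpha * (2 * dot (1 *: x - c) v)))).
Proof.
have h := is_deriveN (is_deriveZ alpha (is_derive_quad 1 c x v)).
have h' : is_derive x v (fun y => - (alpha * quad 1 c y)) (- (alpha * (2 * 1 * dot (1 *: x - c) v))) := h.
rewrite mulr1 in h'.
exact: (is_derive_compl (is_derive_expR _) h').
Qed.

Lemma continuous_gauss : continuous gauss.
Proof.
move=> x; apply: (@continuous_comp _ _ _ (fun x => - (alpha * quad 1 c x)) expR).
  apply: (@continuousN _ _ _ (fun x => alpha * quad 1 c x)).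
  by apply: (@continuousM _ _ (cst alpha) (quad 1 c)); [exact: cst_continuous|exact: continuous_quad].
exact: continuous_expR.
Qed.

Lemma gauss_second x : pure_second gauss x /\
  laplacian gauss x = 2 * alpha * (2 * alpha * quad 1 c x - d%:R) * gauss x.
Proof.
pose w : vec := 1 *: x - c.
have [||h ->] := @pure_second_derive R d gauss
  (fun i y => gauss y * (- (alpha * (2 * dot (1 *: y - c) (delta_mx ord0 i)))))
  (fun i => - (2 * alpha) * gauss x + 4 * alpha ^+ 2 * gauss x * (w ord0 i * w ord0 i)) x.
- by move=> i; apply: (@filterE _ (nbhs x)) => y; exact: is_derive_gauss.
- move=> i; have h1 := is_derive_gauss x (delta_mx ord0 i).
  have h2 : is_derive x (delta_mx ord0 i)
      (fun y => - (alpha * (2 * dot (1 *: y - c) (delta_mx ord0 i))))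
      (- (alpha * (2 * (1 * dot (delta_mx ord0 i : vec) (delta_mx ord0 i))))) :=
    is_deriveN (is_deriveZ alpha (is_deriveZ 2 (is_derive_dotl 1 c (delta_mx ord0 i) x (delta_mx ord0 i)))).
  apply: (is_derive_eq (is_deriveM h1 h2)).
  rewrite !scale_realE dot_deltas dot_delta -/w.
  by move: (gauss x) (w ord0 i) => A B; ring.
split=> //; rewrite big_split /= sumr_const card_ord -mulr_sumr.
rewrite -[\sum_(i < d) _]/(dot w w) -mulrnAr -[_ *+ d]mulr_natr -[dot w w]/(quad 1 c x).
by move: (gauss x) (quad 1 c x) => A B; ring.
Qed.

End Gauss.

Lemma within_continuous_eucl {R : realType} {d : nat} (A : set 'rV[R]_d) (g : 'rV[R]_d -> R) :
  {within A, continuous g} <-> forall x, A x -> forall e : R, 0 < e ->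
    exists2 r : R, 0 < r & forall y, A y -> eucl_norm (y - x) < r -> `|g x - g y| <= e.
Proof.
split=> [/subspace_continuousP cg x Ax e e0|h].
  have := cg x Ax => /cvgrPdist_le/(_ _ e0)/nbhs_eucl[r r0 hr].
  by exists r => // y Ay yx; exact: hr.
apply/subspace_continuousP => x Ax; apply/cvgrPdist_le => e e0.
have [r r0 hr] := h x Ax e e0; apply/nbhs_eucl; exists r => // y yx Ay.
exact: hr.
Qed.

Section Boundary.
Context {R : realType} {d : nat} (sigma : probability (borelRd R d) R).
Hypothesis sigma_unif : uniform_on_sphere sigma.
Local Notation M := (sphere_mean sigma).
Local Notation vec := 'rV[R]_d.
Variables (V : set vec) (f : vec -> R).
Hypotheses (V_open : open V) (V_bounded : bounded_set V).
Hypothesis f_cont : {within boundary V, continuous f}.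

Lemma closed_boundary : closed (boundary V).
Proof.
rewrite /boundary setDE; apply: closedI; first exact: closed_closure.
by apply: open_closedC; exact: open_interior.
Qed.

Lemma compact_boundary : compact (boundary V).
Proof.
apply: (@subclosed_compact _ _ (closure V)); [exact: closed_boundary|exact: compact_closure|].
by move=> x [].
Qed.

Lemma boundary_data_bound : exists2 m : R, 0 <= m & forall v, boundary V v -> `|f v| <= m.
Proof.
have /compact_bounded[C [_ hC]] := continuous_compact f_cont compact_boundary.
exists (`|C| + 1); first by rewrite addr_ge0.
by move=> z Sz; apply: hC; [rewrite (le_lt_trans (ler_norm _))// ltrDl|exists z].
Qed.

(** Poincaré's condition speaks of the topological closure of the open ball, the barrier of the
    inequality |x - c| <= s. A point of the sphere is approached by contracting towards the
    centre. *)
Lemma cball_sub_closure_ball (c : vec) (s : R) : 0 < s -> eucl_cball c s `<=` closure (eucl_ball c s).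
Proof.
move=> s0 x xs A /nbhs_eucl[e e0 eA].
(* The contraction moves the point by at most t s, hence by at most e / 2. *)
pose t := Num.min 1 (e / (2 * s)).
have t0 : 0 < t by rewrite lt_min ltr01 divr_gt0// mulr_gt0.
have t1 : t <= 1 by rewrite ge_min lexx.
exists (c + (1 - t) *: (x - c)); split.
  rewrite /eucl_ball /= addrC addKr eucl_normZ ger0_norm ?subr_ge0//.
  apply: (@le_lt_trans _ _ ((1 - t) * s)); first by rewrite ler_wpM2l ?subr_ge0.
  by rewrite -[ltRHS]mul1r ltr_pM2r// ltrBlDr ltrDl.
apply: eA; rewrite /eucl_ball /=.
have -> : c + (1 - t) *: (x - c) - x = - (t *: (x - c)).
  by rewrite scalerBl scale1r addrA (addrC c) subrK addrAC subrr add0r.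
rewrite eucl_normN eucl_normZ gtr0_norm//.
apply: (@le_lt_trans _ _ (t * s)); first by rewrite ler_wpM2l// ltW.
apply: (@le_lt_trans _ _ (e / (2 * s) * s)); first by rewrite ler_wpM2r ?(ltW s0)// ge_min lexx orbT.
rewrite invfM mulrA divfK ?gt_eqF// ltr_pdivrMr// ltr_pMr// ltr1n//.
Qed.

Section Point.
Variables (v0 : vec) (c : vec) (s : R).
Hypotheses (bv0 : boundary V v0) (s0 : 0 < s).
Hypothesis touch : closure V `&` closure (eucl_ball c s) = [set v0].

(* The least alpha making gauss subharmonic outside the ball of radius s about c:
   its laplacian is 2 alpha (2 alpha |x - c|^2 - d) times itself. *)
Let alpha := d%:R / (2 * s ^+ 2).
Let s20 : 0 < s ^+ 2. Proof. by rewrite exprn_gt0. Qed.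
Let alpha0 : 0 < alpha.
Proof. by rewrite divr_gt0 ?ltr0n ?(dim_gt0 sigma_unif)// mulr_gt0. Qed.

Lemma quadE (x : vec) : quad 1 c x = eucl_norm (x - c) ^+ 2.
Proof. by rewrite sqr_eucl_norm /quad scale1r. Qed.

Lemma exterior_ball x : closure V x -> x != v0 -> s < eucl_norm (x - c).
Proof.
move=> Vx xv0; rewrite ltNge; apply/negP => xs.
have : (closure V `&` closure (eucl_ball c s)) x by split=> //; exact: cball_sub_closure_ball.
by rewrite touch => /eqP; apply/negP.
Qed.

(** As a point of the closed ball, [v0] is at distance at most [s] from [c]; as a limit of points of
    [V], which lie outside that ball, at distance at least [s]. *)
Lemma touching_point : eucl_norm (v0 - c) = s.
Proof.
have [cV cB] : (closure V `&` closure (eucl_ball c s)) v0 by rewrite touch.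
apply/eqP; rewrite eq_le; apply/andP; split.
  suff : eucl_cball c s v0 by [].
  have /closure_id -> := @closed_eucl_cball R d c s.
  by move: cB; apply: closure_subset => x; exact: ltW.
have cl : closed [set x : vec | s <= eucl_norm (x - c)].
  have -> : [set x : vec | s <= eucl_norm (x - c)] = (fun x => eucl_norm (x - c)) @^-1` [set t | s <= t] by [].
  by apply: closed_comp; [move=> x _; exact: continuous_eucl_dist_pt|exact: closed_ge].
have /closure_id clE := cl.
suff : closure [set x : vec | s <= eucl_norm (x - c)] v0 by rewrite -clE.
apply: closure_subset cV => x Vx /=; apply: ltW; apply: exterior_ball; first exact: subset_closure.
by apply/eqP => xv; move: Vx; rewrite xv; exact: boundary_notin.
Qed.

Local Notation G := (gauss alpha c).
Local Notation g0 := (expR (- (alpha * s ^+ 2))).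

Lemma gauss_touch : G v0 = g0.
Proof. by rewrite /gauss quadE touching_point. Qed.

Lemma gauss_lt x : closure V x -> x != v0 -> G x < g0.
Proof.
move=> Vx xv0; rewrite ltr_expR ltrN2 ltr_pM2l// quadE.
by rewrite ltr_pXn2r// ?nnegrE ?eucl_norm_ge0 ?(ltW s0)// exterior_ball.
Qed.

Lemma gauss_le x : closure V x -> G x <= g0.
Proof.
by move=> Vx; have [->|xv0] := eqVneq x v0; [rewrite gauss_touch|exact/ltW/gauss_lt].
Qed.

Lemma gauss_laplacian x : V x -> 0 <= laplacian G x.
Proof.
move=> Vx; have [_ ->] := gauss_second alpha c x.
apply: mulr_ge0; last exact: expR_ge0.
have a20 : 0 <= 2 * alpha by rewrite mulr_ge0 ?(ltW alpha0).
apply: mulr_ge0; rewrite ?subr_ge0//.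
have -> : d%:R = 2 * alpha * s ^+ 2.
  by rewrite /alpha; field; rewrite gt_eqF.
rewrite ler_wpM2l// quadE.
rewrite ler_pXn2r// ?nnegrE ?eucl_norm_ge0 ?(ltW s0)//.
apply: ltW; apply: exterior_ball; first exact: subset_closure.
by apply/eqP => xv; move: Vx; rewrite xv; exact: boundary_notin.
Qed.

(** Near [v0] continuity of [f] gives the term [e]; on the compact rest of the boundary g0 - G is
    bounded away from zero, so a multiple of it dominates the oscillation of [f]. *)
Lemma barrier_data (e : R) : 0 < e -> exists2 C, 0 <= C &
  forall v, boundary V v -> `|f v - f v0| <= e + C * (g0 - G v).
Proof.
move=> e0; have [m m0 fm] := boundary_data_bound.
have [r r0 hr] : exists2 r : R, 0 < r & forall v, boundary V v -> eucl_norm (v - v0) < r -> `|f v - f v0| < e.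
  have e20 : 0 < e / 2 by rewrite divr_gt0.
  have [r r0 hr] := (within_continuous_eucl _ _).1 f_cont v0 bv0 _ e20.
  exists r => // v bv vr; rewrite distrC; apply: le_lt_trans (hr v bv vr) _.
  by rewrite ltr_pdivrMr// ltr_pMr// ltr1n.
pose A := boundary V `&` [set v | r <= eucl_norm (v - v0)].
have cA : compact A.
  apply: (@subclosed_compact _ _ (boundary V)); [|exact: compact_boundary|by move=> v []].
  apply: closedI; first exact: closed_boundary.
  have -> : [set v : vec | r <= eucl_norm (v - v0)] = (fun v => eucl_norm (v - v0)) @^-1` [set t | r <= t] by [].
  by apply: closed_comp; [move=> x _; exact: continuous_eucl_dist_pt|exact: closed_ge].
have [A0|/set0P nA] := eqVneq A set0.
  exists 0 => // v bv; rewrite mul0r addr0; apply: ltW; apply: hr => //.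
  by rewrite ltNge; apply/negP => h; have : A v by []; rewrite A0.
have [|x Ax Gx] := EVT_max_rV nA cA (f := G).
  exact/continuous_subspaceT/continuous_gauss.
move: Ax; rewrite inE => -[bx rx].
have gx : 0 < g0 - G x.
  rewrite subr_gt0 gauss_lt//; first exact: boundary_closure.
  by apply/eqP => xv; move: rx; rewrite /= xv subrr eucl_norm0 leNgt r0.
(* [x] maximises [G] on the far part of the boundary, so g0 - G is at least g0 - G x there, and this
   [C] lifts it above 2 m, a bound for |f v - f v0|. *)
exists (2 * m / (g0 - G x)); first by rewrite divr_ge0 ?mulr_ge0 ?(ltW gx).
move=> v bv; have [vr|rv] := ltP (eucl_norm (v - v0)) r.
  apply: le_trans (ltW (hr _ bv vr)) _; rewrite lerDl mulr_ge0 ?divr_ge0 ?mulr_ge0 ?(ltW gx)//.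
  by rewrite subr_ge0 gauss_le//; exact: boundary_closure.
apply: le_trans (_ : 2 * m <= _).
  by apply: le_trans (ler_normB _ _) _; rewrite mulr_natl mulr2n lerD// fm.
apply: ler_wpDl; first exact: ltW.
rewrite mulrAC ler_pdivlMr// ler_wpM2l ?mulr_ge0// lerB//.
by apply: Gx; rewrite inE; split.
Qed.

(** The lower bound, as a function of the point, is itself in the Perron class because [G] is
    subharmonic in [V]; the upper bound is superharmonic there and dominates every member by
    comparison. *)
Lemma perron_barrier (m e : R) : (forall v, boundary V v -> `|f v| <= m) -> 0 <= m -> 0 < e ->
  exists2 C, 0 <= C & forall x, closure V x -> `|perron V f x - f v0| <= e + C * (g0 - G x).
Proof.
move=> fm m0 e0; have [C C0 hC] := barrier_data e0; exists C => // x Vx.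
have second (k b : R) y : pure_second (fun y => k + b * G y) y /\
    laplacian (fun y => k + b * G y) y = b * laplacian G y.
  have [dk lk] := @cst_second R d k y; have [dG _] := gauss_second alpha c y.
  by have [h ->] := pure_secondDZ b dk dG; rewrite lk add0r.
have cont (k b : R) : continuous (fun y => k + b * G y).
  move=> y; apply: (@continuousD _ _ _ (cst k) (fun y => b * G y)); first exact: cst_continuous.
  apply: (@continuousM _ _ (cst b) G); first exact: cst_continuous.
  exact: continuous_gauss.
rewrite ler_distl; apply/andP; split.
  have cl : perron_class V f (fun y => (f v0 - e - C * g0) + C * G y).
    split; [exact: cont| |].
      apply: smooth_subharmonic => y Vy; have [h ->] := second (f v0 - e - C * g0) C y.
      by split=> //; rewrite mulr_ge0// gauss_laplacian.
    move=> v bv; have := hC v bv; rewrite ler_distl => /andP[+ _].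
    by apply: le_trans; rewrite mulrBr; move: (C * g0) (C * G v) (f v0) => x1 x2 x3; lra.
  have := perron_ge sigma_unif V_open V_bounded fm cl Vx; apply: le_trans.
  by rewrite mulrBr; move: (C * g0) (C * G x) (f v0) => x1 x2 x3; lra.
apply: (perron_le sigma_unif V_open V_bounded fm Vx) => s' [cs subs bs].
have hle y : boundary V y -> s' y <= (f v0 + e + C * g0) + (- C) * G y.
  move=> bv; apply: le_trans (bs y bv) _; have := hC y bv; rewrite ler_distl => /andP[_].
  move=> /le_trans; apply.
  by rewrite mulrBr mulNr; move: (C * g0) (C * G y) (f v0) => x1 x2 x3; lra.
have hsup y : V y -> pure_second (fun y => (f v0 + e + C * g0) + (- C) * G y) y /\
    laplacian (fun y => (f v0 + e + C * g0) + (- C) * G y) y <= 0.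
  move=> Vy; have [h ->] := second (f v0 + e + C * g0) (- C) y.
  by split=> //; rewrite mulNr oppr_le0 mulr_ge0// gauss_laplacian.
apply: le_trans (comparison_closure sigma_unif V_open V_bounded cs (@cont _ _) hle subs hsup Vx) _.
by rewrite mulrBr mulNr; move: (C * g0) (C * G x) (f v0) => x1 x2 x3; lra.
Qed.

End Point.

Hypothesis V_poincare : forall v, boundary V v -> poincare_condition V v.

(** The bound and the mean value property accompany the solution because the walk is evaluated
    through them: the latter keeps the expectation of u constant along the walk, the former allows
    dominated convergence. *)
Theorem dirichlet_existence : exists u : vec -> R,
  [/\ dirichlet_solution V f u,
      exists2 m : R, 0 <= m & forall x, closure V x -> `|u x| <= m &
      forall c (rho : R), 0 < rho -> eucl_cball c rho `<=` V ->
        u c = M (fun z => u (c + rho *: z))].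
Proof.
have [m m0 fm] := boundary_data_bound; exists (perron V f).
have bd v0 : boundary V v0 -> forall e : R, 0 < e -> exists2 r : R, 0 < r & forall x, closure V x ->
    eucl_norm (x - v0) < r -> `|perron V f x - f v0| <= e.
  move=> bv0 e e0; have [c [s [s0 touch]]] := V_poincare bv0.
  have e20 : 0 < e / 2 by rewrite divr_gt0.
  have [C C0 hC] := perron_barrier bv0 s0 touch fm m0 e20.
  have G0 := gauss_touch bv0 s0 touch.
  have e30 : 0 < e / 2 / (C + 1) by rewrite divr_gt0// ltr_wpDl.
  have := @continuous_gauss R d (d%:R / (2 * s ^+ 2)) c v0.
  move=> /(@cvgrPdist_le _ _ _ (nbhs v0))/(_ _ e30)/nbhs_eucl[r r0 hr].
  exists r => // x Vx xr; apply: le_trans (hC x Vx) _; rewrite [leRHS](splitr e) lerD2l.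
  have /= := hr x xr; rewrite G0 => /(le_trans (ler_norm _)) h.
  apply: le_trans (_ : C * (e / 2 / (C + 1)) <= _); first by rewrite ler_wpM2l.
  by rewrite mulrA ler_pdivrMr ?ltr_wpDl// mulrC ler_wpM2l ?(ltW e20)// lerDl.
have uf v : boundary V v -> perron V f v = f v.
  move=> bv; apply/eqP; rewrite -subr_eq0 -normr_le0; apply/ler_addgt0Pr => e e0.
  have [r r0 hr] := bd v bv e e0; rewrite add0r; apply: hr; first exact: boundary_closure.
  by rewrite subrr eucl_norm0.
have [CV lap] := perron_harmonic sigma_unif V_open V_bounded fm m0.
split.
- split=> //; apply/within_continuous_eucl => x Vx e e0.
  have [Vx'|bx] := closure_cases V_open Vx.
    have := perron_continuous sigma_unif V_open V_bounded fm m0 Vx'.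
    move=> /(@cvgrPdist_le _ _ _ (nbhs x))/(_ _ e0)/nbhs_eucl[r r0 hr].
    by exists r => // y _ yx; exact: hr.
  have [r r0 hr] := bd x bx e e0; exists r => // y Vy yx.
  by rewrite uf// distrC; exact: hr.
- by exists m => // x Vx; exact: (perron_norm_le sigma_unif V_open V_bounded fm).
- by move=> c rho rho0 BV; exact: (perron_mean sigma_unif V_open V_bounded fm m0).
Qed.

End Boundary.

(** * Distance to the boundary *)

Section BoundaryDistance.
Context {R : realType} {d : nat}.
Local Notation vec := 'rV[R]_d.
Variable V : set vec.
Hypotheses (d_gt0 : (0 < d)%N) (V_nonempty : V !=set0) (V_bounded : bounded_set V) (V_open : open V).
Local Notation dist x := (eucl_dist x (boundary V)).

(** Take the supremum of the parameters for which the segment is in [V]. The point reached is a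
    limit of points of [V]; were it in [V], openness would allow a larger parameter. *)
Lemma segment_boundary x y : V x -> ~ V y ->
  exists2 t : R, 0 <= t <= 1 & boundary V (x + t *: (y - x)).
Proof.
move=> Vx nVy; pose g (t : R) := x + t *: (y - x).
have g0 : g 0 = x by rewrite /g scale0r addr0.
have g1 : g 1 = y by rewrite /g scale1r addrC subrK.
have gdist s t : eucl_norm (g s - g t) = `|s - t| * eucl_norm (y - x).
  by rewrite /g opprD addrACA subrr add0r -scalerBl eucl_normZ.
pose T : set R := [set t | 0 <= t <= 1 /\ V (g t)].
have T0 : T 0 by rewrite /T /= lexx ler01 g0.
have supT : has_sup T by split; [exists 0|exists 1 => t [/andP[]]].
pose ts := sup T.
have ts0 : 0 <= ts by apply: sup_upper_bound.
have ts1 : ts <= 1 by apply: ge_sup; [exists 0|move=> t [/andP[]]].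
pose L := eucl_norm (y - x) + 1.
have L0 : 0 < L by rewrite ltr_wpDl ?eucl_norm_ge0.
have near_g s t e : 0 < e -> `|s - t| < e / L -> eucl_norm (g s - g t) < e.
  move=> e0; rewrite ltr_pdivlMr// => h; rewrite gdist; apply: le_lt_trans h.
  by rewrite ler_wpM2l// lerDl.
exists ts; rewrite ?ts0// boundaryE//; split.
  move=> A /nbhs_eucl[e e0 eA].
  have eL : 0 < e / L by rewrite divr_gt0.
  have [t [t01 Vt] tts] := sup_adherent eL supT.
  exists (g t); split=> //; apply: eA; rewrite /eucl_ball /=; apply: near_g => //.
  have tle : t <= ts by apply: sup_upper_bound => //.
  by rewrite distrC ger0_norm ?subr_ge0// ltrBlDr addrC -ltrBlDr.
move=> Vts; have := open_nbhs_nbhs (conj V_open Vts) => /nbhs_eucl[e e0 eV].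
have ts_lt1 : ts < 1.
  by rewrite lt_neqAle ts1 andbT; apply/eqP => ts1'; move: Vts; rewrite -/(g ts) ts1' g1.
pose h := Num.min (1 - ts) (e / L / 2).
have eL : 0 < e / L by rewrite divr_gt0.
have h0 : 0 < h by rewrite lt_min subr_gt0 ts_lt1 divr_gt0.
have : ts + h <= ts.
  apply: sup_upper_bound => //; split.
    rewrite addr_ge0 ?(ltW h0)//= -lerBrDl; by rewrite ge_min lexx.
  apply: eV; rewrite /eucl_ball /=; apply: near_g => //.
  rewrite addrAC subrr add0r gtr0_norm//.
  apply: (@le_lt_trans _ _ (e / L / 2)); first by rewrite ge_min lexx orbT.
  by rewrite ltr_pdivrMr// ltr_pMr// ltr1n.
by rewrite gerDl leNgt h0.
Qed.

Lemma outside_point : exists y, ~ V y.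
Proof.
have /bounded_eucl[C hC] := V_bounded.
pose e : vec := delta_mx ord0 (Ordinal d_gt0).
have ne : eucl_norm e = 1 by rewrite eucl_normE dot_deltas sqrtr1.
exists ((`|C| + 1) *: e) => /hC; rewrite eucl_normZ ne mulr1 leNgt => /negP; apply.
by rewrite ger0_norm ?addr_ge0// (le_lt_trans (ler_norm C))// ltrDl.
Qed.

Lemma boundary_nonempty : boundary V !=set0.
Proof.
have [x Vx] := V_nonempty; have [y nVy] := outside_point.
by have [t _ bt] := segment_boundary Vx nVy; exists (x + t *: (y - x)).
Qed.

Lemma dist_has_inf (x : vec) : has_inf [set eucl_norm (x - y) | y in boundary V].
Proof.
split; first by have [y by_] := boundary_nonempty; exists (eucl_norm (x - y)), y.
by exists 0 => _ [y _ <-]; exact: eucl_norm_ge0.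
Qed.

Lemma dist_le x y : boundary V y -> dist x <= eucl_norm (x - y).
Proof. by move=> by_; apply: ge_inf; [exact: (dist_has_inf x).2|exists y]. Qed.

Lemma dist_ge x (b : R) : (forall y, boundary V y -> b <= eucl_norm (x - y)) -> b <= dist x.
Proof.
move=> h; apply: lb_le_inf; first exact: (dist_has_inf x).1.
by move=> _ [y by_ <-]; exact: h.
Qed.

Lemma dist_ge0 x : 0 <= dist x.
Proof. by apply: dist_ge => y _; exact: eucl_norm_ge0. Qed.

Lemma dist_lip x y : `|dist x - dist y| <= eucl_norm (x - y).
Proof.
have key a b : dist a - dist b <= eucl_norm (a - b).
  rewrite lerBlDr addrC -lerBlDr; apply: dist_ge => z bz; rewrite lerBlDr addrC.
  by apply: le_trans (dist_le a bz) _; exact: eucl_dist_triangle.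
rewrite ler_norml; apply/andP; split; last exact: key.
by rewrite lerNl opprB eucl_distC key.
Qed.

Lemma continuous_dist : continuous (fun x : vec => dist x).
Proof.
move=> x; apply/(@cvgrPdist_lt _ _ _ (nbhs x)) => e e0.
apply/nbhs_eucl; exists e => // y /= yx; apply: le_lt_trans (dist_lip _ _) _.
by rewrite eucl_distC.
Qed.

Lemma dist_eq0 x : dist x = 0 -> boundary V x.
Proof.
move=> x0; have /closure_id -> := @closed_boundary R d V.
move=> A /nbhs_eucl[e e0 eA].
have [_ [y by_ <-] ye] := inf_adherent e0 (dist_has_inf x).
exists y; split=> //; apply: eA; rewrite /eucl_ball /= eucl_distC.
by apply: lt_le_trans ye _; rewrite -/(dist x) x0 add0r.
Qed.

Lemma dist_gt0 x : V x -> 0 < dist x.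
Proof.
move=> Vx; rewrite lt_neqAle dist_ge0 andbT; apply/eqP => /esym/dist_eq0.
by move=> /(boundary_notin V_open).
Qed.

(** Otherwise the segment from [x] to [y] would meet the boundary at a distance below [dist x]. *)
Lemma ball_dist x y : V x -> eucl_norm (y - x) < dist x -> V y.
Proof.
move=> Vx yx; apply: contrapT => nVy.
have [t /andP[t0 t1] bt] := segment_boundary Vx nVy.
have := dist_le x bt; rewrite leNgt => /negP; apply.
rewrite opprD addrA subrr add0r eucl_normN eucl_normZ ger0_norm//.
by apply: le_lt_trans yx; rewrite ler_piMl// eucl_norm_ge0.
Qed.

Lemma cball_dist x (r : R) : 0 < r < 1 -> V x -> eucl_cball x (r * dist x) `<=` V.
Proof.
move=> /andP[r0 r1] Vx y yx; apply: (ball_dist Vx).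
by apply: le_lt_trans yx _; rewrite gtr_pMl// dist_gt0.
Qed.

End BoundaryDistance.

(** * Chains driven by independent variables *)

Section Chain.
Context {disp dE dT : measure_display} {Omega : measurableType disp}
  {E : measurableType dE} {T : measurableType dT} {R : realType}
  (P : probability Omega R) (theta : nat -> {RV P >-> E}).
Hypothesis theta_indep : mutually_independent theta.
Hypothesis theta_id : identically_distributed theta.
Variables (Phi : nat -> T * E -> T) (y0 : T).
Hypothesis mPhi : forall n, measurable_fun setT (Phi n).
Local Notation sigma := (distribution P (theta 0)).

(** State space and update rule are left general, and the rule may depend on time, so that the walk
    and its frozen companion are both instances. *)
Fixpoint chain (n : nat) (w : Omega) : T :=
  match n with 0 => y0 | m.+1 => Phi m (chain m w, theta m w) end.

Lemma measurable_theta n : measurable_fun setT (theta n).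
Proof. exact: measurable_funP. Qed.

Lemma measurable_chain n : measurable_fun setT (chain n).
Proof.
elim: n => [|n IH] /=; first exact: measurable_cst.
apply: (measurableT_comp (mPhi n)); apply/prod_measurable_funP; split => //=.
Qed.

Definition chain_rv n : {mfun Omega >-> T} :=
  HB.pack (chain n) (isMeasurableFun.Build _ _ _ _ _ (measurable_chain n)).

Lemma measurable_chain_pair n : measurable_fun setT (fun w => (chain n w, theta n w)).
Proof. by apply/prod_measurable_funP; split => /=; [exact: measurable_chain|]. Qed.

Lemma theta_law n (A : set E) : measurable A -> P (theta n @^-1` A) = sigma A.
Proof. by move=> mA; have := theta_id n 0 mA. Qed.

Lemma measurable_preimage dd (T' : measurableType dd) (g : Omega -> T') (A : set T') :
  measurable_fun setT g -> measurable A -> measurable (g @^-1` A).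
Proof. by move=> mg mA; rewrite -[X in measurable X]setTI; exact: mg. Qed.

Local Notation future J B := (\bigcap_(i in [set` J]) (theta i @^-1` B i)).

Lemma measurable_future (J : {fset nat}) (B : nat -> set E) :
  (forall i, measurable (B i)) -> measurable (future J B).
Proof.
move=> mB; apply: fin_bigcap_measurable => [|i _]; first exact: finite_fset.
by apply: measurable_preimage => //; exact: measurable_theta.
Qed.

Let pB (J : {fset nat}) (B : nat -> set E) : {nonneg R} := NngNum (fine_ge0 (measure_ge0 P (future J B))).

(* Under the rectangle hypothesis the pair (chain n, theta n) is independent of any
   event of the later directions; this is the induction step of chain_future. *)
Lemma product_law n (J : {fset nat}) (B : nat -> set E) : (forall i, measurable (B i)) ->
  (forall A C, measurable A -> measurable C ->
    P (chain n @^-1` A `&` (theta n @^-1` C `&` future J B)) =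
      P (chain n @^-1` A) * sigma C * P (future J B))%E ->
  forall X, measurable X ->
    P ((fun w => (chain n w, theta n w)) @^-1` X `&` future J B) =
    (P (future J B) * (distribution P (chain_rv n) \x sigma) X)%E.
Proof.
move=> mB hrect X mX; have mF := measurable_future J mB.
have mp := measurable_chain_pair n.
have pE : (pB J B)%:num%:E = P (future J B).
  by rewrite /= fineK// fin_num_measure.
pose mu1 : {measure set (T * E) -> \bar R} :=
  measure_function_pushforward__canonical__measure_function_Measure (mrestr P mF) mp.
pose mu2 : {measure set (T * E) -> \bar R} :=
  mscale (pB J B) (distribution P (chain_rv n) \x sigma)%E.
have e1 A C : measurable A -> measurable C ->
    mu1 (A `*` C) = (mscale (pB J B) (distribution P (chain_rv n)) A * sigma C)%E.
  move=> mA mC; transitivity (P (chain n @^-1` A) * sigma C * P (future J B))%E.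
    by rewrite -hrect//; congr (P _); apply/seteqP; split=> [w [[/= Aw Cw] Fw]|w [Aw [Cw Fw]]].
  by rewrite /mscale pE muleC muleA.
have e2 A C : measurable A -> measurable C ->
    mu2 (A `*` C) = (mscale (pB J B) (distribution P (chain_rv n)) A * sigma C)%E.
  move=> mA mC; rewrite -[RHS]muleA; congr (_ * _)%E.
  exact: product_measure1E.
transitivity (mu1 X); first by [].
rewrite -(product_measure_unique e1 mX) (product_measure_unique e2 mX).
by rewrite -pE.
Qed.

Lemma futureU n (J : {fset nat}) (B : nat -> set E) (C : set E) : n \notin J ->
  future (n |` J)%fset (fun i => if i == n then C else B i) =
  theta n @^-1` C `&` future J B.
Proof.
move=> nJ; apply/seteqP; split=> w.
  move=> h; split; first by have := h n; rewrite /= fset1U1 eqxx; apply.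
  move=> i iJ; have := h i; rewrite /= in iJ *; rewrite fset1Ur//.
  by case: eqP => [ein|_]; [move: nJ; rewrite -ein iJ|apply].
move=> [Cw h] i /=; rewrite in_fset1U => /orP[/eqP ->|iJ]; first by rewrite eqxx.
by case: eqP => [->|_] //; exact: h.
Qed.

Lemma future_prob n (J : {fset nat}) (B : nat -> set E) (C : set E) : n \notin J ->
  (forall i, measurable (B i)) -> measurable C ->
  P (theta n @^-1` C `&` future J B) = (sigma C * P (future J B))%E.
Proof.
move=> nJ mB mC; rewrite -futureU// theta_indep; last by move=> i; case: ifP.
rewrite theta_indep// big_fsetU1//= eqxx theta_law//; congr (_ * _)%E.
rewrite big_seq [RHS]big_seq; apply: eq_bigr => i iJ.
by case: eqP => // ein; move: nJ; rewrite -ein iJ.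
Qed.

(** The state at time n depends on earlier directions only. Finite families of later events are kept
    in the statement so that the induction can split off the direction at time n; [product_law]
    passes from rectangles to the preimage under the update. *)
Lemma chain_future n (J : {fset nat}) (B : nat -> set E) (A : set T) :
  (forall i, i \in J -> (n <= i)%N) -> (forall i, measurable (B i)) -> measurable A ->
  P (chain n @^-1` A `&` future J B) = (P (chain n @^-1` A) * P (future J B))%E.
Proof.
elim: n J B A => [|n IH] J B A nJ mB mA.
  have [Ay|nAy] := pselect (A y0).
    have -> : chain 0 @^-1` A = setT by apply/seteqP; split.
    by rewrite setTI probability_setT mul1e.
  have -> : chain 0 @^-1` A = set0 by apply/seteqP; split.
  by rewrite set0I measure0 mul0e.
have rect (K : {fset nat}) (D : nat -> set E) (A' : set T) (C : set E) :
    (forall i, i \in K -> (n < i)%N) -> (forall i, measurable (D i)) ->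
    measurable A' -> measurable C ->
    (P (chain n @^-1` A' `&` (theta n @^-1` C `&` future K D)) =
     P (chain n @^-1` A') * sigma C * P (future K D))%E.
  move=> nK mD mA' mC; have nnK : n \notin K.
    by apply/negP => /nK; rewrite ltnn.
  rewrite -futureU// IH//.
  - by rewrite futureU// future_prob// muleA.
  - by move=> i; rewrite in_fset1U => /orP[/eqP ->//|/nK/ltnW].
  - by move=> i; case: ifP.
pose X := Phi n @^-1` A.
have mX : measurable X by rewrite -[X in measurable X]setTI; exact: mPhi.
have e1 := product_law mB (fun A' C => rect J B A' C nJ mB) mX.
(* The empty future gives the law of the pair alone, which is then compared with its law on the
   event [future J B]. *)
have e0 := product_law (J := fset0) mB (fun A' C => rect fset0 B A' C (fun i => ltac:(by rewrite inE)) mB) mX.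
move: e0; rewrite set_fset0 bigcap_set0 setIT probability_setT mul1e => e0.
rewrite -[chain n.+1 @^-1` A]/((fun w => (chain n w, theta n w)) @^-1` X) e1 e0.
by rewrite muleC.
Qed.

Lemma chain_law n (X : set (T * E)) : measurable X ->
  P ((fun w => (chain n w, theta n w)) @^-1` X) =
  ((distribution P (chain_rv n) \x sigma) X)%E.
Proof.
move=> mX; have mB : forall i : nat, measurable (@setT E) by [].
have rect A C : measurable A -> measurable C ->
    (P (chain n @^-1` A `&` (theta n @^-1` C `&` future fset0 (fun=> setT))) =
     P (chain n @^-1` A) * sigma C * P (future fset0 (fun=> setT)))%E.
  move=> mA mC; rewrite -futureU// chain_future//.
  - by rewrite futureU// future_prob// muleA.
  - by move=> i; rewrite in_fset1U => /orP[/eqP ->|]//; rewrite inE.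
  - by move=> i; case: ifP.
have := product_law (J := fset0) mB rect mX.
by rewrite set_fset0 bigcap_set0 setIT probability_setT mul1e.
Qed.

Lemma bounded_finite_integrable dd (T' : measurableType dd) (mu : {measure set T' -> \bar R})
    (g : T' -> R) (C : R) :
  (mu setT < +oo)%E -> measurable_fun setT g -> (forall x, `|g x| <= C) ->
  mu.-integrable setT (EFin \o g).
Proof.
move=> mufin mg gC; apply: measurable_bounded_integrable => //.
exists C; split; first exact: num_real.
by move=> e Ce x _; apply: le_trans (gC x) (ltW Ce).
Qed.

Lemma bounded_integrable dd (T' : measurableType dd) (mu : probability T' R) (g : T' -> R) (C : R) :
  measurable_fun setT g -> (forall x, `|g x| <= C) -> mu.-integrable setT (EFin \o g).
Proof.
move=> mg; apply: bounded_finite_integrable => //.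
by rewrite (le_lt_trans (probability_le1 mu measurableT)) ?ltry.
Qed.

(** Stands in for conditional expectation given the past: state and current direction have a product
    law, and Fubini's theorem integrates out the direction. *)
Lemma chain_mean n (g : T * E -> R) (h : T -> R) (C : R) :
  measurable_fun setT g -> (forall p, `|g p| <= C) ->
  (forall y, \int[sigma]_z g (y, z) = h y) ->
  \int[P]_w g (chain n w, theta n w) = \int[P]_w h (chain n w).
Proof.
move=> mg gC gh; have mp := measurable_chain_pair n.
have mE : measurable_fun setT (EFin \o g) by exact/measurable_EFinP.
pose law := distribution P (chain_rv n).
have ig : (law \x sigma)%E.-integrable setT (EFin \o g).
  apply: (bounded_finite_integrable _ mg gC).
  have one : (law \x sigma)%E setT = 1%E.
    by rewrite -(chain_law n measurableT) preimage_setT probability_setT.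
  by rewrite [X in (X < _)%E](_ : _ = 1%E) ?ltry.
have ipg : P.-integrable setT ((EFin \o g) \o (fun w => (chain n w, theta n w))).
  by apply: (@bounded_integrable _ _ P (fun w => g (chain n w, theta n w)) C) => //; exact: measurableT_comp.
have my y : measurable_fun setT (fun z => g (y, z)).
  by apply: measurableT_comp => //; exact: measurable_pair1.
have FE : fubini_F sigma (EFin \o g) = EFin \o h.
  apply/funext => y; rewrite /fubini_F /= -gh /Rintegral fineK//.
  apply: integrable_fin_num => //.
  by apply: (@bounded_integrable _ _ sigma (fun z => g (y, z)) C) => //; exact: my.
(* Measurability of [h] is a by-product of Fubini's theorem, since [h] is the partial integral of
   [g]. *)
have mh : measurable_fun setT (EFin \o h).
  by rewrite -FE; exact: (measurable_fubini_F ig).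
have hC y : `|h y| <= C.
  have iy : sigma.-integrable setT (EFin \o (fun z => g (y, z))).
    by apply: (@bounded_integrable _ _ sigma _ C) => //; exact: my.
  rewrite -gh; apply: le_trans (le_normr_Rintegral measurableT iy) _.
  have ic : sigma.-integrable setT (EFin \o cst C) by apply: (@bounded_integrable _ _ _ _ `|C|).
  apply: le_trans (le_Rintegral measurableT _ ic _) _ => //.
    exact: integrable_norm iy.
  by rewrite Rintegral_cst// [X in fine X](_ : _ = 1%E) ?mulr1//; exact: probability_setT.
rewrite /Rintegral; congr fine.
transitivity (\int[pushforward P (fun w => (chain n w, theta n w))]_p (EFin \o g) p)%E.
  by rewrite integral_pushforward.
transitivity (\int[law \x sigma]_p (EFin \o g) p)%E.
  by apply: eq_measure_integral => X mX _; exact: chain_law.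
rewrite -integral12_prod_meas1// FE.
transitivity (\int[pushforward P (chain n)]_y (EFin \o h) y)%E; first by [].
rewrite integral_pushforward//; first exact: measurable_chain.
apply: (@bounded_integrable _ _ P (fun w => h (chain n w)) C) => //.
by apply: measurableT_comp; [exact/measurable_EFinP|exact: measurable_chain].
Qed.

End Chain.

Lemma chebyshev_le {R : realType} (dd : measure_display) (T : measurableType dd) (mu : probability T R)
    (psi : T -> R) (c : R) : 0 < c -> measurable_fun setT psi ->
  mu.-integrable setT (EFin \o psi) -> (forall x, 0 <= psi x) ->
  (mu [set x | (c < psi x)%R] <= ((\int[mu]_x psi x)%R / c)%:E)%E.
Proof.
move=> c0 mpsi ipsi psi0; set A := [set x | _].
have mA : measurable A.
  rewrite (_ : A = psi @^-1` `]c, +oo[%classic).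
    by rewrite -[X in measurable X]setTI; exact: mpsi.
  by apply/seteqP; split=> x; rewrite /A /= in_itv/= andbT.
have muA : mu A = (\int[mu]_x (\1_A x : R))%:E.
  by rewrite /Rintegral integral_indic// setIT fineK// fin_num_measure.
have iA : mu.-integrable setT (EFin \o (\1_A : T -> R)).
  apply: (@bounded_integrable _ _ _ _ _ 1); first exact: measurable_indic.
  by move=> x; rewrite indicE; case: (_ \in _); rewrite ?normr1 ?normr0.
rewrite muA lee_fin ler_pdivlMr// mulrC -RintegralZl//.
apply: le_Rintegral => //.
  apply: (@bounded_integrable _ _ _ _ _ c).
    by apply: measurable_funM => //; exact: measurable_indic.
  move=> x; rewrite indicE; case: (_ \in _); rewrite ?mulr1 ?mulr0 ?normr0; last exact: ltW.
  by rewrite gtr0_norm.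
move=> x _; rewrite indicE; have [Ax|nAx] := boolP (x \in A); last by rewrite mulr0.
by rewrite mulr1; move: Ax; rewrite inE /A /= => /ltW.
Qed.

(** * Almost sure convergence of the walk *)

Section Walk.
Context {R : realType} {d : nat} {disp : measure_display} {Omega : measurableType disp}
  (P : probability Omega R) (theta : nat -> {RV P >-> borelRd R d}).
Hypotheses (theta_indep : mutually_independent theta)
  (theta_id : identically_distributed theta)
  (sigma_unif : uniform_on_sphere (distribution P (theta 0))).
Local Notation vec := 'rV[R]_d.
Local Notation bRd := (borelRd R d).
Local Notation S := (@unit_sphere R d).
Local Notation sigma := (distribution P (theta 0)).
Local Notation M := (sphere_mean sigma).
Variables (V : set vec) (r : R) (v : vec).
Hypotheses (V_nonempty : V !=set0) (V_bounded : bounded_set V) (V_open : open V).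
Hypotheses (r01 : 0 < r < 1) (Vv : V v).
Local Notation dist x := (eucl_dist x (boundary V)).

Let d0 : (0 < d)%N := dim_gt0 sigma_unif.
Let r_gt0 : 0 < r. Proof. by case/andP: r01. Qed.
Let mV : measurable (V : set bRd). Proof. exact: borel_open. Qed.
Let mS : measurable (S : set bRd). Proof. exact: borel_unit_sphere. Qed.

(* A direction outside the sphere occurs only on a null event; suppressing the
   displacement there, and outside V, keeps the walk inside V surely. *)
Definition move (a : R) (x z : vec) : vec :=
  x + (a * \1_V x * \1_S z * (r * dist x)) *: z.

Lemma moveE a x z : V x -> S z -> move a x z = x + (a * (r * dist x)) *: z.
Proof. by move=> Vx Sz; rewrite /move !indicE !mem_set// !mulr1. Qed.

Lemma move_off a x z : ~ S z -> move a x z = x.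
Proof. by move=> nS; rewrite /move [\1_S z]indicE memNset// mulr0 mul0r scale0r addr0. Qed.

Lemma move0 x z : move 0 x z = x.
Proof. by rewrite /move !mul0r scale0r addr0. Qed.

Lemma move_in a x z : 0 <= a <= 1 -> V x -> V (move a x z).
Proof.
move=> /andP[a0 a1] Vx; have [Sz|nS] := pselect (S z); last by rewrite move_off.
have dx := dist_gt0 d0 V_nonempty V_bounded V_open Vx.
rewrite moveE//; apply: (ball_dist d0 V_nonempty V_bounded V_open Vx).
rewrite addrC addKr eucl_normZ Sz mulr1 ger0_norm ?mulr_ge0 ?(ltW r_gt0) ?(ltW dx)//.
apply: le_lt_trans (_ : 1 * (r * dist x) < _).
  by rewrite ler_wpM2r// mulr_ge0 ?(ltW r_gt0) ?(ltW dx).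
by rewrite mul1r gtr_pMl//; case/andP: r01.
Qed.

Lemma measurable_dist : measurable_fun setT (fun x : bRd => dist (x : vec)).
Proof. by apply: continuous_borel; exact: continuous_dist d0 V_nonempty V_bounded V_open. Qed.

Lemma measurable_move dd (T : measurableType dd) (a : T -> R) (x z : T -> bRd) :
  measurable_fun setT a -> measurable_fun setT x -> measurable_fun setT z ->
  measurable_fun setT (fun t => move (a t) (x t) (z t) : bRd).
Proof.
move=> ma mx mz; apply: measurable_fun_coord => i.
have coord (y : T -> bRd) : measurable_fun setT y -> measurable_fun setT (fun t => (y t : vec) ord0 i).
  by move=> my; exact: (measurableT_comp (@coord_borel R d i) my).
have -> : (fun t => (move (a t) (x t) (z t)) ord0 i) = fun t => (x t : vec) ord0 i +
    (a t * \1_V (x t) * \1_S (z t) * (r * dist (x t))) * (z t : vec) ord0 i.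
  by apply/funext => t; rewrite /move !mxE.
apply: measurable_funD; first exact: coord.
apply: measurable_funM; last exact: coord.
apply: measurable_funM; last first.
  by apply: measurable_funM => //; exact: (measurableT_comp measurable_dist mx).
apply: measurable_funM; last first.
  exact: (measurableT_comp (@measurable_indic _ bRd R setT _ mS) mz).
apply: measurable_funM => //.
exact: (measurableT_comp (@measurable_indic _ bRd R setT _ mV) mx).
Qed.

Lemma Rintegral_sphere (g : bRd -> R) (C : R) : measurable_fun setT g -> (forall z, `|g z| <= C) ->
  \int[sigma]_z g z = M g.
Proof.
move=> mg gC; rewrite /sphere_mean /Rintegral; congr fine.
have sS : sigma (~` S) = 0%E.
  rewrite probability_setC//; case: sigma_unif => sS1 _.
  by rewrite [X in (1 - X)%E](_ : _ = 1%E) ?subee.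
rewrite (@negligible_integral _ _ _ sigma setT (~` S))//.
- by rewrite setTD setCK.
- exact: measurableC.
- exact: (bounded_integrable sigma mg gC).
Qed.

Lemma sphere_continuous_dot (w : vec) : sphere_continuous (fun z => dot z w).
Proof. by move=> z _; apply: (@cvg_dot R d _ (nbhs z) _ id (cst w) z w); [exact: cvg_id|exact: cvg_cst]. Qed.

Lemma sphere_mean_dot (w : vec) : M (fun z => dot z w) = 0.
Proof.
(* The map z -> - z is orthogonal, so the mean equals its own opposite. *)
have Q1 : (- 1%:M : 'M[R]_d) *m (- 1%:M)^T = 1%:M.
  by rewrite linearN /= trmx1 mulNmx mulmxN opprK mulmx1.
have c := @sphere_continuous_dot w.
have := sphere_mean_rot sigma_unif Q1 c.
have -> : M (fun z => dot (z *m - 1%:M) w) = M (fun z => -1 * dot z w).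
  by apply: eq_sphere_mean => z _; rewrite mulmxN mulmx1 dotNl mulN1r.
rewrite sphere_meanZ// => h.
by move: h; set m := M _; lra.
Qed.

(** Pythagoras for one step: the cross term has mean zero, and directions have length one. *)
Lemma mean_sqr_move a (x b : vec) : V x ->
  M (fun z => dot (move a x z - b) (move a x z - b)) =
  dot (x - b) (x - b) + (a * (r * dist x)) ^+ 2.
Proof.
move=> Vx; set t := a * (r * dist x).
rewrite (@eq_sphere_mean _ _ _ _ (fun z => (dot (x - b) (x - b) + t ^+ 2) + 2 * t * dot z (x - b))).
  rewrite sphere_meanD ?sphere_meanZ ?sphere_mean_dot ?mulr0 ?addr0 ?sphere_mean_cst//.
  - exact: sphere_continuous_dot.
  - exact: sphere_continuous_cst.
  - by apply: sphere_continuousZ; exact: sphere_continuous_dot.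
move=> z Sz; rewrite moveE// -/t addrAC; move: (x - b) => w.
rewrite dotDl !dotDr !dotZl !dotZr ((unit_sphere_dot z).1 Sz) (dotC w z).
by move: (dot w w) (dot z w) => A B; ring.
Qed.

Definition free_step (n : nat) (p : bRd * bRd) : bRd := move 1 p.1 p.2.
Definition close (e : R) : set (bRd * bRd) := [set p | eucl_norm ((p.2 : vec) - p.1) <= e].
(* The pair (b, x): up to time N both components are the walk; afterwards b stays
   at its position at time N, and x stops as soon as it is farther than e from b. *)
Definition frozen_step (N : nat) (e : R) (n : nat) (p : (bRd * bRd) * bRd) : bRd * bRd :=
  if (n < N)%N then (move 1 p.1.2 p.2 : bRd, move 1 p.1.2 p.2 : bRd)
  else (p.1.1, move (\1_(close e) p.1) p.1.2 p.2 : bRd).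

Lemma measurable_free_step n : measurable_fun setT (free_step n).
Proof. by apply: measurable_move. Qed.

Lemma measurable_dot_pair dd (T : measurableType dd) (x y : T -> bRd) :
  measurable_fun setT x -> measurable_fun setT y ->
  measurable_fun setT (fun t => dot ((x t : vec) - y t) ((x t : vec) - y t)).
Proof.
move=> mx my; apply: measurable_sum => i; under eq_fun do rewrite !mxE.
have coord (u : T -> bRd) : measurable_fun setT u -> measurable_fun setT (fun t => (u t : vec) ord0 i).
  by move=> mu; exact: (measurableT_comp (@coord_borel R d i) mu).
by apply: measurable_funM; apply: measurable_funB; exact: coord.
Qed.

Lemma measurable_close e : measurable (close e).
Proof.
have [e0|e0] := ltP e 0.
  have -> : close e = set0 by apply/seteqP; split=> // p /=; rewrite /close /= leNgt (lt_le_trans e0) ?eucl_norm_ge0.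
  exact: measurable0.
have m := measurable_dot_pair (@measurable_snd _ _ bRd bRd) (@measurable_fst _ _ bRd bRd).
have -> : close e = (fun p : bRd * bRd => dot ((p.2 : vec) - p.1) ((p.2 : vec) - p.1)) @^-1` `]-oo, (e ^+ 2)]%classic.
  apply/seteqP; split=> p; rewrite /close /= in_itv/= -sqr_eucl_norm ler_pXn2r// nnegrE//; exact: eucl_norm_ge0.
by rewrite -[X in measurable X]setTI; exact: m.
Qed.

Lemma measurable_frozen_step N e n : measurable_fun setT (frozen_step N e n).
Proof.
have m1 := @measurable_fst _ _ (bRd * bRd)%type bRd; have m2 := @measurable_snd _ _ (bRd * bRd)%type bRd.
have m11 := measurableT_comp (@measurable_fst _ _ bRd bRd) m1.
have m12 := measurableT_comp (@measurable_snd _ _ bRd bRd) m1.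
have mc := measurableT_comp (@measurable_indic _ _ R setT _ (measurable_close e)) m1.
rewrite /frozen_step; case: (n < N)%N.
  have m := measurable_move (measurable_cst (1 : R)) m12 m2.
  exact: (measurable_fun_pair m m).
exact: (measurable_fun_pair m11 (measurable_move mc m12 m2)).
Qed.

Local Notation X := (chain theta free_step (v : bRd)).
Local Notation F N e := (chain theta (frozen_step N e) ((v : bRd), (v : bRd))).

Lemma free_in n w : V (X n w).
Proof. by elim: n => [|n IH] //=; apply: move_in; rewrite ?ler01 ?lexx. Qed.

Lemma indic01 (T : Type) (A : set T) (x : T) : 0 <= (\1_A x : R) <= 1.
Proof. by rewrite indicE; case: (_ \in _); rewrite ?ler01 ?lexx. Qed.

Lemma frozen_in N e n w : V (F N e n w).1 /\ V (F N e n w).2.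
Proof.
elim: n => [|n [IH1 IH2]] //=; rewrite /frozen_step; case: ifP => _ /=.
  by split; apply: move_in => //; rewrite ler01 lexx.
by split=> //; apply: move_in => //; exact: indic01.
Qed.

Lemma frozen_before N e n w : (n <= N)%N -> F N e n w = (X n w, X n w).
Proof.
elim: n => [|n IH] //= nN; rewrite IH; last exact: ltnW.
by rewrite /frozen_step nN.
Qed.

Lemma frozen_base N e n w : (N <= n)%N -> (F N e n w).1 = X N w.
Proof.
elim: n => [|n IH]; first by rewrite leqn0 => /eqP ->.
rewrite leq_eqVlt => /predU1P[<-|Nn]; first by rewrite frozen_before.
by rewrite /= /frozen_step ltnNge -ltnS Nn /= IH.
Qed.

Lemma frozen_after N e n w : (N <= n)%N ->
  (F N e n w).2 = X n w \/ e < eucl_norm (((F N e n w).2 : vec) - X N w).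
Proof.
elim: n => [|n IH] Nn; first by left.
move: Nn; rewrite leq_eqVlt => /predU1P[<-|Nn]; first by left; rewrite frozen_before.
have base := frozen_base e w (Nn : (N <= n)%N).
rewrite /= /frozen_step ltnNge -ltnS Nn /=.
have [le|gt] := leP (eucl_norm (((F N e n w).2 : vec) - X N w)) e.
  have [E|] := IH Nn; last by rewrite ltNge le.
  by left; rewrite indicE mem_set ?E// /close /= base.
right; rewrite indicE memNset ?move0// /close /= base.
by apply/negP; rewrite -ltNge.
Qed.

Lemma frozen_exceed N e j n w : (N <= j <= n)%N ->
  e < eucl_norm ((X j w : vec) - X N w) -> e < eucl_norm (((F N e n w).2 : vec) - X N w).
Proof.
move=> /andP[Nj jn] ej; have hj : e < eucl_norm (((F N e j w).2 : vec) - X N w).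
  by have [->|] := frozen_after e w Nj.
elim: n jn => [|n IH]; first by rewrite leqn0 => /eqP j0; move: hj; rewrite j0.
rewrite leq_eqVlt => /predU1P[<- //|jn].
have Nn : (N <= n)%N := leq_trans Nj jn.
have base := frozen_base e w Nn.
rewrite /= /frozen_step ltnNge Nn /= indicE memNset ?move0; first exact: IH.
by rewrite /close /= base; apply/negP; rewrite -ltNge; exact: IH.
Qed.

Lemma diameter : exists2 C : R, 0 < C & (forall x y, V x -> V y -> eucl_norm (x - y) <= C) /\
  (forall x, V x -> dist x <= C).
Proof.
have /bounded_eucl[C0 hC] := compact_bounded (compact_closure V_bounded).
pose C := 2 * `|C0| + 1; exists C; first by rewrite ltr_wpDl// mulr_ge0.
have hC' x y : closure V x -> closure V y -> eucl_norm (x - y) <= C.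
  move=> cx cy; apply: le_trans (eucl_normD _ _) _; rewrite eucl_normN.
  rewrite /C mulr_natl mulr2n; apply: ler_wpDr => //.
  by apply: lerD; apply: le_trans (ler_norm C0); exact: hC.
split=> [x y Vx Vy|x Vx]; first by apply: hC'; exact: subset_closure.
have [y by_] := boundary_nonempty d0 V_nonempty V_bounded V_open.
apply: le_trans (dist_le d0 V_nonempty V_bounded V_open x by_) _.
by apply: hC'; [exact: subset_closure|exact: boundary_closure].
Qed.

Definition sq_step (n : nat) : R := \int[P]_w (r * dist (X n w)) ^+ 2.
Definition sq_dist N e n : R :=
  \int[P]_w dot (((F N e n w).2 : vec) - (F N e n w).1) (((F N e n w).2 : vec) - (F N e n w).1).

Lemma sqr_le_dot (x : vec) (C : R) : eucl_norm x <= C -> `|dot x x| <= C ^+ 2.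
Proof.
move=> xC; rewrite ger0_norm ?dot_ge0// -sqr_eucl_norm ler_pXn2r// ?nnegrE ?eucl_norm_ge0//.
exact: le_trans (eucl_norm_ge0 x) xC.
Qed.

Lemma measurable_free n : measurable_fun setT (X n).
Proof. by apply: measurable_chain; exact: measurable_free_step. Qed.

Lemma measurable_frozen N e n : measurable_fun setT (F N e n).
Proof. by apply: measurable_chain; exact: measurable_frozen_step. Qed.

Lemma integrable_sq_dist N e n : P.-integrable setT (EFin \o (fun w =>
  dot (((F N e n w).2 : vec) - (F N e n w).1) (((F N e n w).2 : vec) - (F N e n w).1))).
Proof.
have [C C0 [hC _]] := diameter; apply: (@bounded_integrable _ _ _ _ _ (C ^+ 2)).
  apply: measurable_dot_pair.
    exact: (measurableT_comp measurable_snd (measurable_frozen N e n)).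
  exact: (measurableT_comp measurable_fst (measurable_frozen N e n)).
by move=> w; apply: sqr_le_dot; have [h1 h2] := frozen_in N e n w; exact: hC.
Qed.

Lemma sq_dist0 N e : sq_dist N e N = 0.
Proof.
rewrite /sq_dist (@eq_Rintegral _ _ _ _ _ (cst 0)) ?Rintegral_cst ?mul0r//.
by move=> w _; rewrite frozen_before//= subrr dot0l.
Qed.

Definition frozen_increment N e n (w : Omega) : R :=
  (\1_(close e) (F N e n w) * (r * dist ((F N e n w).2 : vec))) ^+ 2.

Lemma sqr_dist_bound : exists C : R, forall (a : R) x, 0 <= a <= 1 -> V x ->
  `|(a * (r * dist x)) ^+ 2| <= C.
Proof.
have [C C0 [_ hC]] := diameter; exists (C ^+ 2) => a x /andP[a0 a1] Vx.
have dx := dist_ge0 d0 V_nonempty V_bounded V_open x.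
rewrite normrX ler_pXn2r// ?nnegrE ?(ltW C0)// ger0_norm; last by rewrite !mulr_ge0 ?(ltW r_gt0).
rewrite mulrA; apply: le_trans (_ : 1 * dist x <= C); last by rewrite mul1r hC.
rewrite ler_wpM2r//; case/andP: r01 => _ r1.
by apply: le_trans (ler_pM a0 (ltW r_gt0) a1 (ltW r1)) _; rewrite mulr1.
Qed.

Lemma integrable_frozen_increment N e n : P.-integrable setT (EFin \o frozen_increment N e n).
Proof.
have [C hC] := sqr_dist_bound.
apply: (@bounded_integrable _ _ _ _ _ C); last first.
  by move=> w; apply: hC; [exact: indic01|have [] := frozen_in N e n w].
apply: measurable_funX; apply: measurable_funM.
  exact: (measurableT_comp (@measurable_indic _ _ R setT _ (measurable_close e)) (measurable_frozen N e n)).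
apply: measurable_funM => //; apply: (measurableT_comp measurable_dist).
exact: (measurableT_comp measurable_snd (measurable_frozen N e n)).
Qed.

Lemma integrable_sq_step n : P.-integrable setT (EFin \o (fun w => (r * dist (X n w : vec)) ^+ 2)).
Proof.
have [C hC] := sqr_dist_bound.
apply: (@bounded_integrable _ _ _ _ _ C); last first.
  by move=> w; rewrite -[r * _]mul1r; apply: hC; [rewrite ler01 lexx|exact: free_in].
apply: measurable_funX; apply: measurable_funM => //; apply: (measurableT_comp measurable_dist).
exact: measurable_free.
Qed.

(** Orthogonality of the increments: the one-step identity of [mean_sqr_move], with the base as
    reference point, is averaged over the past. *)
Lemma sq_distS N e n : (N <= n)%N ->
  sq_dist N e n.+1 = sq_dist N e n + \int[P]_w frozen_increment N e n w.
Proof.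
move=> Nn; have [C C0 [hC _]] := diameter.
pose y (p : (bRd * bRd) * bRd) : vec := move (\1_(close e) p.1) p.1.2 p.2.
(* The indicators make [g] bounded for all states, as [chain_mean] requires; along the chain they
   are equal to one. *)
pose g (p : (bRd * bRd) * bRd) : R :=
  \1_V (p.1.1 : vec) * \1_V (p.1.2 : vec) * dot (y p - p.1.1) (y p - p.1.1).
pose h (q : bRd * bRd) : R := \1_V (q.1 : vec) * \1_V (q.2 : vec) *
  (dot ((q.2 : vec) - q.1) ((q.2 : vec) - q.1) + (\1_(close e) q * (r * dist (q.2 : vec))) ^+ 2).
have m1 := @measurable_fst _ _ (bRd * bRd)%type bRd; have m2 := @measurable_snd _ _ (bRd * bRd)%type bRd.
have m11 := measurableT_comp (@measurable_fst _ _ bRd bRd) m1.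
have m12 := measurableT_comp (@measurable_snd _ _ bRd bRd) m1.
have mg : measurable_fun setT g.
  apply: measurable_funM.
    apply: measurable_funM; first exact: (measurableT_comp (@measurable_indic _ bRd R setT _ mV) m11).
    exact: (measurableT_comp (@measurable_indic _ bRd R setT _ mV) m12).
  have mc := measurableT_comp (@measurable_indic _ _ R setT _ (measurable_close e)) m1.
  exact: (measurable_dot_pair (measurable_move mc m12 m2) m11).
have gC p : `|g p| <= C ^+ 2.
  rewrite /g; have [Vb|nVb] := pselect (V (p.1.1 : vec)); last first.
    by rewrite [\1_V (p.1.1 : vec)]indicE memNset// !mul0r normr0 exprn_ge0// ltW.
  have [Vx|nVx] := pselect (V (p.1.2 : vec)); last first.
    by rewrite [\1_V (p.1.2 : vec)]indicE memNset// mulr0 !mul0r normr0 exprn_ge0// ltW.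
  rewrite !indicE !mem_set// !mul1r; apply: sqr_le_dot; apply: hC => //.
  by apply: move_in => //; exact: indic01.
have gh q : \int[sigma]_z g (q, z) = h q.
  rewrite /g /h /=; have [Vb|nVb] := pselect (V (q.1 : vec)); last first.
    rewrite (@eq_Rintegral _ _ _ _ _ (cst 0)) ?Rintegral_cst ?mul0r//.
      by rewrite [\1_V (q.1 : vec)]indicE memNset// !mul0r.
    by move=> z _; rewrite [\1_V (q.1 : vec)]indicE memNset// !mul0r.
  have [Vx|nVx] := pselect (V (q.2 : vec)); last first.
    rewrite (@eq_Rintegral _ _ _ _ _ (cst 0)) ?Rintegral_cst ?mul0r//.
      by rewrite [\1_V (q.2 : vec)]indicE memNset// mulr0 !mul0r.
    by move=> z _; rewrite [\1_V (q.2 : vec)]indicE memNset// mulr0 !mul0r.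
  rewrite [\1_V (q.1 : vec)]indicE [\1_V (q.2 : vec)]indicE !mem_set// !mul1r.
  rewrite (@eq_Rintegral _ _ _ _ _ (fun z => g (q, z))); last first.
    by move=> z _; rewrite /g [\1_V (q.1 : vec)]indicE [\1_V (q.2 : vec)]indicE !mem_set// !mul1r.
  rewrite (@Rintegral_sphere _ (C ^+ 2)) => [||z]; last 2 first.
  - by apply: measurableT_comp => //; exact: measurable_pair1.
  - exact: gC.
  rewrite -mean_sqr_move//; apply: eq_sphere_mean => z _.
  by rewrite /g /= [\1_V (q.1 : vec)]indicE [\1_V (q.2 : vec)]indicE !mem_set// !mul1r.
have := chain_mean theta_indep theta_id ((v : bRd), (v : bRd)) (measurable_frozen_step N e) n mg gC gh.
have E1 : \int[P]_w g (F N e n w, theta n w) = sq_dist N e n.+1.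
  apply: eq_Rintegral => w _; have [Vb Vx] := frozen_in N e n w.
  rewrite /g /= /frozen_step ltnNge Nn /=.
  by rewrite [\1_V ((F N e n w).1 : vec)]indicE [\1_V ((F N e n w).2 : vec)]indicE !mem_set// !mul1r.
rewrite E1 => ->; rewrite -RintegralD//; last 2 first.
- exact: integrable_sq_dist.
- exact: integrable_frozen_increment.
apply: eq_Rintegral => w _; have [Vb Vx] := frozen_in N e n w.
by rewrite /h [\1_V ((F N e n w).1 : vec)]indicE [\1_V ((F N e n w).2 : vec)]indicE !mem_set// !mul1r.
Qed.

Lemma sq_step_ge0 n : 0 <= sq_step n.
Proof. by apply: Rintegral_ge0 => w _; rewrite sqr_ge0. Qed.

(** Until it is frozen the chain makes the steps of the walk, afterwards none. *)
Lemma sq_dist_le N e n : (N <= n)%N -> sq_dist N e n <= \sum_(N <= k < n) sq_step k.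
Proof.
elim: n => [|n IH]; first by rewrite leqn0 => /eqP ->; rewrite sq_dist0 big_geq.
rewrite leq_eqVlt => /predU1P[<-|Nn]; first by rewrite sq_dist0 big_geq.
rewrite ltnS in Nn; rewrite sq_distS// big_nat_recr//= lerD ?IH//.
apply: le_Rintegral => //; [exact: integrable_frozen_increment|exact: integrable_sq_step|].
move=> w _; rewrite /frozen_increment indicE.
have [le|gt] := leP (eucl_norm (((F N e n w).2 : vec) - (F N e n w).1)) e.
  rewrite mem_set// mul1r; have [->//|] := frozen_after e w Nn.
  by rewrite -(frozen_base e w Nn) ltNge le.
rewrite memNset; first by rewrite mul0r expr0n /= sqr_ge0.
by rewrite /close /=; apply/negP; rewrite -ltNge.
Qed.

(** With a bound [C] of the diameter as threshold the chain started at time 0 is never frozen, so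
    the sum equals the mean square distance from the starting point, which is at most C^2. *)
Lemma sum_sq_step_bounded : exists Q : R, forall n, \sum_(0 <= k < n) sq_step k <= Q.
Proof.
have [C C0 [hC _]] := diameter; exists (C ^+ 2) => n.
have close0 k w : (F 0%N C k w).2 = X k w.
  have [//|] := frozen_after C w (leq0n k); rewrite ltNge => /negP[].
  by apply: hC; [have [] := frozen_in 0%N C k w|exact: free_in].
have -> : \sum_(0 <= k < n) sq_step k = sq_dist 0%N C n.
  elim: n => [|n IH]; first by rewrite big_geq// sq_dist0.
  rewrite big_nat_recr//= IH sq_distS//; congr (_ + _).
  apply: eq_Rintegral => w _; rewrite /frozen_increment indicE mem_set ?mul1r ?close0//.
  by rewrite /close /=; have [h1 h2] := frozen_in 0%N C n w; exact: hC.
apply: (@le_trans _ _ (\int[P]_w C ^+ 2)); last first.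
  by rewrite Rintegral_cst// [X in fine X](_ : _ = 1%E) ?mulr1//; exact: probability_setT.
apply: le_Rintegral => //; first exact: integrable_sq_dist.
  by apply: (@bounded_integrable _ _ _ _ _ `|C ^+ 2|).
move=> w _; apply: le_trans (ler_norm _) _; apply: sqr_le_dot.
by have [h1 h2] := frozen_in 0%N C n w; exact: hC.
Qed.

Definition exceed N n (e : R) : set Omega :=
  \bigcup_(j in [set j | (N <= j <= n)%N]) [set w | e ^+ 2 < dot ((X j w : vec) - X N w) ((X j w : vec) - X N w)].

Lemma measurable_exceed N n e : measurable (exceed N n e).
Proof.
apply: bigcup_measurable => j _.
have m := measurable_dot_pair (measurable_free j) (measurable_free N).
rewrite (_ : [set w | _] = (fun w => dot ((X j w : vec) - X N w) ((X j w : vec) - X N w)) @^-1` `]e ^+ 2, +oo[%classic).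
  by rewrite -[X in measurable X]setTI; exact: m.
by apply/seteqP; split=> w; rewrite /= in_itv/= andbT.
Qed.

(* Kolmogorov's maximal inequality: freezing the walk at its first exit from a
   ball turns the maximum into a terminal value. *)
Lemma maximal_inequality N n e : 0 < e -> (N <= n)%N ->
  (P (exceed N n e) <= ((\sum_(N <= k < n) sq_step k) / e ^+ 2)%:E)%E.
Proof.
move=> e0 Nn; pose psi w := dot (((F N e n w).2 : vec) - (F N e n w).1) (((F N e n w).2 : vec) - (F N e n w).1).
have mpsi : measurable_fun setT psi.
  have h := integrable_sq_dist N e n.
  by apply/measurable_EFinP; exact: (measurable_int P h).
have sub : exceed N n e `<=` [set w | e ^+ 2 < psi w].
  move=> w [j /= jn ej]; rewrite /psi (frozen_base _ _ Nn) -sqr_eucl_norm.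
  rewrite ltr_pXn2r// ?nnegrE ?eucl_norm_ge0 ?(ltW e0)//; apply: (frozen_exceed jn).
  by rewrite -(@ltr_pXn2r _ 2)// ?nnegrE ?eucl_norm_ge0 ?(ltW e0)// sqr_eucl_norm.
have e20 : 0 < e ^+ 2 by rewrite exprn_gt0.
apply: (@le_trans _ _ (P [set w | e ^+ 2 < psi w])).
  apply: le_measure => //; rewrite ?inE//; first exact: measurable_exceed.
  rewrite (_ : [set w | _] = psi @^-1` `]e ^+ 2, +oo[%classic).
    by rewrite -[X in measurable X]setTI; exact: mpsi.
  by apply/seteqP; split=> w; rewrite /= in_itv/= andbT.
apply: le_trans (chebyshev_le e20 mpsi (integrable_sq_dist N e n) _) _.
  by move=> w; exact: dot_ge0.
by rewrite lee_fin ler_pM2r ?invr_gt0// sq_dist_le.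
Qed.

Lemma tail_small (e : R) : 0 < e -> exists N, forall n, (N <= n)%N ->
  \sum_(N <= k < n) sq_step k <= e.
Proof.
move=> e0; have [Q hQ] := sum_sq_step_bounded.
pose A : set R := [set \sum_(0 <= k < n) sq_step k | n in setT].
have supA : has_sup A.
  split; first by exists (\sum_(0 <= k < 0) sq_step k), 0%N.
  by exists Q => _ [n _ <-]; exact: hQ.
have [_ [N _ <-] hN] := sup_adherent e0 supA.
exists N => n Nn; have : \sum_(0 <= k < n) sq_step k <= sup A.
  by apply: sup_upper_bound => //; exists n.
rewrite (big_cat_nat _ Nn)//= => le.
move: hN le; move: (\sum_(0 <= k < N) _) (\sum_(N <= k < n) _) (sup A) => a b c; lra.
Qed.

(** For fixed [N] the events increase with [n], so the maximal inequality bounds their union by the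
    tail of a convergent series over e^2. *)
Lemma oscillation_null e : 0 < e -> P (\bigcap_N \bigcup_n exceed N n e) = 0%E.
Proof.
move=> e0; apply/eqP; rewrite eq_le measure_ge0 andbT; apply/lee_addgt0Pr => eps eps0.
rewrite add0e; have e20 : 0 < e ^+ 2 by rewrite exprn_gt0.
have [N hN] := tail_small (mulr_gt0 eps0 e20).
have mU k : measurable (\bigcup_n exceed k n e).
  by apply: bigcupT_measurable => n; exact: measurable_exceed.
apply: (@le_trans _ _ (P (\bigcup_n exceed N n e))).
  apply: le_measure; rewrite ?inE//; first exact: bigcapT_measurable.
  by move=> w; exact.
have cv := @nondecreasing_cvg_mu _ _ _ P (fun n => exceed N n e)
  (fun n => measurable_exceed N n e) (mU N).
have nd : nondecreasing_seq (fun n => exceed N n e).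
  move=> n m nm; apply/subsetPset => w [j /= /andP[Nj jn] h]; exists j => //=.
  by rewrite Nj (leq_trans jn nm).
rewrite -(cvg_lim _ (cv nd))//; apply: lime_le; first by apply/cvg_ex; eexists; exact: (cv nd).
near=> n; have Nn : (N <= n)%N by near: n; exact: nbhs_infty_ge.
apply: le_trans (maximal_inequality e0 Nn) _.
by rewrite lee_fin ler_pdivrMr// hN.
Unshelve. all: by end_near. Qed.

Lemma ae_cauchy : {ae P, forall w, forall k, exists N, forall n, ~ exceed N n k.+1%:R^-1 w}.
Proof.
apply/ae_foralln => k; have k0 : 0 < k.+1%:R^-1 :> R by rewrite invr_gt0.
exists (\bigcap_N \bigcup_n exceed N n k.+1%:R^-1); split.
- apply: bigcapT_measurable => N; apply: bigcupT_measurable => n; exact: measurable_exceed.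
- exact: oscillation_null.
move=> w /= h N _; apply: contrapT => h'; apply: h; exists N => n hn.
by apply: h'; exists n.
Qed.

(** That all distances from time [N] on stay large has probability at most that of a single late
    time, which Chebyshev's inequality makes arbitrarily small. Since the walk converges and the
    distance is continuous, such a subsequence suffices. *)
Lemma ae_dist_small : {ae P, forall w, forall k N, exists2 n, (N <= n)%N & r * dist (X n w : vec) <= k.+1%:R^-1}.
Proof.
apply/ae_foralln => k; apply/ae_foralln => N; set e : R := k.+1%:R^-1.
have e0 : 0 < e by rewrite invr_gt0.
have e20 : 0 < e ^+ 2 by rewrite exprn_gt0.
pose A n := [set w | e ^+ 2 < (r * dist (X n w : vec)) ^+ 2].
have mX n : measurable_fun setT (fun w => (r * dist (X n w : vec)) ^+ 2).
  by apply/measurable_EFinP; exact: (measurable_int P (integrable_sq_step n)).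
have mA n : measurable (A n).
  rewrite (_ : A n = (fun w => (r * dist (X n w : vec)) ^+ 2) @^-1` `]e ^+ 2, +oo[%classic).
    by rewrite -[X in measurable X]setTI; exact: mX.
  by apply/seteqP; split=> w; rewrite /A /= in_itv/= andbT.
exists (\bigcap_(n in [set n | (N <= n)%N]) A n); split.
- apply: bigcap_measurable => //; by exists N; rewrite /= leqnn.
- apply/eqP; rewrite eq_le measure_ge0 andbT; apply/lee_addgt0Pr => eps eps0; rewrite add0e.
  have [N' hN'] := tail_small (mulr_gt0 eps0 e20); pose n := maxn N N'.
  apply: (@le_trans _ _ (P (A n))).
    apply: le_measure; rewrite ?inE//; first by apply: bigcap_measurable => //; exists N; rewrite /= leqnn.
    by move=> w; apply; rewrite /= leq_maxl.
  apply: le_trans (chebyshev_le e20 (mX n) (integrable_sq_step n) _) _.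
    by move=> w; exact: sqr_ge0.
  (* [sq_step n] is the last term of the tail sum up to [n.+1], the upper end being excluded. *)
  rewrite lee_fin ler_pdivrMr//; apply: le_trans (hN' n.+1 _); last by rewrite leqW// leq_maxr.
  rewrite big_nat_recr ?leq_maxr//= lerDr; apply: sumr_ge0 => i _; exact: sq_step_ge0.
move=> w /= h n Nn; apply: contrapT => h'; apply: h; exists n => //.
rewrite leNgt; apply/negP => lt; apply: h'; rewrite /A /=.
rewrite ltr_pXn2r// ?nnegrE ?(ltW e0)// mulr_ge0 ?(ltW r_gt0)//.
exact: dist_ge0 d0 V_nonempty V_bounded V_open _.
Qed.

Lemma walk_converges (w : Omega) :
  (forall k, exists N, forall n, ~ exceed N n k.+1%:R^-1 w) ->
  cvgn (fun n => X n w : vec).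
Proof.
move=> h; apply/cauchy_cvgP/cauchy_exP => e e0.
have [k ke] : exists k, k.+1%:R^-1 < e :> R.
  by have [K _ /(_ K (leqnn K))] := near_infty_natSinv_lt (PosNum e0); exists K.
have [N hN] := h k; exists (X N w : vec); exists N => // n /= Nn.
rewrite -ball_normE /=; apply: le_lt_trans ke; apply: le_trans (ler_norm_eucl _) _.
rewrite eucl_distC leNgt; apply/negP => lt; apply: (hN n); exists n; first by rewrite /= Nn leqnn.
by rewrite /= -sqr_eucl_norm ltr_pXn2r// ?nnegrE ?eucl_norm_ge0 ?invr_ge0.
Qed.

Lemma walk_limit_boundary (w : Omega) (l : vec) :
  (forall k N, exists2 n, (N <= n)%N & r * dist (X n w : vec) <= k.+1%:R^-1) ->
  (X n w : vec) @[n --> \oo] --> l -> boundary V l.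
Proof.
move=> h lim.
apply: (dist_eq0 d0 V_nonempty V_bounded V_open); apply/eqP.
rewrite eq_le (dist_ge0 d0 V_nonempty V_bounded V_open) andbT.
rewrite -(pmulr_rle0 _ r_gt0); apply/ler_addgt0Pr => e e0; rewrite add0r.
have e20 : 0 < e / 2 by rewrite divr_gt0.
have [k ke] : exists k, k.+1%:R^-1 < e / 2 :> R.
  by have [K _ /(_ K (leqnn K))] := near_infty_natSinv_lt (PosNum e20); exists K.
have : r * dist (X n w : vec) @[n --> \oo] --> r * dist l.
  apply: cvgM; first exact: cvg_cst.
  exact: (cvg_comp _ _ lim (@continuous_dist R d V d0 V_nonempty V_bounded V_open l)).
move=> /cvgrPdist_lt/(_ _ e20)[N _ hN].
have [n Nn dn] := h k N; have := hN n Nn; rewrite /= => hn.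
have nn := ler_norm (r * dist l - r * dist (X n w : vec)).
have c1 := le_lt_trans nn hn; have c2 := le_lt_trans dn ke.
move: c1 c2; move: (r * dist l) (r * dist (X n w : vec)) => a b; lra.
Qed.

End Walk.

(** By Cauchy's criterion convergence is a countable combination of measurable conditions; off that
    set [lim] has a constant value. This makes the exit value measurable surely, not just almost
    surely. *)
Lemma sequence_limit_measurable {R : realType} {d : nat} (dd : measure_display)
    (T : measurableType dd) (y : nat -> T -> borelRd R d) :
  (forall n, measurable_fun setT (y n)) ->
  measurable_fun setT (fun w => lim ((y n w : 'rV[R]_d) @[n --> \oo]) : borelRd R d).
Proof.
move=> my; pose C := [set w | cvgn (fun n => y n w : 'rV[R]_d)].
have CE : C = \bigcap_k \bigcup_N \bigcap_(n in [set n | (N <= n)%N])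
    [set w | dot ((y n w : 'rV[R]_d) - y N w) ((y n w : 'rV[R]_d) - y N w) < k.+1%:R^-1 ^+ 2].
  have sq k n N w : dot ((y n w : 'rV[R]_d) - y N w) ((y n w : 'rV[R]_d) - y N w) < k.+1%:R^-1 ^+ 2
      <-> eucl_norm ((y n w : 'rV[R]_d) - y N w) < k.+1%:R^-1.
    by rewrite -sqr_eucl_norm ltr_pXn2r// ?nnegrE ?eucl_norm_ge0 ?invr_ge0.
  apply/seteqP; split=> w.
    move=> /cvg_ex[l yl] k _; have e0 : 0 < k.+1%:R^-1 / 2 :> R by rewrite divr_gt0.
    have nl : nbhs l (eucl_ball l (k.+1%:R^-1 / 2)) by apply/nbhs_eucl; exists (k.+1%:R^-1 / 2).
    have [N _ hN] := yl _ nl; exists N => // n /= Nn; apply/sq.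
    apply: le_lt_trans (eucl_dist_triangle _ l _) _.
    have := hN n Nn; have := hN N (leqnn N); rewrite /eucl_ball /= (eucl_distC l) => a b.
    by rewrite [ltRHS]splitr ltrD.
  move=> h; apply/cauchy_cvgP/cauchy_exP => e e0.
  have [k ke] : exists k, k.+1%:R^-1 < e :> R.
    by have [K _ /(_ K (leqnn K))] := near_infty_natSinv_lt (PosNum e0); exists K.
  have [N _ hN] := h k I; exists (y N w : 'rV[R]_d); exists N => // n /= Nn.
  rewrite -ball_normE /=; apply: le_lt_trans ke; apply: le_trans (ler_norm_eucl _) _.
  by rewrite eucl_distC ltW//; apply/sq; exact: hN.
have mC : measurable C.
  rewrite CE; apply: bigcap_measurableType => k _; apply: bigcup_measurable => N _.
  apply: bigcap_measurableType => n _.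
  have m := measurable_dot_pair (my n) (my N).
  rewrite (_ : [set w | _] = (fun w => dot ((y n w : 'rV[R]_d) - y N w) ((y n w : 'rV[R]_d) - y N w)) @^-1`
      `]-oo, (k.+1%:R^-1 ^+ 2)[%classic); first by rewrite -[X in measurable X]setTI; exact: m.
  by apply/seteqP; split=> w; rewrite /= in_itv.
(* [point] is the default value of [lim] on a divergent sequence, so the modified sequence converges
   everywhere to the same [lim]. *)
pose z n w : borelRd R d := if w \in C then y n w else (point : 'rV[R]_d).
apply: measurable_fun_coord => i; apply: (@measurable_fun_cvg _ _ _ _ (fun n w => (z n w : 'rV[R]_d) ord0 i)).
  move=> n; apply: (measurableT_comp (@coord_borel R d i)).
  apply: (@measurable_fun_ifT _ _ _ _ (y n) (cst (point : 'rV[R]_d)) (fun w => w \in C)) => //.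
  apply: (@measurable_fun_bool _ _ _ _ true).
  rewrite setTI (_ : _ @^-1` _ = C)//; apply/seteqP.
  by split=> w /=; rewrite -[_ = true]/(is_true _) inE.
move=> w _; have : (z n w : 'rV[R]_d) @[n --> \oo] --> lim ((y n w : 'rV[R]_d) @[n --> \oo]).
  rewrite /z; have [Cw|nCw] := pselect (C w); first by rewrite mem_set.
  rewrite memNset// dvgP//; exact: cvg_cst.
move=> h; exact: (cvg_comp _ _ h (@coord_continuous R 1 d ord0 i _)).
Qed.

(** * The expectation of the exit value *)

Section ExitValue.
Context {R : realType} {d : nat} {disp : measure_display} {Omega : measurableType disp}
  (P : probability Omega R) (theta : nat -> {RV P >-> borelRd R d}).
Hypotheses (theta_indep : mutually_independent theta)
  (theta_id : identically_distributed theta)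
  (sigma_unif : uniform_on_sphere (distribution P (theta 0))).
Local Notation vec := 'rV[R]_d.
Local Notation bRd := (borelRd R d).
Local Notation S := (@unit_sphere R d).
Local Notation sigma := (distribution P (theta 0)).
Local Notation M := (sphere_mean sigma).
Variables (V : set vec) (r : R) (v : vec).
Hypotheses (V_nonempty : V !=set0) (V_bounded : bounded_set V) (V_open : open V).
Hypotheses (r01 : 0 < r < 1) (Vv : V v).
Local Notation dist x := (eucl_dist x (boundary V)).
Local Notation X := (chain theta (free_step V r) (v : bRd)).
Variables (f u : vec -> R) (m : R).
Hypotheses (m_ge0 : 0 <= m) (f_cont : {within boundary V, continuous f})
  (u_cont : {within closure V, continuous u})
  (u_boundary : forall x, boundary V x -> u x = f x)
  (u_le : forall x, closure V x -> `|u x| <= m)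
  (u_mean : forall c (rho : R), 0 < rho -> eucl_cball c rho `<=` V ->
     u c = M (fun z => u (c + rho *: z))).

Let d0 : (0 < d)%N := dim_gt0 sigma_unif.

Lemma ae_unit : {ae P, forall w, forall n, S (theta n w)}.
Proof.
apply/ae_foralln => n; exists (theta n @^-1` (~` S)); split=> //.
  apply: measurable_preimage; first exact: measurable_theta.
  by apply: measurableC; exact: borel_unit_sphere.
have mS : measurable (~` S : set bRd) by apply: measurableC; exact: borel_unit_sphere.
apply: etrans (theta_law theta_id n mS) _; rewrite probability_setC//; last exact: borel_unit_sphere.
by case: sigma_unif => s1 _; rewrite [X in (1 - X)%E](_ : _ = 1%E) ?subee.
Qed.

(** When all directions are on the sphere the chain stays in [V] and the indicators in [move] are
    equal to one. *)
Lemma walk_path_chain w : (forall n, S (theta n w)) ->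
  walk_path V r v theta w = (fun n => X n w : vec).
Proof.
move=> Sw; apply/funext => n; elim: n => [//|n IH]; rewrite /walk_path/= -/(walk_path V r v theta w n) IH.
have Vx := free_in sigma_unif V_nonempty V_bounded V_open r01 Vv n w.
by rewrite /free_step/= moveE// mul1r.
Qed.

Lemma ae_walk : {ae P, forall w, exists2 l, boundary V l &
  walk_path V r v theta w = (fun n => X n w : vec) /\
  (X n w : vec) @[n --> \oo] --> l}.
Proof.
have h1 := ae_unit.
have h2 := ae_cauchy theta_indep theta_id sigma_unif V_nonempty V_bounded V_open r01 Vv.
have h3 := ae_dist_small theta_indep theta_id sigma_unif V_nonempty V_bounded V_open r01 Vv.
move: h1 h2 h3; apply: filterS3 => w h1 h2 h3.
have c := @walk_converges _ _ _ _ _ _ _ _ _ _ h2.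
exists (lim ((X n w : vec) @[n --> \oo])); last by split; [exact: walk_path_chain|exact: c].
exact: (walk_limit_boundary sigma_unif V_nonempty V_bounded V_open r01 h3 c).
Qed.

Lemma walk_limitE w l : walk_path V r v theta w = (fun n => X n w : vec) ->
  (X n w : vec) @[n --> \oo] --> l -> walk_limit V r v theta w = l.
Proof. by move=> e h; rewrite /walk_limit e; apply: cvg_lim. Qed.

(** [u] is controlled on the closure of [V] only; with the value zero elsewhere it becomes bounded
    and Borel on the whole space. *)
Definition extension : bRd -> R := patch (fun=> 0) (closure V) u.

Lemma measurable_extension : measurable_fun setT extension.
Proof.
have mc : measurable (closure V : set bRd) by apply: borel_closed; exact: closed_closure.
apply/(measurable_restrictT (u : bRd -> R) mc); exact: within_continuous_measurable.
Qed.

Lemma extension_le x : `|extension x| <= m.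
Proof.
rewrite /extension /patch; case: ifP => [/set_mem|_]; first exact: u_le.
by rewrite normr0.
Qed.

Lemma extensionE x : closure V x -> extension x = u x.
Proof. by move=> cx; rewrite /extension /patch mem_set. Qed.

(** As r < 1, the closed ball whose boundary carries the next position lies in [V], so the mean
    value property leaves the expectation unchanged in one step. *)
Lemma mean_extension n : \int[P]_w extension (X n w) = u v.
Proof.
have Xin k w := free_in sigma_unif V_nonempty V_bounded V_open r01 Vv k w.
elim: n => [|n IH].
  rewrite /= Rintegral_cst// [X in fine X](_ : _ = 1%E); last exact: probability_setT.
  by rewrite mulr1 extensionE//; apply: subset_closure.
(* The indicator makes the one-step identity hold for every state, inside [V] or not. *)
pose g (p : bRd * bRd) := \1_V (p.1 : vec) * extension (move V r 1 p.1 p.2).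
pose h (x : bRd) := \1_V (x : vec) * extension x.
have mV : measurable (V : set bRd) by exact: borel_open.
have mg : measurable_fun setT g.
  apply: measurable_funM; first exact: (measurableT_comp (@measurable_indic _ bRd R setT _ mV) measurable_fst).
  apply: (measurableT_comp measurable_extension).
  exact: (measurable_free_step sigma_unif r V_nonempty V_bounded V_open 0).
have gm p : `|g p| <= m.
  rewrite /g normrM; have /andP[i0 i1] : 0 <= (\1_V (p.1 : vec) : R) <= 1 := indic01 _ _.
  by rewrite ger0_norm// -[leRHS]mul1r ler_pM// extension_le.
have gh x : \int[sigma]_z g (x, z) = h x.
  have mgx : measurable_fun setT (fun z => g (x, z)) by apply: measurableT_comp => //; exact: measurable_pair1.
  rewrite (Rintegral_sphere sigma_unif mgx (fun z => gm (x, z))) /h.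
  have [Vx|nVx] := pselect (V x); last first.
    rewrite (@eq_sphere_mean _ _ sigma _ (fun=> 0)) ?sphere_mean_cst.
      by rewrite [\1_V (x : vec)]indicE memNset// mul0r.
      exact: sigma_unif.
    by move=> z _; rewrite /g /= [\1_V (x : vec)]indicE memNset// mul0r.
  rewrite [\1_V (x : vec)]indicE mem_set// mul1r extensionE; last exact: subset_closure.
  have rd : 0 < r * dist x by rewrite mulr_gt0 ?(dist_gt0 d0)//; case/andP: r01.
  rewrite (u_mean rd (cball_dist d0 V_nonempty V_bounded V_open r01 Vx)).
  apply: eq_sphere_mean => z Sz; rewrite /g /= [\1_V (x : vec)]indicE mem_set// mul1r.
  have Vm : V (move V r 1 x z) by apply: (move_in sigma_unif) => //; rewrite ler01 lexx.
  by rewrite extensionE; [rewrite moveE// mul1r|exact: subset_closure].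
have mP k := measurable_free_step sigma_unif r V_nonempty V_bounded V_open k.
have := chain_mean theta_indep theta_id (v : bRd) mP n mg gm gh.
have -> : \int[P]_w g (X n w, theta n w) = \int[P]_w extension (X n.+1 w).
  by apply: eq_Rintegral => w _; rewrite /g /= [\1_V (X n w : vec)]indicE mem_set ?mul1r.
move=> ->; rewrite -IH.
by apply: eq_Rintegral => w _; rewrite /h [\1_V (X n w : vec)]indicE mem_set ?mul1r.
Qed.

(** The exit value is defined through the unguarded walk, so its measurability cannot be taken from
    the chain, with which it agrees only almost surely. *)
Lemma measurable_walk n : measurable_fun setT (fun w => walk_path V r v theta w n : bRd).
Proof.
elim: n => [|n IH]; first exact: measurable_cst.
have md := measurableT_comp (measurable_dist sigma_unif V_nonempty V_bounded V_open) IH.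
apply: measurable_fun_coord => i.
have -> : (fun w => (walk_path V r v theta w n.+1 : vec) ord0 i) = fun w =>
    (walk_path V r v theta w n : vec) ord0 i + (r * dist (walk_path V r v theta w n : vec)) * (theta n w : vec) ord0 i.
  by apply/funext => w; rewrite /walk_path /= !mxE.
apply: measurable_funD; first exact: (measurableT_comp (@coord_borel R d i) IH).
apply: measurable_funM; first exact: measurable_funM.
exact: (measurableT_comp (@coord_borel R d i) (measurable_theta theta n)).
Qed.

Lemma measurable_exit_value : measurable_fun setT (exit_value V f r v theta).
Proof.
have mb : measurable (boundary V : set bRd) by apply: borel_closed; exact: closed_boundary.
have mp : measurable_fun setT (patch (cst 0) (boundary V) f : bRd -> R).
  apply/(measurable_restrictT (f : bRd -> R) mb); exact: within_continuous_measurable.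
exact: (measurableT_comp mp (sequence_limit_measurable measurable_walk)).
Qed.

Lemma exit_value_le w : `|exit_value V f r v theta w| <= m.
Proof.
rewrite /exit_value /patch; case: ifP => [/set_mem bl|_]; last by rewrite normr0.
by rewrite -u_boundary//; apply: u_le; exact: boundary_closure.
Qed.

Lemma exit_value_integrable : P.-integrable setT (EFin \o exit_value V f r v theta).
Proof. exact: bounded_integrable measurable_exit_value exit_value_le. Qed.

Lemma exit_well_defined : exit_value_well_defined V f r v theta.
Proof.
split; last exact: exit_value_integrable.
move: ae_walk; apply: filterS => w [l bl [e h]].
by rewrite (walk_limitE e h) e; split=> //; apply/cvg_ex; exists l.
Qed.

(** Dominated convergence with the constant [m]. The expectations do not depend on n, and the
    integrands converge because [u] is continuous up to the boundary, where it equals [f]. *)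
Lemma exit_mean : fine 'E_P[exit_value V f r v theta] = u v.
Proof.
have Xin k w := free_in sigma_unif V_nonempty V_bounded V_open r01 Vv k w.
have mX n := measurable_free sigma_unif r v V_nonempty V_bounded V_open n.
have mext n := measurableT_comp measurable_extension (mX n).
have iext n : P.-integrable setT (EFin \o (fun w => extension (X n w))).
  exact: (bounded_integrable P (mext n) (fun w => extension_le _)).
have ic : P.-integrable setT (EFin \o cst m).
  by apply: (@bounded_integrable _ _ _ P _ m) => // w; rewrite ger0_norm.
have cv : {ae P, forall w, setT w ->
    (extension (X n w))%:E @[n --> \oo] --> (exit_value V f r v theta w)%:E}.
  move: ae_walk; apply: filterS => w [l bl [e h]] _.
  rewrite /exit_value (walk_limitE e h) /patch mem_set// -u_boundary//.
  apply: cvg_EFin; first by near=> n.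
  apply/cvgrPdist_le => eps eps0.
  have [rho rho0 hrho] := (within_continuous_eucl _ _).1 u_cont l (boundary_closure bl) eps eps0.
  have nl : nbhs l (eucl_ball l rho) by apply/nbhs_eucl; exists rho.
  have [N _ hN] := h _ nl; exists N => // n /= Nn.
  have cX : closure V (X n w) by apply: subset_closure; exact: Xin.
  by rewrite extensionE//; apply: hrho => //; exact: (hN n Nn).
have dom w n : setT w -> (`|(extension (X n w))%:E| <= (EFin \o cst m) w)%E.
  by move=> _; rewrite lee_fin; exact: extension_le.
have [_ _ lim] := dominated_convergence measurableT
  (fun n => (measurable_EFinP _ _).2 (mext n)) ((measurable_EFinP _ _).2 measurable_exit_value)
  cv ic (aeW _ dom).
have E n : (\int[P]_(w in setT) (extension (X n w))%:E)%E = (u v)%:E.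
  rewrite -(mean_extension n) /Rintegral fineK//.
  exact: integrable_fin_num (iext n).
rewrite unlock; have := cvg_lim (@ereal_hausdorff R) lim.
rewrite (_ : (fun n => _) = fun=> (u v)%:E); last by apply/funext => n; exact: E.
by rewrite lim_cst// => h; have <- := h _.
Unshelve. all: by end_near. Qed.

End ExitValue.

(** * The walk solves the Dirichlet problem *)

Theorem mainTheorem2 (R : realType) (d : nat)
    (disp : measure_display) (Omega : measurableType disp)
    (P : probability Omega R)
    (theta : nat -> {RV P >-> borelRd R d})
    (theta_indep : mutually_independent theta)
    (theta_id : identically_distributed theta)
    (theta_unif : forall n, uniform_on_sphere (distribution P (theta n)))
    (V : set 'rV[R]_d) (V_nonempty : V !=set0) (V_bounded : bounded_set V)
    (V_open : open V)
    (V_poincare : forall v, boundary V v -> poincare_condition V v)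
    (f : 'rV[R]_d -> R) (f_cont : {within boundary V, continuous f}) :
  [/\ (forall r v, 0 < r < 1 -> V v -> exit_value_well_defined V f r v theta),
      (forall r s v, 0 < r < 1 -> 0 < s < 1 -> closure V v ->
        walk_solution V f r theta v = walk_solution V f s theta v) &
      (forall r, 0 < r < 1 -> dirichlet_solution V f (walk_solution V f r theta))].
Proof.
have [u [[u_cont u_bd u_C2 u_lap] [m m0 u_le] u_mean]] :=
  dirichlet_existence (theta_unif 0%N) V_open V_bounded f_cont V_poincare.
have hE r x : 0 < r < 1 -> closure V x -> walk_solution V f r theta x = u x.
  move=> r01 /(closure_cases V_open)[Vx|bx]; rewrite /walk_solution.
    rewrite memNset; last by move=> /(boundary_notin V_open).
    exact: (exit_mean theta_indep theta_id (theta_unif 0%N) V_nonempty V_bounded V_open r01 Vx m0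
      f_cont u_cont u_bd u_le u_mean).
  by rewrite mem_set// u_bd.
split.
- move=> r x r01 Vx.
  exact: (exit_well_defined theta_indep theta_id (theta_unif 0%N) V_nonempty V_bounded V_open r01 Vx m0
    f_cont u_bd u_le).
- by move=> r s x r01 s01 cx; rewrite !hE.
(* The walk solution is known to agree with [u] on the closure of [V] only; derivatives at a point
   of [V] carry over because [V] is a neighbourhood of it. *)
move=> r r01; have near_u x : V x -> \forall y \near x, u y = walk_solution V f r theta y.
  move=> Vx; near=> y; rewrite hE//; apply: subset_closure; near: y.
  exact: open_nbhs_nbhs.
split.
- apply/within_continuous_eucl => x cx e e0.
  have [rho rho0 h] := (within_continuous_eucl _ _).1 u_cont x cx e e0.
  by exists rho => // y cy xy; rewrite !hE//; exact: h.
- by move=> x bx; rewrite hE ?u_bd//; exact: boundary_closure.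
- by move=> x Vx; apply: (C2_near_eq (near_u x Vx)); exact: u_C2.
by move=> x Vx; rewrite -(laplacian_near_eq (near_u x Vx)) u_lap.
Unshelve. all: by end_near. Qed.
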